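(* Let $X(t)$ and $Y(t)$ be the processes defined for $t\in[0,+\infty)$ by $$X(t)=\int_0^t \cos(x(t)-x(s))\,u(s)\,ds,\qquad Y(t)=\int_0^t \sin(x(t)-x(s))\,u(s)\,ds,$$ where $x$ is the It\^o process $dx(t)=a(t)\,dt+\sigma(t)\,dw(t)$ and $u$ is the integrable adapted process described in the context. Then for every $t\ge 0$, almost surely, $$\int_0^t X(s)\,dx(s)=Y(t)+\frac12\int_0^t\sigma(s)^2\,Y(s)\,ds .$$ Moreover, for every choice of the drift process $a(\cdot)$ and every $t\ge 0$, $$\sqrt{X(t)^2+Y(t)^2}\le\int_0^t|u(s)|\,ds\quad\text{almost surely.}$$
   Context: Let $(\Omega,\mathcal F,\mathbf P)$ be a complete probability space with a right-continuous filtration $\{\mathcal F_t\}_{t\ge0}$ of complete $\sigma$-algebras, and let $w(t)|_{t\ge0}$ be a one-dimensional Wiener process adapted to $\{\mathcal F_t\}$ with $w(0)=0$ and such that $\mathcal F_t$ is independent of $w(s)-w(q)$ whenever $s>q\ge t\ge 0$. The process $x(t)|_{t\ge0}$ is a continuous one-dimensional $\mathcal F_t$-adapted process with $dx(t)=a(t)\,dt+\sigma(t)\,dw(t)$, where $a(t)$ and $\sigma(t)$ are bounded real-valued $\mathcal F_t$-adapted processes. The process $u(t):(0,+\infty)\to\mathbf R$ is a real-valued random $\mathcal F_t$-adapted process that is integrable on any finite time interval, and it is assumed that $\operatorname{ess\,sup}_{\omega\in\Omega}\int_0^t|u(s)|\,ds<+\infty$ for any $t>0$. The processes $a,\sigma,u$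 are understood to be measurable in $(t,\omega)$ in the usual sense (progressively measurable), so that all integrals are well defined. The integral $\int_0^t X(s)\,dx(s)$ means $\int_0^t X(s)a(s)\,ds+\int_0^t X(s)\sigma(s)\,dw(s)$, the last integral being an It\^o integral. *)

(* Defs.v *)
From HB Require Import structures.
From mathcomp Require Import all_boot all_order all_algebra.
From mathcomp Require Import all_classical all_reals all_analysis.
Set Implicit Arguments.
Unset Strict Implicit.
Unset Printing Implicit Defensive.
Import Order.TTheory GRing.Theory Num.Theory.
Import numFieldNormedType.Exports.
Local Open Scope classical_set_scope.
Local Open Scope ring_scope.

(* A process is a function [H : R -> T -> R] of time and outcome; its values at
   negative times are irrelevant everywhere below. *)

Section processes.
Context {R : realType} {d : measure_display} {T : measurableType d}.
Variables (P : probability T R) (F : R -> set (set T)).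
Implicit Types (w a sigma x H : R -> T -> R) (f I J : T -> R) (t : R).

(* The usual conditions: increasing, complete and right-continuous. *)
Definition usual_filtration : Prop :=
  [/\ forall t, 0 <= t -> sigma_algebra setT (F t) /\ F t `<=` measurable,
      forall s t, 0 <= s -> s <= t -> F s `<=` F t,
      forall t, 0 <= t -> P.-negligible `<=` F t
    & forall t, 0 <= t ->
        F t = [set A | forall s, t < s -> F s A] ].

Definition measurable_at t f : Prop :=
  measurable_fun setT (f : g_sigma_algebraType (F t) -> R).

Definition adapted H : Prop := forall t, 0 <= t -> measurable_at t (H t).

(* [D] is the time set of the process, `[0, +oo[ or `]0, +oo[. *)
Definition progressive (D : set R) H : Prop :=
  forall t, 0 <= t ->
    measurable_fun ((D `&` `[0, t]) `*` setT)
      (fun p : measurableTypeR R * g_sigma_algebraType (F t) => H p.1 p.2).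

Definition bounded_process H : Prop :=
  exists C : R, forall t (omega : T), 0 <= t -> `|H t omega| <= C.

Definition continuous_paths H : Prop :=
  forall omega, {within `[0, +oo[, continuous (fun t => H t omega)}.

(* Wiener process with respect to [F]. The independence of the increments of [w]
   follows from adaptedness and the last clause. *)
Definition wiener w : Prop :=
  [/\ adapted w, continuous_paths w, forall omega, w 0 omega = 0,
      (forall q s, 0 <= q -> q < s -> forall B : set R, measurable B ->
        P [set omega | B (w s omega - w q omega)]
        = normal_prob 0 (Num.sqrt (s - q)) B)
    & (forall t q s, 0 <= t -> t <= q -> q < s ->
        forall (A : set T) (B : set R), F t A -> measurable B ->
        P (A `&` [set omega | B (w s omega - w q omega)])
        = (P A * P [set omega | B (w s omega - w q omega)%R])%E) ].

(* The bounded elementary process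
   \sum_(i < n) coef i * 1_{]time i, time i.+1]}. *)
Record simple_process := SimpleProcess {
  sp_size : nat ;
  sp_time : nat -> R ;
  sp_coef : nat -> T -> R ;
  sp_time_ge0 : 0 <= sp_time 0%N ;
  sp_time_le : forall i, sp_time i <= sp_time i.+1 ;
  sp_coef_meas : forall i, measurable_at (sp_time i) (sp_coef i) ;
  sp_coef_bounded : forall i, exists C : R, forall omega,
    `|sp_coef i omega| <= C }.

Definition simple_value (S : simple_process) (s : R) (omega : T) : R :=
  \sum_(i < sp_size S)
    sp_coef S i omega * \1_(`]sp_time S i, sp_time S i.+1]%classic) s.

Definition simple_integral w (S : simple_process) t (omega : T) : R :=
  \sum_(i < sp_size S) sp_coef S i omega *
    (w (Num.min (sp_time S i.+1) t) omega - w (Num.min (sp_time S i) t) omega).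

(* [I] is a version of the Ito integral of [H] against [w] over [0, t], for a
   progressive [H] with E \int_0^t H^2 < +oo: the L^2(P) limit of the integrals
   of simple processes converging to [H] in L^2(dt x P). *)
Definition is_ito_integral w H t I : Prop :=
  [/\ progressive `[0, +oo[ H,
      (\int[P]_omega \int[lebesgue_measure]_(s in `]0%R, t])
         ((H s omega) ^+ 2)%:E < +oo)%E,
      measurable_fun setT I
    & exists S : nat -> simple_process,
        (\int[P]_omega \int[lebesgue_measure]_(s in `]0%R, t])
           ((simple_value (S n) s omega - H s omega) ^+ 2)%:E)%E
          @[n --> \oo] --> 0%E
        /\
        (\int[P]_omega ((simple_integral w (S n) t omega - I omega) ^+ 2)%:E)%E
          @[n --> \oo] --> 0%E ].

(* dx = a dt + sigma dw *)
Definition ito_process w a sigma x : Prop :=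
  forall t, 0 <= t -> exists2 I, is_ito_integral w sigma t I &
    {ae P, forall omega, x t omega = x 0 omega
      + \int[lebesgue_measure]_(s in `]0, t]) a s omega + I omega}.

(* [J] is a version of the integral of [H] over [0, t] against a process with
   stochastic differential a dt + sigma dw. *)
Definition is_ito_process_integral w a sigma H t J : Prop :=
  exists2 I, is_ito_integral w (fun s omega => H s omega * sigma s omega) t I &
    {ae P, forall omega,
      lebesgue_measure.-integrable `]0, t]
        (fun s => (H s omega * a s omega)%:E) /\
      J omega = \int[lebesgue_measure]_(s in `]0, t]) (H s omega * a s omega)
                + I omega}.

End processes.

(* Main.v *)
Require Import Defs.
From HB Require Import structures.
From mathcomp Require Import all_boot all_order all_algebra.
From mathcomp Require Import all_classical all_reals all_analysis.
From mathcomp Require Import measurable_realfun ess_sup_inf ring lra.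
Set Implicit Arguments.
Unset Strict Implicit.
Unset Printing Implicit Defensive.
Import Order.TTheory GRing.Theory Num.Theory.
Import numFieldNormedType.Exports.
Local Open Scope classical_set_scope.
Local Open Scope ring_scope.

(** Differentiating the convolution integrals gives formally
    dY = X dx - (1/2) sigma^2 Y dt, which is the claimed identity. It is proved
    without Ito's formula. For a partition of [0, t] the addition formulas give
    the exact recursion Y_{k+1} = X_k sin D_k + Y_k cos D_k + R_k, where
    D_k = x_{k+1} - x_k and R_k = \int_{t_k}^{t_{k+1}} sin(x_{k+1} - x(s)) u(s) ds,
    so Taylor expansion expresses \sum_k X_k D_k through Y(t) and
    (1/2) \sum_k Y_k D_k^2, up to errors controlled by the path. On cells where a
    simple approximation of sigma has value c_k, D_k is the drift, plus c_k times
    the Wiener increment, plus a martingale error. The errors and the compensated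
    squares c_k^2 ((Delta w)^2 - h_k) are orthogonal with small second moments;
    along partitions for which these moments are summable the sums
    \sum_k X_k c_k Delta_k w converge almost surely to
    Y(t) + (1/2) \int sigma^2 Y ds - \int X a ds. By the Ito isometry they are
    Cauchy in L^2(P), hence converge there too, and they are the integrals of
    simple processes converging to X sigma, so the limit is the Ito integral.
    The second claim is Cauchy-Schwarz: X^2 + Y^2 =
    \int (X cos + Y sin) u <= (X^2 + Y^2)^(1/2) \int |u|. *)

(** * Densities and normal moments *)

Import HBNNSimple.

(** Three obstacles shape the proof. First, [sigma] is only progressive, so its values at partition
    points carry no information; each partition refines a simple process close to [sigma] in L^2(dt
    x P), and the mesh is chosen after that process, because the bound of its coefficients may grow
    along the sequence. Hence the constant of the estimate along a path must not involve this bound.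
    Secondly, the integral of [sigma] up to each time is known only almost surely, with no
    continuity in time; only the countably many partition times are used, and its increments are
    handled through a second simple process, arbitrarily close to [sigma], for which the isometry is
    exact. Thirdly, X and Y are bounded only almost surely, whereas coefficients of simple processes
    are bounded everywhere; X and Y are truncated, and the truncation is removed at the end. One
    number bounds the expectation of all errors together, so a single summable sequence makes them
    all vanish on almost every path, and the estimate along the path is linear in one small
    parameter. *)

Section density.
Local Open Scope ereal_scope.
Context d (T : measurableType d) (R : realType).
Variables (mu nu : {measure set T -> \bar R}) (p : T -> R).
Hypotheses (mp : measurable_fun setT p) (p0 : forall x, (0 <= p x)%R).
Hypothesis nuE : forall A, measurable A -> nu A = \int[mu]_(x in A) (p x)%:E.

(** Both sides pass to the limit along simple approximations of [f] by monotone convergence; for a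
    simple function the identity is [nuE] on each level set, summed. *)
Lemma ge0_integral_density (f : T -> \bar R) :
  measurable_fun setT f -> (forall x, 0 <= f x) ->
  \int[nu]_x f x = \int[mu]_x (f x * (p x)%:E).
Proof.
move=> mf f0; pose f_ := nnsfun_approx measurableT mf.
transitivity (limn (fun n => \int[nu]_x (f_ n x)%:E)).
  rewrite -monotone_convergence//.
  - apply: eq_integral => y _; apply/esym/cvg_lim => //.
    by apply: cvg_nnsfun_approx => // *; exact: f0.
  - by move=> n; exact/measurable_EFinP/measurable_funP.
  - by move=> n y _; rewrite lee_fin.
  - by move=> y _ m n mn; rewrite lee_fin; exact/lefP/nd_nnsfun_approx.
rewrite (_ : (fun n => _) = fun n => \int[mu]_x ((f_ n x)%:E * (p x)%:E)).
  rewrite -monotone_convergence//.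
  - apply: eq_integral => y _; apply/cvg_lim => //.
    apply: cvgeZr => //.
    by apply: cvg_nnsfun_approx => // *; exact: f0.
  - move=> n; apply: emeasurable_funM; last exact/measurable_EFinP.
    exact/measurable_EFinP/measurable_funP.
  - by move=> n y _; rewrite mule_ge0// lee_fin.
  - move=> y _ m n mn; rewrite lee_wpmul2r ?lee_fin//.
    exact/lefP/nd_nnsfun_approx.
apply/funext => n.
rewrite integral_nnsfun// sintegralE.
have -> : (f_ n \_ setT) = f_ n :> (T -> R).
  by apply/funext => x; rewrite patchE in_setT.
transitivity (\int[mu]_x (\sum_(k \in range (f_ n))
    (k%:E * (p x * \1_(f_ n @^-1` [set k]) x)%:E))); last first.
  apply: eq_integral => x _; rewrite fimfunE -fsumEFin//.
  rewrite ge0_mule_fsuml; last by move=> r; rewrite nnfun_muleindic_ge0.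
  by apply: eq_fsbigr => r _; rewrite -!EFinM mulrAC mulrA.
rewrite ge0_integral_fsum//; last 2 first.
- move=> r; apply: emeasurable_funM => //; apply/measurable_EFinP.
  exact: measurable_funM.
- move=> r x _; rewrite -EFinM lee_fin mulrCA mulr_ge0//.
  by have := nnfun_muleindic_ge0 (f_ n) r x; rewrite -EFinM lee_fin.
apply: eq_fsbigr => r rf.
have r0 : (0 <= r)%R by move: rf; rewrite inE => -[x _ <-].
rewrite ge0_integralZl//; last first.
- by move=> x _; rewrite lee_fin mulr_ge0.
- by apply/measurable_EFinP; exact: measurable_funM.
congr (_ * _); rewrite nuE//.
rewrite integral_mkcond; apply: eq_integral => x _.
by rewrite patchE indicE; case: ifPn => _; rewrite ?mulr1 ?mulr0.
Qed.

End density.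

Section normal_moments.
Context {R : realType}.
Variable s : R.
Hypothesis s0 : 0 < s.
Local Notation mu := (@lebesgue_measure R).
Local Notation p := (normal_pdf 0 s).

Let sn0 : s != 0. Proof. exact: lt0r_neq0. Qed.

Let pE x : p x = normal_peak s * expR (- (x ^+ 2 / (s ^+ 2 *+ 2))).
Proof. by rewrite normal_pdfE// /normal_fun subr0 mulNr. Qed.

Let cont_p : continuous p. Proof. exact: continuous_normal_pdf. Qed.

Let is_derive_p (x : R) : is_derive x 1 (p : R^o -> R^o) (- (x / s ^+ 2) * p x).
Proof.
have -> : (p : R^o -> R^o) =
    (fun x => normal_peak s * expR (- (x ^+ 2 / (s ^+ 2 *+ 2)))).
  by apply/funext => y; rewrite pE.
apply: is_derive_eq.
rewrite ?pE /GRing.scale/= !mulr1.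
by field.
Qed.

(** The bound e^y >= 1 + y at y = n^2 / (2 s^2) turns the Gaussian factor into one of order 1 /
    n^2. *)
Let cvg_xp : (n%:R * p n%:R) @[n --> \oo] --> (0 : R).
Proof.
apply: (@squeeze_cvgr _ _ _ _ (fun=> 0)
    (fun n => normal_peak s * (s ^+ 2 *+ 2) * (n%:R^-1 : R))).
- near=> n.
  have n0 : (0 : R) < n%:R by rewrite ltr0n; near: n; exact: nbhs_infty_gt.
  rewrite mulr_ge0 ?normal_pdf_ge0 ?ler0n//= pE mulrCA -mulrA.
  rewrite ler_wpM2l ?normal_peak_ge0// expRN ler_pdivrMr ?expR_gt0//.
  have s20 : 0 < s ^+ 2 *+ 2 by rewrite pmulrn_lgt0// exprn_gt0.
  set S := s ^+ 2 *+ 2 in s20 *; clearbody S.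
  have := expR_ge1Dx (n%:R ^+ 2 / S) => e1.
  apply: (@le_trans _ _ (S / n%:R * (n%:R ^+ 2 / S))).
    rewrite le_eqVlt; apply/orP; left; apply/eqP; field.
    by rewrite !lt0r_neq0.
  by apply: ler_wpM2l; [rewrite divr_ge0// ltW|apply: le_trans e1; rewrite lerDr].
- exact: cvg_cst.
- rewrite -(mulr0 (normal_peak s * (s ^+ 2 *+ 2))); apply: cvgM; first exact: cvg_cst.
  apply/gtr0_cvgV0; last exact/cvgrnyP.
  by near=> n; rewrite ltr0n; near: n; exact: nbhs_infty_gt.
Unshelve. all: by end_near. Qed.

(** Integration by parts in disguise: -s^2 x p(x) is a primitive of (x^2 - s^2) p(x), because p' =
    -(x / s^2) p. *)
Let sqr_part (n : nat) : (0 < n)%N ->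
  (\int[mu]_(x in `[0%R, n%:R]) ((x ^+ 2 * p x)%:E) =
   (s ^+ 2)%:E * \int[mu]_(x in `[0%R, n%:R]) (p x)%:E
     - (s ^+ 2 * (n%:R * p n%:R))%:E)%E.
Proof.
move=> n0.
have n0' : (0 : R) < n%:R by rewrite ltr0n.
pose f (x : R) : R := (x ^+ 2 - s ^+ 2) * p x.
pose F (x : R) : R := - s ^+ 2 * (x * p x).
have dF (x : R) : is_derive x 1 (F : R^o -> R^o) (f x).
  have dp := is_derive_p x; rewrite /F; apply: is_derive_eq.
  rewrite /GRing.scale/= !mulr1 /f. by field.
have cf : continuous f.
  move=> x; apply: cvgM; last exact: cont_p.
  apply: cvgB; last exact: cvg_cst.
  exact: exprn_continuous.
have cF : continuous F.
  move=> x; apply: differentiable_continuous; apply/derivable1_diffP.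
  by case: (dF x).
have ip : mu.-integrable `[0, n%:R] (EFin \o p).
  by apply: (integrableS _ _ (@subsetT _ _)) => //; exact: integrable_normal_pdf.
have iX : mu.-integrable `[0, n%:R] (EFin \o f).
  apply: continuous_compact_integrable; first exact: segment_compact.
  exact: continuous_subspaceT.
transitivity (\int[mu]_(x in `[0%R, n%:R]) ((f x)%:E + (s ^+ 2 * p x)%:E))%E.
  by apply: eq_integral => x _; rewrite -EFinD /f; congr (_%:E); ring.
rewrite integralD//; last first.
  by rewrite (_ : (fun x => _) = fun x => ((s ^+ 2)%:E * (p x)%:E)%E)//;
    exact: integrableZl.
rewrite (@continuous_FTC2 _ f F 0 n%:R)//; first last.
- by move=> x _; rewrite derive1E; have [_ ->] := dF x.
- split; first by move=> x _; case: (dF x).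
  + exact/cvg_at_right_filter/cF.
  + exact/cvg_at_left_filter/cF.
- exact: continuous_subspaceT.
rewrite {2}/F mul0r mulr0 sube0 addeC; congr (_ + _)%E.
  under eq_integral do rewrite EFinM.
  by rewrite integralZl.
by rewrite /F mulNr EFinN.
Qed.

(** By symmetry only the half-line counts. There [sqr_part] is passed to the limit, the boundary
    term vanishing by [cvg_xp]. *)
Lemma normal_second_moment : (\int[mu]_x ((x ^+ 2 * p x)%:E) = (s ^+ 2)%:E)%E.
Proof.
rewrite ge0_symfun_integralT; first last.
- by move=> x /=; rewrite !pE sqrrN.
- by move=> x; apply: cvgM; [exact: exprn_continuous|exact: cont_p].
- by move=> x; rewrite mulr_ge0 ?sqr_ge0 ?normal_pdf_ge0.
have : (\int[mu]_x (p x)%:E = 1)%E by rewrite integral_normal_pdf.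
rewrite ge0_symfun_integralT; first last.
- by move=> x /=; rewrite !pE sqrrN.
- exact: cont_p.
- by move=> x; rewrite normal_pdf_ge0.
rewrite -set_itvcy.
have h1 : (\int[mu]_(x in `[0%R, n%:R]) (p x)%:E)%E @[n --> \oo] -->
    (\int[mu]_(x in `[0%R, +oo[) (p x)%:E)%E.
  apply: ge0_cvgn_integral => [x|]; first exact: normal_pdf_ge0.
  by apply: measurable_funTS; exact: measurable_normal_pdf.
have h2 : (\int[mu]_(x in `[0%R, n%:R]) (x ^+ 2 * p x)%:E)%E @[n --> \oo] -->
    (\int[mu]_(x in `[0%R, +oo[) (x ^+ 2 * p x)%:E)%E.
  apply: (@ge0_cvgn_integral R mu (fun x => x ^+ 2 * p x)) => [x|].
    by rewrite mulr_ge0 ?sqr_ge0 ?normal_pdf_ge0.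
  apply: measurable_funM; first exact: exprn_measurable.
  by apply: measurable_funTS; exact: measurable_normal_pdf.
set I := (\int[mu]_(x in `[0%R, +oo[) (p x)%:E)%E in h1 *.
set J := (\int[mu]_(x in `[0%R, +oo[) (x ^+ 2 * p x)%:E)%E in h2 *.
move=> I1.
have Ifin : I \is a fin_num.
  apply: integrable_fin_num => //.
  by apply: (integrableS _ _ (@subsetT _ _)) => //; exact: integrable_normal_pdf.
suff -> : J = ((s ^+ 2)%:E * I)%E by rewrite muleCA I1 mule1.
apply: (cvg_unique _ h2) => //.
have h3 : ((s ^+ 2)%:E * \int[mu]_(x in `[0%R, n%:R]) (p x)%:E
     - (s ^+ 2 * (n%:R * p n%:R))%:E)%E @[n --> \oo] --> ((s ^+ 2)%:E * I)%E.
  rewrite -[X in _ --> X]sube0; apply: cvgeB => //.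
  - by rewrite fin_num_adde_defl.
  - by apply: cvgeZl.
  - apply: cvg_EFin; first by near=> n.
    by rewrite -[X in _ --> X](mulr0 (s ^+ 2)); apply: cvgM; [exact: cvg_cst|exact: cvg_xp].
apply: cvg_trans h3; apply: near_eq_cvg; near=> n.
by rewrite sqr_part//; near: n; exact: nbhs_infty_gt.
Unshelve. all: by end_near. Qed.

End normal_moments.

Section normal_rv.
Context {R : realType} d (T : measurableType d) (P : probability T R).
Variables (s : R) (D : T -> R).
Hypothesis s0 : 0 < s.
Hypothesis mD : measurable_fun setT D.
Hypothesis DN : forall B : set R, measurable B ->
  P (D @^-1` B) = normal_prob 0 s B.
Local Notation mu := (@lebesgue_measure R).
Local Notation p := (normal_pdf 0 s).

Lemma normal_rv_integral (g : R -> \bar R) :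
  measurable_fun setT g -> (forall x, 0 <= g x)%E ->
  (\int[P]_x g (D x) = \int[mu]_x (g x * (p x)%:E))%E.
Proof.
move=> mg g0.
rewrite -(@ge0_integral_density _ _ _ mu
   (pushforward P (D : _ -> measurableTypeR R)))//.
- by rewrite ge0_integral_pushforward.
- exact: measurable_normal_pdf.
- by move=> x; exact: normal_pdf_ge0.

Qed.

Let normal_pdfN x : p (- x) = p x.
Proof. by rewrite !normal_pdfE ?lt0r_neq0// /normal_fun !subr0 sqrrN. Qed.

Lemma normal_rv_sqr : (\int[P]_x ((D x) ^+ 2)%:E = (s ^+ 2)%:E)%E.
Proof.
rewrite (@normal_rv_integral (fun x => (x ^+ 2)%:E)).
- by rewrite -normal_second_moment//; apply: eq_integral => x _; rewrite EFinM.
- by apply/measurable_EFinP; exact: exprn_measurable.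
- by move=> x; rewrite lee_fin sqr_ge0.
Qed.

(** Only the order s^4 matters, so no exact fourth moment is computed: x^4 times the density of
    parameter [s] is at most 64 s^4 times the density of parameter [2 * s], whose integral is 1. *)
Lemma normal_rv_pow4 :
  (\int[P]_x ((D x) ^+ 4)%:E <= (64 * s ^+ 4)%:E)%E.
Proof.
rewrite (@normal_rv_integral (fun x => (x ^+ 4)%:E)); last 2 first.
- by apply/measurable_EFinP; exact: exprn_measurable.
- by move=> x; rewrite lee_fin (@exprM _ x 2 2) sqr_ge0.
have h : (\int[mu]_x ((64 * s ^+ 4) * normal_pdf 0 (2 * s) x)%:E = (64 * s ^+ 4)%:E)%E.
  under eq_integral do rewrite EFinM.
  rewrite integralZl//; first by rewrite integral_normal_pdf mule1.
  exact: integrable_normal_pdf.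
rewrite -h; apply: ge0_le_integral => //.
- move=> x _; rewrite mule_ge0 ?lee_fin ?normal_pdf_ge0//.
  by rewrite (@exprM _ x 2 2) sqr_ge0.
- apply/measurable_EFinP; apply: measurable_funM; first exact: exprn_measurable.
  exact: measurable_normal_pdf.
- apply/measurable_EFinP; apply: measurable_funM => //.
  exact: measurable_normal_pdf.
move=> x _; rewrite -EFinM lee_fin !normal_pdfE ?mulf_neq0 ?lt0r_neq0//.
have -> : normal_peak s = 2 * normal_peak (2 * s).
  rewrite /normal_peak.
  rewrite (_ : (2 * s) ^+ 2 * pi *+ 2 = 2 ^+ 2 * (s ^+ 2 * pi *+ 2)); last by ring.
  by rewrite (sqrtrM _ (sqr_ge0 2)) sqrtr_sqr ger0_norm// invfM mulrA divff// mul1r.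
rewrite /normal_fun !subr0 !mulNr.
(* [z] is half the gap between the two Gaussian exponents. Then x^4 = (256 / 9) s^4 z^2 and z^2
   e^(-2z) <= 1, which leaves the factor 512 / 9 <= 64. *)
set z : R := 3 * x ^+ 2 / (16 * s ^+ 2).
have z0 : 0 <= z by rewrite divr_ge0// mulr_ge0// sqr_ge0.
have -> : x ^+ 2 / (s ^+ 2 *+ 2) = x ^+ 2 / ((2 * s) ^+ 2 *+ 2) + 2 * z.
  by rewrite /z; field; rewrite lt0r_neq0.
have -> : x ^+ 4 = (256 / 9) * s ^+ 4 * z ^+ 2.
  by rewrite /z; field; rewrite lt0r_neq0.
rewrite opprD expRD mulrCA.
set e := expR (- (_ / _)); set k := normal_peak _.
have e0 : 0 <= e by exact: expR_ge0.
have k0 : 0 <= k by exact: normal_peak_ge0.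
have ez : z ^+ 2 * expR (- (2 * z)) <= 1.
  rewrite expRN ler_pdivrMr ?expR_gt0// mul1r mulr_natl.
  rewrite (_ : z *+ 2 = z + z) ?mulr2n// expRD -expr2.
  rewrite ler_sqr ?nnegrE ?expR_ge0//.
  by apply: le_trans (expR_ge1Dx z); rewrite lerDr.
have s40 : 0 <= s ^+ 4 by rewrite exprn_ge0// ltW.
have -> : 2 * k * (256 / 9 * s ^+ 4 * z ^+ 2 * (e * expR (- (2 * z)))) =
   (512 / 9 * (z ^+ 2 * expR (- (2 * z)))) * (s ^+ 4 * (k * e)) by field.
rewrite -[leRHS]mulrA; apply: ler_wpM2r.
  by apply: mulr_ge0 => //; apply: mulr_ge0.
by move: ez; set y := z ^+ 2 * _ => ez; clearbody y; lra.
Qed.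

Lemma normal_rv_integrable2 : P.-integrable setT (fun x => ((D x) ^+ 2)%:E).
Proof.
apply/integrableP; split.
  by apply/measurable_EFinP; exact: measurable_funX.
under eq_integral do rewrite gee0_abs ?lee_fin ?sqr_ge0//.
by rewrite normal_rv_sqr ltry.
Qed.

Lemma normal_rv_integrable : P.-integrable setT (fun x => (D x)%:E).
Proof.
apply: (@le_integrable _ _ _ _ _ _ _ (fun x => 1%:E + ((D x) ^+ 2)%:E)%E) => //.
- exact/measurable_EFinP.
- move=> x _; rewrite -EFinD !abse_EFin lee_fin [leRHS]ger0_norm ?addr_ge0 ?sqr_ge0//.
  rewrite -[D x ^+ 2]real_normK ?num_real//.
  have := normr_ge0 (D x); move: `|D x| => y y0.
  by have := sqr_ge0 (y - 1); rewrite sqrrB1 => ?; nra.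
- apply: integrableD => //; last exact: normal_rv_integrable2.
  exact: finite_measure_integrable_cst.
Qed.

(** Reflection preserves Lebesgue measure and the density, so the positive and the negative part
    have the same integral; it is finite, hence they cancel. *)
Lemma normal_rv_mean : (\int[P]_x (D x)%:E = 0)%E.
Proof.
rewrite integralE.
have mpos : measurable_fun setT (fun x : R => (Num.max x 0)%:E).
  by apply/measurable_EFinP; exact: measurable_maxr.
have mneg : measurable_fun setT (fun x : R => (Num.max (- x) 0)%:E).
  by apply/measurable_EFinP; apply: measurable_maxr.
have -> : (\int[P]_x (fun x => (D x)%:E)^\+ x = \int[P]_x (Num.max (D x) 0)%:E)%E.
  by apply: eq_integral => x _; rewrite funeposE -EFin_max.
have -> : (\int[P]_x (fun x => (D x)%:E)^\- x = \int[P]_x (Num.max (- D x) 0)%:E)%E.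
  by apply: eq_integral => x _; rewrite funenegE -EFinN -EFin_max.
have mx0 (x : R) : (0 <= (Num.max x 0)%:E)%E by rewrite lee_fin le_max lexx orbT.
rewrite (@normal_rv_integral (fun x => (Num.max x 0)%:E))//.
rewrite (@normal_rv_integral (fun x => (Num.max (- x) 0)%:E))//.
have e : (\int[mu]_x ((Num.max x 0)%:E * (p x)%:E) =
          \int[mu]_x ((Num.max (- x) 0)%:E * (p x)%:E))%E.
  rewrite -[LHS](@eq_measure_integral _ _ _ _ mu
     (pushforward mu (-%R : _ -> measurableTypeR R))); last first.
    by move=> A mA _; exact: lebesgue_measureN.
  rewrite ge0_integral_pushforward//.
  - by apply: eq_integral => x _ /=; rewrite normal_pdfN.
  - apply: emeasurable_funM => //.
    by apply/measurable_EFinP; exact: measurable_normal_pdf.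
  - by move=> x _; rewrite mule_ge0// lee_fin normal_pdf_ge0.
rewrite -e subee//.
rewrite -(@normal_rv_integral (fun x => (Num.max x 0)%:E))//.
have /integrable_funepos := normal_rv_integrable => /(_ measurableT).
move=> /(integrable_fin_num measurableT); congr (_ \is a fin_num).
by apply: eq_integral => x _; rewrite funeposE -EFin_max.
Qed.

End normal_rv.

(** * Increments of a Wiener process *)

Section independence.
Context {R : realType} d (T : measurableType d) (P : probability T R).
Variables Z D : T -> R.
Hypothesis mZ : measurable_fun setT Z.
Hypothesis mD : measurable_fun setT D.
Hypothesis indep : forall A B : set R, measurable A -> measurable B ->
  (P (Z @^-1` A `&` D @^-1` B) = P (Z @^-1` A) * P (D @^-1` B))%E.
Hypothesis iZ : P.-integrable setT (EFin \o Z).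
Hypothesis iD : P.-integrable setT (EFin \o D).

Let rZ : {RV P >-> R} :=
  HB.pack (Z : T -> R) (isMeasurableFun.Build _ _ _ _ _ mZ).
Let rD : {RV P >-> R} :=
  HB.pack (D : T -> R) (isMeasurableFun.Build _ _ _ _ _ mD).

Let ZD (x : T) : R * R := (Z x, D x).
Let mZD : measurable_fun setT ZD.
Proof. exact: measurable_fun_pair. Qed.
Let rZD : {RV P >-> (R * R)%type} :=
  HB.pack ZD (isMeasurableFun.Build _ _ _ _ _ mZD).

Local Open Scope ereal_scope.

(** A product measure is determined by its values on rectangles, where the claim is exactly the
    independence hypothesis. Integrals of products then follow from Fubini and Tonelli. *)
Let joint X : measurable X ->
  (distribution P rZ \x distribution P rD) X = distribution P rZD X.
Proof.
by apply: product_measure_unique => A B mA mB; exact: indep.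
Qed.

Let f (z : R * R) : \bar R := (z.1 * z.2)%:E.

Let mf : measurable_fun setT f.
Proof.
apply/measurable_EFinP; apply: measurable_funM.
- exact: measurable_fst.
- exact: measurable_snd.
Qed.

Let idistr (X : {RV P >-> R}) :
  P.-integrable setT (EFin \o X) ->
  (distribution P X).-integrable setT (@EFin R).
Proof.
move=> /integrableP[mX iX]; apply/integrableP; split.
  exact/measurable_EFinP.
rewrite ge0_integral_distribution//.
by apply: measurableT_comp => //; exact/measurable_EFinP.
Qed.

Let integrable_f :
  (distribution P rZ \x distribution P rD).-integrable setT f.
Proof.
apply/integrable12ltyP => //.
have /integrableP[_ hZ] := idistr (X := rZ) iZ.
have /integrableP[_ hD] := idistr (X := rD) iD.
under eq_integral => z _.
  under eq_integral do rewrite /f/= normrM EFinM.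
  rewrite ge0_integralZl//; last first.
    by apply/measurable_EFinP; exact: normr_measurable.
  over.
rewrite ge0_integralZr//=; last 2 first.
- by apply/measurable_EFinP; exact: normr_measurable.
- by apply: integral_ge0.
by rewrite lte_mul_pinfty// ?integral_ge0// ge0_fin_numE// integral_ge0.
Qed.

Lemma independent_integrableM : P.-integrable setT (fun x => (Z x * D x)%:E).
Proof.
apply/integrableP; split.
  by apply/measurable_EFinP; exact: measurable_funM.
have /integrableP[_] := integrable_f.
rewrite (eq_measure_integral (distribution P rZD)); last first.
  by move=> A mA _; exact: joint.
by rewrite ge0_integral_distribution//; exact: measurableT_comp.
Qed.

Lemma independent_integralM :
  \int[P]_x (Z x * D x)%:E = (\int[P]_x (Z x)%:E) * (\int[P]_x (D x)%:E).
Proof.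
transitivity (\int[distribution P rZD]_z f z).
  rewrite integral_distribution//; exact: independent_integrableM.
rewrite (eq_measure_integral (distribution P rZ \x distribution P rD)); last first.
  by move=> A mA _; apply/esym/joint.
rewrite -integral12_prod_meas1// /fubini_F.
have hZ := idistr (X := rZ) iZ.
have hD := idistr (X := rD) iD.
under eq_integral => z _.
  under eq_integral do rewrite /f/= EFinM.
  rewrite integralZl//.
  over.
have fD : \int[distribution P rD]_x x%:E \is a fin_num.
  exact: integrable_fin_num.
rewrite -(fineK fD) integralZr//.
by rewrite fineK// !integral_distribution.
Qed.

End independence.

Lemma integrable_boundedM {R : realType} d (T : measurableType d)
    (P : {measure set T -> \bar R}) (Z f : T -> R) (C : R) :
  measurable_fun setT Z -> (forall x, `|Z x| <= C) ->
  P.-integrable setT (EFin \o f) -> P.-integrable setT (fun x => (Z x * f x)%:E).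
Proof.
move=> mZ ZC fi.
have mf : measurable_fun setT f by apply/measurable_EFinP; exact: measurable_int fi.
apply: (@le_integrable _ _ _ P setT _ _ (fun x => C%:E * (f x)%:E)%E) => //.
- by apply/measurable_EFinP; exact: measurable_funM.
- move=> x _; rewrite -EFinM !abse_EFin lee_fin !normrM ler_wpM2r//.
  by rewrite (le_trans (ZC x))// ler_norm.
- exact: integrableZl.
Qed.

Lemma integrable_mul_sqr {R : realType} d (T : measurableType d)
    (P : {measure set T -> \bar R}) (f g : T -> R) :
  measurable_fun setT f -> measurable_fun setT g ->
  P.-integrable setT (fun x => (f x ^+ 2)%:E) ->
  P.-integrable setT (fun x => (g x ^+ 2)%:E) ->
  P.-integrable setT (fun x => (f x * g x)%:E).
Proof.
move=> mf mg fi gi.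
apply: (@le_integrable _ _ _ P setT _ _
  (fun x => (f x ^+ 2)%:E + (g x ^+ 2)%:E)%E) => //.
- by apply/measurable_EFinP; exact: measurable_funM.
- move=> x _; rewrite -EFinD !abse_EFin lee_fin [leRHS]ger0_norm ?addr_ge0 ?sqr_ge0//.
  rewrite normrM -[f x ^+ 2]real_normK ?num_real// -[g x ^+ 2]real_normK ?num_real//.
  move: `|f x| `|g x| => a b; have := sqr_ge0 (a - b); have := sqr_ge0 (a + b); nra.
- exact: integrableD.
Qed.

Section wiener_increments.
Context {R : realType} {d : measure_display} {T : measurableType d}.
Variables (P : probability T R) (F : R -> set (set T)) (w : R -> T -> R).
Hypotheses (F_usual : usual_filtration P F) (w_wiener : wiener P F w).

Lemma measurable_atW t (f : T -> R) : 0 <= t ->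
  measurable_at F t f -> measurable_fun setT f.
Proof.
move=> t0 mf _ B mB; have [/(_ _ t0)[sF FT] _ _ _] := F_usual.
apply: FT; rewrite -(sigma_algebra_id sF).
exact: (mf measurableT B mB).
Qed.

Lemma measurable_at_le s t (f : T -> R) : 0 <= s -> s <= t ->
  measurable_at F s f -> measurable_at F t f.
Proof.
move=> s0 st mf _ B mB; have t0 := le_trans s0 st.
have [sF mono _ _] := F_usual; have [sFs _] := sF _ s0; have [sFt _] := sF _ t0.
have := mf measurableT B mB; rewrite /measurable/= !sigma_algebra_id//.
exact: mono.
Qed.

Lemma wiener_incr_measurable q s : 0 <= q -> q <= s ->
  measurable_at F s (fun x => w s x - w q x).
Proof.
move=> q0 qs; have [aw _ _ _ _] := w_wiener.
apply: measurable_funB; first by apply: aw; exact: le_trans qs.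
by apply: (measurable_at_le q0 qs); exact: aw.
Qed.

Let mincr q s : 0 <= q -> q <= s -> measurable_fun setT (fun x => w s x - w q x).
Proof.
move=> q0 qs; apply: (@measurable_atW s); first exact: le_trans qs.
exact: wiener_incr_measurable.
Qed.

Let incr_law q s : 0 <= q -> q < s -> forall B : set R, measurable B ->
  P ((fun x => w s x - w q x) @^-1` B) = normal_prob 0 (Num.sqrt (s - q)) B.
Proof. by move=> q0 qs B mB; have [_ _ _ + _] := w_wiener; apply. Qed.

Let sqrtsq (q s : R) : q < s -> Num.sqrt (s - q) ^+ 2 = s - q.
Proof. by move=> qs; rewrite sqr_sqrtr// subr_ge0 ltW. Qed.

Lemma wiener_incr_integrable q s : 0 <= q -> q <= s ->
  P.-integrable setT (fun x => (w s x - w q x)%:E).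
Proof.
(* The law of the increment is only given for [q < s]. The degenerate case is kept because the
   partitions used later may repeat a point. *)
move=> q0; rewrite le_eqVlt => /predU1P[->|qs].
  by under eq_fun do rewrite subrr; exact: integrable0.
apply: (normal_rv_integrable (s := Num.sqrt (s - q))).
- by rewrite sqrtr_gt0 subr_gt0.
- by apply: mincr => //; exact: ltW.
- exact: incr_law.
Qed.

Lemma wiener_incr_integrable2 q s : 0 <= q -> q <= s ->
  P.-integrable setT (fun x => ((w s x - w q x) ^+ 2)%:E).
Proof.
move=> q0; rewrite le_eqVlt => /predU1P[->|qs].
  by under eq_fun do rewrite subrr expr0n; exact: integrable0.
apply: (normal_rv_integrable2 (s := Num.sqrt (s - q))).
- by rewrite sqrtr_gt0 subr_gt0.
- by apply: mincr => //; exact: ltW.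
- exact: incr_law.
Qed.

Lemma wiener_incr_pow4 q s : 0 <= q -> q <= s ->
  (\int[P]_x ((w s x - w q x) ^+ 4)%:E <= (64 * (s - q) ^+ 2)%:E)%E.
Proof.
move=> q0; rewrite le_eqVlt => /predU1P[->|qs].
  under eq_integral do rewrite subrr expr0n.
  by rewrite integral0 lee_fin mulr_ge0// sqr_ge0.
rewrite -[in leRHS](sqrtsq qs) -exprM.
apply: normal_rv_pow4.
- by rewrite sqrtr_gt0 subr_gt0.
- by apply: mincr => //; exact: ltW.
- exact: incr_law.
Qed.

(** The function [g] lets one statement serve both the increment and its square. *)
Let incr_indep q s (Z : T -> R) (g : R -> R) : 0 <= q -> q < s ->
  measurable_at F q Z -> measurable_fun setT g ->
  forall A B : set R, measurable A -> measurable B ->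
  P (Z @^-1` A `&` (fun x => g (w s x - w q x)) @^-1` B) =
  (P (Z @^-1` A) * P ((fun x => g (w s x - w q x)%R) @^-1` B))%E.
Proof.
move=> q0 qs mZ mg A B mA mB.
have [_ _ _ _ h] := w_wiener.
have FA : F q (Z @^-1` A).
  have [/(_ _ q0)[sF _] _ _ _] := F_usual.
  rewrite -(sigma_algebra_id sF) -[_ @^-1` _]setTI; exact: (mZ measurableT A mA).
have mgB : measurable (g @^-1` B).
  by rewrite -[_ @^-1` _]setTI; exact: mg.
exact: (h q q s q0 (lexx q) qs (Z @^-1` A) (g @^-1` B) FA mgB).
Qed.

Let incr_prod q s (Z : T -> R) (g : R -> R) : 0 <= q -> q < s ->
  measurable_at F q Z -> measurable_fun setT g ->
  P.-integrable setT (EFin \o Z) ->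
  P.-integrable setT (fun x => (g (w s x - w q x))%:E) ->
  P.-integrable setT (fun x => (Z x * g (w s x - w q x))%:E) /\
  (\int[P]_x (Z x * g (w s x - w q x))%:E =
   (\int[P]_x (Z x)%:E) * (\int[P]_x (g (w s x - w q x)%R)%:E))%E.
Proof.
move=> q0 qs mZ mg iZ ig.
have mZ' := measurable_atW q0 mZ.
have mg' : measurable_fun setT (fun x => g (w s x - w q x)).
  by apply: measurableT_comp => //; apply: mincr => //; exact: ltW.
have ind := incr_indep q0 qs mZ mg.
by split; [exact: independent_integrableM|exact: independent_integralM].
Qed.

Lemma wiener_incr_orthogonal q s (Z : T -> R) : 0 <= q -> q <= s ->
  measurable_at F q Z -> P.-integrable setT (EFin \o Z) ->
  P.-integrable setT (fun x => (Z x * (w s x - w q x))%:E) /\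
  (\int[P]_x (Z x * (w s x - w q x))%:E = 0)%E.
Proof.
move=> q0; rewrite le_eqVlt => /predU1P[->|qs] mZ iZ.
  under eq_fun do rewrite subrr mulr0.
  by split; [exact: integrable0|exact: integral0].
have i1 := wiener_incr_integrable q0 (ltW qs).
have [i2 ->] := incr_prod q0 qs mZ (@measurable_id _ _ setT) iZ i1.
split=> //; rewrite (@normal_rv_mean _ _ _ P (Num.sqrt (s - q)) (fun x => w s x - w q x)) ?mule0//.
- by rewrite sqrtr_gt0 subr_gt0.
- by apply: mincr => //; exact: ltW.
- exact: incr_law.
Qed.

Lemma wiener_incr_sqr q s (Z : T -> R) : 0 <= q -> q <= s ->
  measurable_at F q Z -> P.-integrable setT (EFin \o Z) ->
  P.-integrable setT (fun x => (Z x * (w s x - w q x) ^+ 2)%:E) /\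
  (\int[P]_x (Z x * (w s x - w q x) ^+ 2)%:E =
   \int[P]_x (Z x * (s - q))%:E)%E.
Proof.
move=> q0; rewrite le_eqVlt => /predU1P[->|qs] mZ iZ.
  under eq_fun do rewrite subrr expr0n mulr0.
  split; first exact: integrable0.
  by apply: eq_integral => x _; rewrite subrr mulr0.
have i1 := wiener_incr_integrable2 q0 (ltW qs).
have [i2 ->] := incr_prod q0 qs mZ (@exprn_measurable _ setT 2) iZ i1.
split=> //; rewrite (@normal_rv_sqr _ _ _ P (Num.sqrt (s - q)) (fun x => w s x - w q x)).
- under [RHS]eq_integral do rewrite EFinM.
  by rewrite sqrtsq// integralZr.
- by rewrite sqrtr_gt0 subr_gt0.
- by apply: mincr => //; exact: ltW.
- exact: incr_law.
Qed.

(** This makes the compensated squares of successive increments orthogonal, even with weights known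
    at the start of each increment. *)
Lemma wiener_incr_compensated q s (Z : T -> R) : 0 <= q -> q <= s ->
  measurable_at F q Z -> P.-integrable setT (EFin \o Z) ->
  P.-integrable setT (fun x => (Z x * ((w s x - w q x) ^+ 2 - (s - q)))%:E) /\
  (\int[P]_x (Z x * ((w s x - w q x) ^+ 2 - (s - q)))%:E = 0)%E.
Proof.
move=> q0 qs mZ iZ; have [i1 e1] := wiener_incr_sqr q0 qs mZ iZ.
have i2 : P.-integrable setT (fun x => (Z x * (s - q))%:E).
  by under eq_fun do rewrite EFinM; exact: integrableZr.
under eq_fun do rewrite mulrBr EFinB.
split; first exact: integrableB.
rewrite integralB_EFin// e1 subee//; exact: integrable_fin_num.
Qed.

End wiener_increments.

(** * The Ito isometry for elementary processes *)

Section isometry.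
Context {R : realType} {d : measure_display} {T : measurableType d}.
Variables (P : probability T R) (F : R -> set (set T)) (w : R -> T -> R).
Hypotheses (F_usual : usual_filtration P F) (w_wiener : wiener P F w).

Definition bounded_rv (c : T -> R) := exists C : R, forall x, `|c x| <= C.

Lemma bounded_rvM (c c' : T -> R) : bounded_rv c -> bounded_rv c' ->
  bounded_rv (fun x => c x * c' x).
Proof.
move=> [C cC] [C' cC']; exists (C * C') => x.
by rewrite normrM ler_pM.
Qed.

Lemma bounded_rv_integrable (c : T -> R) : measurable_fun setT c ->
  bounded_rv c -> P.-integrable setT (EFin \o c).
Proof.
move=> mc [C cC].
apply: (@eq_integrable _ _ _ P setT _ (fun x => (c x * 1)%:E)) => //.
  by move=> x _; rewrite mulr1.
apply: (integrable_boundedM (C := C)) => //.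
exact: finite_measure_integrable_cst.
Qed.

Let mincr q s : 0 <= q -> q <= s -> measurable_fun setT (fun x => w s x - w q x).
Proof.
move=> q0 qs; apply: (@measurable_atW _ _ _ _ _ F_usual s); first exact: le_trans qs.
exact: (wiener_incr_measurable F_usual w_wiener).
Qed.

Let incr_mul_integrable (c : T -> R) q s q' s' :
  measurable_fun setT c -> bounded_rv c ->
  0 <= q -> q <= s -> 0 <= q' -> q' <= s' ->
  P.-integrable setT
    (fun x => (c x * ((w s x - w q x) * (w s' x - w q' x)))%:E).
Proof.
move=> mc [C cC] q0 qs q0' qs'; apply: (integrable_boundedM (C := C)) => //.
apply: integrable_mul_sqr; [exact: mincr|exact: mincr| |].
- exact: (wiener_incr_integrable2 F_usual w_wiener).
- exact: (wiener_incr_integrable2 F_usual w_wiener).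
Qed.

(** All factors but the last increment are known at time [q], and that increment is centred and
    independent of them. *)
Let incr_mul_orthogonal (c : T -> R) a b q s :
  measurable_at F q c -> bounded_rv c ->
  0 <= a -> a <= b -> b <= q -> q <= s ->
  (\int[P]_x (c x * ((w b x - w a x) * (w s x - w q x)))%:E = 0)%E.
Proof.
move=> mc bc a0 ab bq qs; have q0 := le_trans a0 (le_trans ab bq).
have mZ : measurable_at F q (fun x => c x * (w b x - w a x)).
  apply: measurable_funM => //.
  apply: (measurable_at_le F_usual (le_trans a0 ab) bq).
  exact: (wiener_incr_measurable F_usual w_wiener).
have iZ : P.-integrable setT (fun x => (c x * (w b x - w a x))%:E).
  case: bc => C cC; apply: (integrable_boundedM (C := C)) => //.
    exact: (measurable_atW F_usual q0).
  exact: (wiener_incr_integrable F_usual w_wiener).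
have [_] := wiener_incr_orthogonal F_usual w_wiener q0 qs mZ iZ.
by under eq_integral do rewrite -mulrA.
Qed.

(** The longer increment is cut at the end of the shorter one; its second piece is orthogonal and
    only a square remains. *)
Let incr_mul_same (c : T -> R) q m M :
  measurable_at F q c -> bounded_rv c -> 0 <= q -> q <= m -> q <= M ->
  (\int[P]_x (c x * ((w m x - w q x) * (w M x - w q x)))%:E =
   \int[P]_x (c x * (Num.min m M - q))%:E)%E.
Proof.
wlog mM : m M / m <= M.
  move=> h mc bc q0 qm qM; have /orP[mM|Mm] := le_total m M.
    exact: h.
  under eq_integral do rewrite (mulrC (w m _ - _)).
  by rewrite h// minC.
move=> mc bc q0 qm qM; rewrite (min_idPl mM).
have mc' := measurable_atW F_usual q0 mc.
transitivity (\int[P]_x ((c x * ((w m x - w q x) * (w m x - w q x)))%:E +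
    (c x * ((w m x - w q x) * (w M x - w m x)))%:E))%E.
  by apply: eq_integral => x _; rewrite -EFinD; congr (_%:E); ring.
rewrite integralD//; [|exact: incr_mul_integrable|
  by apply: incr_mul_integrable => //; exact: le_trans qm].
rewrite (@incr_mul_orthogonal c q m m M)//; last exact: (measurable_at_le F_usual q0 qm).
rewrite adde0.
have ic := bounded_rv_integrable mc' bc.
have [_ <-] := wiener_incr_sqr F_usual w_wiener q0 qm mc ic.
by apply: eq_integral => x _; rewrite -expr2.
Qed.

(** The last factor is the length of the overlap of []a, b]] and []a', b']]. Intervals in arbitrary
    position are allowed, so the isometry needs no common refinement. *)
Lemma wiener_incr_covariance (c c' : T -> R) a b a' b' :
  measurable_at F a c -> bounded_rv c -> measurable_at F a' c' -> bounded_rv c' ->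
  0 <= a -> a <= b -> 0 <= a' -> a' <= b' ->
  P.-integrable setT
    (fun x => ((c x * (w b x - w a x)) * (c' x * (w b' x - w a' x)))%:E) /\
  (\int[P]_x ((c x * (w b x - w a x)) * (c' x * (w b' x - w a' x)))%:E =
   \int[P]_x (c x * c' x * Num.max 0 (Num.min b b' - Num.max a a'))%:E)%E.
Proof.
move=> mc bc mc' bc' a0 ab a0' ab'.
have mcT := measurable_atW F_usual a0 mc.
have mcT' := measurable_atW F_usual a0' mc'.
have e1 x : (c x * (w b x - w a x)) * (c' x * (w b' x - w a' x)) =
   (c x * c' x) * ((w b x - w a x) * (w b' x - w a' x)) by ring.
split.
  under eq_fun do rewrite e1; apply: incr_mul_integrable => //.
    exact: measurable_funM.
  exact: bounded_rvM.
under eq_integral do rewrite e1.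
clear e1.
wlog aa' : a b c a' b' c' mc bc mc' bc' a0 ab a0' ab' mcT mcT' / a <= a'.
  move=> h; have /orP[aa'|aa'] := le_total a a'; first exact: h.
  transitivity (\int[P]_x (c' x * c x *
      ((w b' x - w a' x) * (w b x - w a x)))%:E)%E.
    by apply: eq_integral => x _; congr (_%:E); ring.
  rewrite h//; apply: eq_integral => x _.
  by rewrite (minC b') (maxC a') (mulrC (c x)).
have mcc : measurable_at F a' (fun x => c x * c' x).
  by apply: measurable_funM => //; exact: (measurable_at_le F_usual a0 aa').
have bcc := bounded_rvM bc bc'.
have mccT := measurable_atW F_usual a0' mcc.
rewrite (max_idPr aa').
(* When the intervals are disjoint, [Num.min b b' - a'] is at most 0 and the maximum cuts it to
   0. *)
have [ba'|a'b] := leP b a'.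
  rewrite incr_mul_orthogonal//.
  rewrite (_ : Num.max 0 _ = 0).
    by under eq_integral do rewrite mulr0; rewrite integral0.
  by apply/max_idPl; rewrite subr_le0 ge_min ba'.
(* Cutting the first increment at [a'] gives an orthogonal piece and a pair of increments with the
   same start. *)
transitivity (\int[P]_x ((c x * c' x * ((w a' x - w a x) * (w b' x - w a' x)))%:E +
    (c x * c' x * ((w b x - w a' x) * (w b' x - w a' x)))%:E))%E.
  by apply: eq_integral => x _; rewrite -EFinD; congr (_%:E); ring.
rewrite integralD//; [|exact: incr_mul_integrable|
  by apply: incr_mul_integrable => //; exact: ltW].
rewrite incr_mul_orthogonal// add0e.
rewrite (incr_mul_same mcc bcc a0' (ltW a'b) ab').
apply: eq_integral => x _; congr (_ * _)%:E; apply/esym/max_idPr.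
by rewrite subr_ge0 le_min ab' (ltW a'b).
Qed.

(** One term of an elementary process. Unlike the consecutive intervals of [simple_process], those
    in a list of such terms may overlap, so sums and differences of processes are mere
    concatenations. *)
Record elem (t : R) := Elem {
  el_l : R ; el_r : R ; el_c : T -> R ;
  el_l0 : 0 <= el_l ; el_lr : el_l <= el_r ; el_rt : el_r <= t ;
  el_meas : measurable_at F el_l el_c ;
  el_bounded : bounded_rv el_c }.

Definition evalue t (l : seq (elem t)) (s : R) (x : T) : R :=
  \sum_(e <- l) el_c e x * \1_(`]el_l e, el_r e]%classic) s.

Definition eint t (l : seq (elem t)) (x : T) : R :=
  \sum_(e <- l) el_c e x * (w (el_r e) x - w (el_l e) x).

Lemma eint_measurable t (l : seq (elem t)) : measurable_fun setT (eint l).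
Proof.
apply: measurable_sum => e; apply: measurable_funM.
- exact: (measurable_atW F_usual (el_l0 e) (el_meas (e := e))).
- exact: (mincr (el_l0 e) (el_lr e)).
Qed.

Let overlap (a b a' b' t : R) : 0 <= a -> b <= t -> 0 <= a' -> b' <= t ->
  (\int[lebesgue_measure]_(s in `]0%R, t])
    (\1_(`]a, b]%classic) s * \1_(`]a', b']%classic) s)%:E =
   (Num.max 0 (Num.min b b' - Num.max a a'))%:E)%E.
Proof.
move=> a0 bt a0' bt'.
transitivity (\int[lebesgue_measure]_(s in `]0%R, t])
    (\1_(`]Num.max a a', Num.min b b']%classic) s)%:E)%E.
  apply: eq_integral => s _; rewrite !indicE -natrM mulnb; congr (_%:R%:E).
  rewrite !mem_setE !in_itv/= gt_max le_min.
  by case: (a < s); case: (a' < s); case: (s <= b); case: (s <= b').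
rewrite integral_indic//= setIidl; last first.
  move=> s /=; rewrite !in_itv/= gt_max le_min => /andP[/andP[as_ _] /andP[sb _]].
  by rewrite (le_lt_trans a0 as_) (le_trans sb bt).
rewrite lebesgue_measure_itv/= lte_fin.
case: ltP => h.
  by rewrite -EFinD; congr (_%:E); apply/esym/max_idPr; rewrite subr_ge0 ltW.
by congr (_%:E); apply/esym/max_idPl; rewrite subr_le0.
Qed.

Lemma evalue_sqr_integral t (l : seq (elem t)) x :
  (\int[lebesgue_measure]_(s in `]0%R, t]) ((evalue l s x) ^+ 2)%:E =
  (\sum_(e <- l) \sum_(e' <- l) el_c e x * el_c e' x *
    Num.max 0 (Num.min (el_r e) (el_r e') - Num.max (el_l e) (el_l e')))%:E)%E.
Proof.
have ii (e e' : elem t) : lebesgue_measure.-integrable `]0, t]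
   (fun s => (el_c e x * el_c e' x * (\1_(`]el_l e, el_r e]%classic) s *
      \1_(`]el_l e', el_r e']%classic) s))%:E).
  apply: measurable_bounded_integrable => //.
  - by rewrite /= lebesgue_measure_itv/=; case: ifP => // _; rewrite ltry.
  - by apply: measurable_funM => //; apply: measurable_funM.
  exists (`|el_c e x * el_c e' x|); split; first exact: num_real.
  move=> M MM s _ /=; apply: le_trans (ltW MM); rewrite normrM ler_piMr//.
  rewrite !indicE -natrM normr_nat.
  by do 2 case: (_ \in _).
transitivity (\int[lebesgue_measure]_(s in `]0%R, t])
   \sum_(e <- l) \sum_(e' <- l) (el_c e x * el_c e' x * (\1_(`]el_l e, el_r e]%classic) s *
      \1_(`]el_l e', el_r e']%classic) s))%:E)%E.
  apply: eq_integral => s _.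
  under eq_bigr do rewrite sumEFin.
  rewrite sumEFin expr2 mulr_suml; congr (_%:E); apply: eq_bigr => e _.
  by rewrite mulr_sumr; apply: eq_bigr => e' _; ring.
rewrite integral_sum//; last first.
  by move=> e; apply: integrable_sum => // e' _; exact: ii.
rewrite -sumEFin; apply: eq_bigr => e _.
rewrite integral_sum//.
rewrite -sumEFin; apply: eq_bigr => e' _.
under eq_integral do rewrite EFinM.
rewrite integralZl//; last first.
  apply: measurable_bounded_integrable => //.
  - by rewrite /= lebesgue_measure_itv/=; case: ifP => // _; rewrite ltry.
  - by apply: measurable_funM.
  exists 1; split; first exact: num_real.
  move=> M MM s _ /=; apply: le_trans (ltW MM).
  rewrite !indicE -natrM normr_nat.
  by do 2 case: (_ \in _).
rewrite overlap ?EFinM//; [exact: el_l0|exact: el_rt|exact: el_l0|exact: el_rt].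
Qed.

(** Both squares expand into double sums, which reduces the claim to a pair of terms: their
    covariance and the time integral of the product of their indicators both involve the length of
    the overlap. *)
Lemma eint_isometry t (l : seq (elem t)) :
  (\int[P]_x ((eint l x) ^+ 2)%:E =
   \int[P]_x \int[lebesgue_measure]_(s in `]0%R, t]) ((evalue l s x) ^+ 2)%:E)%E.
Proof.
have cov (e e' : elem t) := wiener_incr_covariance (el_meas (e := e))
  (el_bounded e) (el_meas (e := e')) (el_bounded e') (el_l0 e) (el_lr e)
  (el_l0 e') (el_lr e').
under [RHS]eq_integral do rewrite evalue_sqr_integral.
transitivity (\int[P]_x \sum_(e <- l) \sum_(e' <- l)
   ((el_c e x * (w (el_r e) x - w (el_l e) x)) *
    (el_c e' x * (w (el_r e') x - w (el_l e') x)))%:E)%E.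
  apply: eq_integral => x _.
  under eq_bigr do rewrite sumEFin.
  rewrite sumEFin expr2 mulr_suml; congr (_%:E); apply: eq_bigr => e _.
  by rewrite mulr_sumr.
rewrite integral_sum//; last first.
  by move=> e; apply: integrable_sum => // e' _; exact: (cov e e').1.
transitivity (\sum_(e <- l) \sum_(e' <- l)
   \int[P]_x (el_c e x * el_c e' x *
    Num.max 0 (Num.min (el_r e) (el_r e') - Num.max (el_l e) (el_l e')))%:E)%E.
  apply: eq_bigr => e _; rewrite integral_sum//; last first.
    by move=> e'; exact: (cov e e').1.
  by apply: eq_bigr => e' _; exact: (cov e e').2.
have iZ (e e' : elem t) : P.-integrable setT (fun x => (el_c e x * el_c e' x *
    Num.max 0 (Num.min (el_r e) (el_r e') - Num.max (el_l e) (el_l e')))%:E).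
  under eq_fun do rewrite EFinM.
  apply: integrableZr => //; apply: (bounded_rv_integrable (c := fun x => el_c e x * el_c e' x)).
    apply: measurable_funM.
    - exact: (measurable_atW F_usual (el_l0 e) (el_meas (e := e))).
    - exact: (measurable_atW F_usual (el_l0 e') (el_meas (e := e'))).
  by apply: bounded_rvM; exact: el_bounded.
transitivity (\int[P]_x \sum_(e <- l) \sum_(e' <- l) (el_c e x * el_c e' x *
    Num.max 0 (Num.min (el_r e) (el_r e') - Num.max (el_l e) (el_l e')))%:E)%E.
  rewrite integral_sum//; last by move=> e; exact: integrable_sum.
  by apply: eq_bigr => e _; rewrite integral_sum.
by apply: eq_integral => x _; under eq_bigr do rewrite sumEFin; rewrite sumEFin.
Qed.

End isometry.

(** * Joint measurability in time and outcome *)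

Section timespace.
Context {R : realType} {d : measure_display} {T : measurableType d}.
Implicit Types (t : R) (f g : R -> T -> R).
Local Notation mu := (@lebesgue_measure R).

(** Joint measurability on the half-open strip: time 0 is left out because [u] is only given on []0,
    +oo[], and time integrals do not see it. *)
Definition jmeas t f := measurable_fun (`]0, t]%classic `*` [set: T])
  (fun p : measurableTypeR R * T => f p.1 p.2).

Let mD t : measurable (`]0, t]%classic `*` [set: T] : set (measurableTypeR R * T)).
Proof. by apply: measurableX => //; exact: measurable_itv. Qed.

Lemma jmeas_le s t f : s <= t -> jmeas t f -> jmeas s f.
Proof.
move=> st; apply: (measurable_funS (mD t)) => -[r x] [/= rs _]; split => //=.
by move: rs; rewrite !in_itv/= => /andP[-> /le_trans]; apply.
Qed.

Lemma eq_jmeas t f g : (forall s x, 0 < s <= t -> f s x = g s x) ->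
  jmeas t f -> jmeas t g.
Proof.
move=> fg; apply: eq_measurable_fun => -[s x]; rewrite inE => -[/= + _].
by rewrite in_itv/=; exact: fg.
Qed.

Lemma jmeas_section_time t f x : jmeas t f ->
  measurable_fun `]0, t] (fun s : measurableTypeR R => f s x).
Proof.
move=> mf.
have h : measurable_fun `]0, t] (fun s : measurableTypeR R => (s, x)).
  exact: measurable_funTS (pair2_measurable x).
apply: (measurable_comp (mD t) _ mf h).
by move=> _ [s st <-].
Qed.

Lemma jmeas_integral t (f : R -> T -> \bar R) : 
  measurable_fun (`]0, t]%classic `*` [set: T])
     (fun p : measurableTypeR R * T => f p.1 p.2) ->
  (forall s x, 0 <= f s x)%E ->
  measurable_fun setT (fun x => \int[mu]_(s in `]0%R, t]) f s x)%E.
Proof.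
move=> mf f0.
pose g : measurableTypeR R * T -> \bar R :=
  (fun p => f p.1 p.2) \_ (`]0, t]%classic `*` [set: T]).
have mg : measurable_fun setT g by apply/(measurable_restrictT _ (mD t)).
have g0 p : (0 <= g p)%E by rewrite /g patchE; case: ifP.
have h := measurable_fun_fubini_tonelli_G (m1 := mu) g mg g0.
apply: eq_measurable_fun h.
move=> x _; rewrite /fubini_G [RHS]integral_mkcond; apply: eq_integral => s _.
rewrite /g !patchE; congr (if _ then _ else _).
by rewrite in_setX in_setT andbT.
Qed.

Lemma jmeas_sqr_integral t f : jmeas t f ->
  measurable_fun setT (fun x => \int[mu]_(s in `]0%R, t]) (f s x ^+ 2)%:E)%E.
Proof.
move=> mf; apply: jmeas_integral; last by move=> s x; rewrite lee_fin sqr_ge0.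
by apply/measurable_EFinP; exact: measurable_funX.
Qed.

(** Tonelli covers nonnegative integrands, so the positive and negative parts are integrated
    separately. *)
Lemma jmeas_Rintegral t f : jmeas t f ->
  measurable_fun setT (fun x => \int[mu]_(s in `]0, t]) f s x).
Proof.
move=> mf; apply: measurableT_comp => //.
under eq_fun => x.
  rewrite integralE; under eq_integral do rewrite funeposE.
  under [X in (_ - X)%E]eq_integral do rewrite funenegE.
  over.
apply: emeasurable_funB.
- apply: (@jmeas_integral t (fun s x => maxe (f s x)%:E 0)).
    by apply: measurable_maxe => //; exact/measurable_EFinP.
  by move=> s x; rewrite le_max lexx orbT.
- apply: (@jmeas_integral t (fun s x => maxe (- (f s x)%:E) 0)%E).
    apply: measurable_maxe => //; apply: measurableT_comp => //.
    exact/measurable_EFinP.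
  by move=> s x; rewrite le_max lexx orbT.
Qed.

End timespace.

Lemma progressive_jmeas {R : realType} {d} {T : measurableType d}
    (F : R -> set (set T)) (H : R -> T -> R) (D : set R) t :
  measurable (D : set (measurableTypeR R)) -> `]0, +oo[ `<=` D -> 0 <= t ->
  progressive F D H -> @jmeas R _ (g_sigma_algebraType (F t)) t H.
Proof.
move=> mD D0 t0 pH; apply: (measurable_funS _ _ (pH t t0)).
- apply: measurableX => //; apply: measurableI => //; exact: measurable_itv.
- move=> [s x] [/= st _]; split => //=; move: st; rewrite in_itv/= => /andP[s0 st].
  by split; [apply: D0; rewrite /= in_itv/= s0|rewrite /= in_itv/= st ltW].
Qed.

(** The identity map from the full sigma-algebra to the coarser [G] is measurable; composing with it
    enlarges the sigma-algebra on outcomes. *)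
Lemma jmeas_sub {R : realType} {d} {T : measurableType d}
    (G : set (set T)) t (H : R -> T -> R) :
  sigma_algebra setT G -> G `<=` measurable ->
  @jmeas R _ (g_sigma_algebraType G) t H -> jmeas t H.
Proof.
move=> sG GT mH.
pose h (p : measurableTypeR R * T) : measurableTypeR R * g_sigma_algebraType G := p.
have mh : measurable_fun setT h.
  apply/measurable_fun_pairP; split; first exact: measurable_fst.
  move=> _ B mB; apply: (measurable_snd measurableT).
  by apply: GT; rewrite -(sigma_algebra_id sG).
pose D : set (measurableTypeR R * T) := `]0, t]%classic `*` [set: T].
have mh' : measurable_fun D h by exact: measurable_funTS mh.
have mD : measurable (`]0, t]%classic `*` [set: T] :
    set (measurableTypeR R * g_sigma_algebraType G)).
  by apply: measurableX => //; exact: measurable_itv.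
apply: (measurable_comp mD _ mH mh').
by move=> _ [p pD <-].
Qed.

Section sqnorm.
Context {R : realType} {d : measure_display} {T : measurableType d}.
Variable P : probability T R.
Implicit Types (t : R) (f g h : R -> T -> R).
Local Notation mu := (@lebesgue_measure R).

(** The squared norm of L^2(dt x P) over []0, t]], in the iterated form in which [is_ito_integral]
    states it. *)
Definition sqnorm t f : \bar R :=
  (\int[P]_x \int[mu]_(s in `]0%R, t]) ((f s x) ^+ 2)%:E)%E.

Lemma sqnorm_ge0 t f : (0 <= sqnorm t f)%E.
Proof.
by apply: integral_ge0 => x _; apply: integral_ge0 => s _; rewrite lee_fin sqr_ge0.
Qed.

Lemma eq_sqnorm t f g : (forall s x, 0 < s <= t -> f s x = g s x) ->
  sqnorm t f = sqnorm t g.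
Proof.
move=> fg; apply: eq_integral => x _; apply: eq_integral => s.
by rewrite inE/= in_itv/= => st; rewrite fg.
Qed.

(** Stands in for the triangle inequality: with [K = 2] it is fed by (a + b)^2 <= 2 a^2 + 2 b^2. *)
Lemma sqnorm_le2 t (K : R) f g h : 0 <= K -> jmeas t f -> jmeas t g -> jmeas t h ->
  (forall s x, 0 < s <= t -> f s x ^+ 2 <= K * (g s x ^+ 2 + h s x ^+ 2)) ->
  (sqnorm t f <= K%:E * (sqnorm t g + sqnorm t h))%E.
Proof.
move=> K0 mf mg mh fgh.
rewrite -ge0_integralD//; [|by move=> x _; apply: integral_ge0 => s _;
  rewrite lee_fin sqr_ge0|exact: jmeas_sqr_integral|by move=> x _;
  apply: integral_ge0 => s _; rewrite lee_fin sqr_ge0|exact: jmeas_sqr_integral].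
have i0 f' x : (0 <= \int[mu]_(s in `]0%R, t]) (f' s x ^+ 2)%:E)%E.
  by apply: integral_ge0 => s _; rewrite lee_fin sqr_ge0.
rewrite -ge0_integralZl_EFin//; last 2 first.
- by move=> x _; rewrite adde_ge0.
- by apply: emeasurable_funD; exact: jmeas_sqr_integral.
apply: ge0_le_integral => //.
- exact: jmeas_sqr_integral.
- by apply: measurable_funeM; apply: emeasurable_funD; exact: jmeas_sqr_integral.
move=> x _.
have ms f' : jmeas t f' -> measurable_fun `]0, t]
    (fun s : measurableTypeR R => (f' s x ^+ 2)%:E).
  move=> mf'; apply/measurable_EFinP; apply: measurable_funX.
  exact: jmeas_section_time.
rewrite -ge0_integralD//; [|by move=> s _; rewrite lee_fin sqr_ge0|exact: ms
  |by move=> s _; rewrite lee_fin sqr_ge0|exact: ms].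
rewrite -ge0_integralZl_EFin//; last 2 first.
- by move=> s _; rewrite adde_ge0// lee_fin sqr_ge0.
- by apply: emeasurable_funD; exact: ms.
apply: ge0_le_integral => //.
- by move=> s _; rewrite lee_fin sqr_ge0.
- exact: ms.
- by apply: measurable_funeM; apply: emeasurable_funD; exact: ms.
move=> s; rewrite /= in_itv/= => st; rewrite -EFinD -EFinM lee_fin; exact: fgh.
Qed.

Lemma sqnorm_le t (K : R) f g : 0 <= K -> jmeas t f -> jmeas t g ->
  (forall s x, 0 < s <= t -> f s x ^+ 2 <= K * g s x ^+ 2) ->
  (sqnorm t f <= K%:E * sqnorm t g)%E.
Proof.
move=> K0 mf mg fg.
have z : sqnorm t (fun _ _ => 0) = 0%E.
  apply: integral0_eq => x _; apply: integral0_eq => s _.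
  by rewrite expr0n.
rewrite -[sqnorm t g]adde0 -z; apply: sqnorm_le2 => //.
  exact: measurable_cst.
by move=> s x st; rewrite expr0n addr0; exact: fg.
Qed.

Lemma sqnorm_mono r t f : r <= t -> jmeas t f -> (sqnorm r f <= sqnorm t f)%E.
Proof.
move=> rt mf; apply: ge0_le_integral => //.
- by move=> x _; apply: integral_ge0 => s _; rewrite lee_fin sqr_ge0.
- by apply: jmeas_sqr_integral; exact: jmeas_le mf.
- exact: jmeas_sqr_integral.
move=> x _; apply: ge0_subset_integral => //.
- apply/measurable_EFinP; apply: measurable_funX.
  exact: jmeas_section_time.
- by move=> s _; rewrite lee_fin sqr_ge0.
- move=> s; rewrite /= !in_itv/= => /andP[-> sr]; exact: le_trans sr rt.
Qed.

End sqnorm.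

(** * Simple processes and Ito integrals *)

Section simple_processes.
Context {R : realType} {d : measure_display} {T : measurableType d}.
Variables (P : probability T R) (F : R -> set (set T)) (w : R -> T -> R).
Hypotheses (F_usual : usual_filtration P F) (w_wiener : wiener P F w).
Implicit Types (S : simple_process F) (t : R).

Lemma sp_time_homo S : {homo sp_time S : i j / (i <= j)%N >-> i <= j}.
Proof. exact/nondecreasing_seqP/sp_time_le. Qed.

Lemma sp_time_ge0' S i : 0 <= sp_time S i.
Proof. exact: le_trans (sp_time_ge0 S) (sp_time_homo S (leq0n i)). Qed.

Section elem_mul.
Variables (t : R) (e : elem F t) (S : simple_process F) (i : nat).
Local Notation clip a := (Num.max (el_l e) (Num.min a (el_r e))).

(** If [sp_time S i] is at or beyond [el_r e], both clipped endpoints equal [el_r e], where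
    [sp_coef S i] need not be measurable yet. The product vanishes there anyway, so the coefficient
    is set to 0. *)
Definition elem_mul_coef : T -> R :=
  if sp_time S i < el_r e then fun x => el_c e x * sp_coef S i x else fun=> 0.

Let clip_ge0 : 0 <= clip (sp_time S i).
Proof. by rewrite le_max el_l0. Qed.

Let clip_le : clip (sp_time S i) <= clip (sp_time S i.+1).
Proof. by rewrite ge_max !le_max lexx/= le_min !ge_min sp_time_le lexx/= !orbT. Qed.

Let clip_t : clip (sp_time S i.+1) <= t.
Proof.
rewrite ge_max (le_trans (el_lr e) (el_rt e))/=.
by rewrite ge_min (el_rt e) orbT.
Qed.

Let elem_mul_meas : measurable_at F (clip (sp_time S i)) elem_mul_coef.
Proof.
rewrite /elem_mul_coef; case: ifPn => h; last exact: measurable_cst.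
rewrite (min_idPl (ltW h)); apply: measurable_funM.
- apply: (measurable_at_le F_usual (el_l0 e) _ (el_meas (e := e))).
  by rewrite le_max lexx.
- apply: (measurable_at_le F_usual (sp_time_ge0' S i) _ (@sp_coef_meas _ _ _ _ S i)).
  by rewrite le_max lexx orbT.
Qed.

Let elem_mul_bounded : bounded_rv elem_mul_coef.
Proof.
rewrite /elem_mul_coef; case: ifPn => h; last by exists 0 => x; rewrite normr0.
exact: (bounded_rvM (el_bounded e) (sp_coef_bounded S i)).
Qed.

Definition elem_mul : elem F t :=
  Elem clip_ge0 clip_le clip_t elem_mul_meas elem_mul_bounded.

Lemma elem_mul_value s x : el_c elem_mul x * \1_(`]el_l elem_mul, el_r elem_mul]%classic) s
  = el_c e x * \1_(`]el_l e, el_r e]%classic) s *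
    (sp_coef S i x * \1_(`]sp_time S i, sp_time S i.+1]%classic) s).
Proof.
rewrite /= /elem_mul_coef !indicE !mem_setE !in_itv/=.
rewrite gt_max gt_min le_max le_min (ltNge (el_r e)) (leNgt s (el_l e)).
case: ifPn => [_|].
  case: (el_l e < s); case: (s <= el_r e); case: (sp_time S i < s);
  case: (s <= sp_time S i.+1); rewrite /= ?(mulr0, mul0r, mulr1)//.
move=> h; have {}h : el_r e <= sp_time S i by rewrite leNgt.
rewrite mul0r; have [sr|] := boolP (s <= el_r e).
  by rewrite (ltNge (sp_time S i)) (le_trans sr h)/= !mulr0.
by move=> _; rewrite andbF mulr0 mul0r.
Qed.

Lemma elem_mul_int x :
  el_c elem_mul x * (w (el_r elem_mul) x - w (el_l elem_mul) x) =
  el_c e x * (sp_coef S i x *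
    (w (Num.min (sp_time S i.+1) (el_r e)) x - w (Num.min (sp_time S i) (el_r e)) x)
   - sp_coef S i x *
    (w (Num.min (sp_time S i.+1) (el_l e)) x - w (Num.min (sp_time S i) (el_l e)) x)).
Proof.
have lr := el_lr e.
have cl a : w (clip a) x - w (el_l e) x =
    w (Num.min a (el_r e)) x - w (Num.min a (el_l e)) x.
  case: (leP a (el_l e)) => h.
    by rewrite (min_idPl (le_trans h lr)) (max_idPl h) !subrr.
  by rewrite (max_idPr _)// le_min lr ltW.
have {}cl : w (clip (sp_time S i.+1)) x - w (clip (sp_time S i)) x =
    w (Num.min (sp_time S i.+1) (el_r e)) x - w (Num.min (sp_time S i) (el_r e)) x -
    (w (Num.min (sp_time S i.+1) (el_l e)) x - w (Num.min (sp_time S i) (el_l e)) x).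
  have := cl (sp_time S i); have := cl (sp_time S i.+1); lra.
rewrite /= cl /elem_mul_coef; case: ifPn; first by move=> _; ring.
rewrite -leNgt => h.
have h' := le_trans h (sp_time_le S i).
by rewrite !(min_idPr _)//; [ring|exact: le_trans lr h|exact: le_trans lr h'].
Qed.

End elem_mul.
Definition elem_mul_simple t (e : elem F t) S : seq (elem F t) :=
  [seq elem_mul e S (nat_of_ord i) | i <- index_enum 'I_(sp_size S)].

Lemma evalue_elem_mul t (e : elem F t) S s x :
  evalue (elem_mul_simple e S) s x =
  el_c e x * \1_(`]el_l e, el_r e]%classic) s * simple_value S s x.
Proof.
rewrite /evalue big_map /simple_value mulr_sumr.
by apply: eq_bigr => i _; exact: elem_mul_value.
Qed.

(** Thus increments of a simple integral, weighted by a variable known at the left endpoint, stay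
    within the class where the isometry holds. *)
Lemma eint_elem_mul t (e : elem F t) S x :
  eint w (elem_mul_simple e S) x =
  el_c e x * (simple_integral w S (el_r e) x - simple_integral w S (el_l e) x).
Proof.
rewrite /eint big_map /simple_integral -sumrB mulr_sumr.
by apply: eq_bigr => i _; exact: elem_mul_int.
Qed.

Lemma evalue_cat t (l l' : seq (elem F t)) s x :
  evalue (l ++ l') s x = evalue l s x + evalue l' s x.
Proof. by rewrite /evalue big_cat. Qed.

Lemma eint_cat t (l l' : seq (elem F t)) x :
  eint w (l ++ l') x = eint w l x + eint w l' x.
Proof. by rewrite /eint big_cat. Qed.

Lemma evalue_flatten t n (l : 'I_n -> seq (elem F t)) s x :
  evalue (flatten [seq l i | i <- index_enum 'I_n]) s x = \sum_(i < n) evalue (l i) s x.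
Proof. by rewrite /evalue big_flatten big_map. Qed.

Lemma eint_flatten t n (l : 'I_n -> seq (elem F t)) x :
  eint w (flatten [seq l i | i <- index_enum 'I_n]) x = \sum_(i < n) eint w (l i) x.
Proof. by rewrite /eint big_flatten big_map. Qed.

Lemma jmeas_rv_indic t (c : T -> R) (a b : R) : measurable_fun setT c ->
  jmeas t (fun s x => c x * \1_(`]a, b]%classic) s).
Proof.
move=> mc; apply: measurable_funTS; apply: measurable_funM.
- exact: (measurableT_comp mc measurable_snd).
- apply: (@measurableT_comp _ _ _ (measurableTypeR R * T)%type (measurableTypeR R) R
    (\1_(`]a, b]%classic) : measurableTypeR R -> R) setT fst).
    exact: measurable_indic.
  exact: measurable_fst.
Qed.

Lemma jmeas_simple_value r S : jmeas r (simple_value S).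
Proof.
apply: measurable_sum => i; apply: jmeas_rv_indic.
exact: (measurable_atW F_usual (sp_time_ge0' S i) (@sp_coef_meas _ _ _ _ S i)).
Qed.

Lemma simple_integral0 S x : simple_integral w S 0 x = 0.
Proof.
rewrite /simple_integral big1// => i _.
by rewrite !(min_idPr _) ?sp_time_ge0'// subrr mulr0.
Qed.

Lemma eint_isometry_sqnorm t (l : seq (elem F t)) :
  (\int[P]_x ((eint w l x) ^+ 2)%:E = sqnorm P t (evalue l))%E.
Proof. exact: eint_isometry. Qed.

Let cst_meas r (c : R) : measurable_at F r (fun=> c).
Proof. exact: measurable_cst. Qed.

Let cst_bounded (c : R) : bounded_rv (fun _ : T => c).
Proof. by exists `|c|. Qed.

(** Multiplying a simple process by this element restricts it to []0, r]] and scales it by [c]; with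
    [c] equal to 1 and -1, a difference of simple integrals becomes the integral of one list. *)
Definition elem_cst r (c : R) (r0 : 0 <= r) : elem F r :=
  Elem (lexx 0) r0 (lexx r) (@cst_meas 0 c) (cst_bounded c).

Lemma simple_integral_isometry r S S' : 0 <= r ->
  (\int[P]_x ((simple_integral w S r x - simple_integral w S' r x) ^+ 2)%:E =
   sqnorm P r (fun s x => (simple_value S s x - simple_value S' s x)%R))%E.
Proof.
move=> r0.
pose l := elem_mul_simple (elem_cst 1 r0) S ++ elem_mul_simple (elem_cst (-1) r0) S'.
transitivity (\int[P]_x ((eint w l x) ^+ 2)%:E)%E.
  apply: eq_integral => x _; congr (_ ^+ 2)%:E.
  by rewrite eint_cat !eint_elem_mul/= !simple_integral0 !subr0 mul1r mulN1r.
rewrite eint_isometry_sqnorm; apply: eq_sqnorm => s x sr.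
rewrite evalue_cat !evalue_elem_mul/=.
have -> : \1_(`]0, r]%classic) s = 1 :> R by rewrite indicE mem_set//= in_itv.
by rewrite !mulr1 mul1r mulN1r.
Qed.

Lemma simple_integral_measurable S r : 0 <= r -> measurable_fun setT (simple_integral w S r).
Proof.
move=> r0; have := eint_measurable F_usual w_wiener (elem_mul_simple (elem_cst 1 r0) S).
apply: eq_measurable_fun => x _.
by rewrite eint_elem_mul/= !simple_integral0 subr0 mul1r.
Qed.

(* The difference of the two martingale increments over each ]tau p, tau p.+1],
   weighted by Z p, is itself the integral of an elementary process. *)
Lemma weighted_increments_isometry t N (tau : nat -> R) (Z c : nat -> T -> R) S :
  0 <= tau 0%N -> (forall p, tau p <= tau p.+1) -> tau N <= t ->
  (forall p, (p < N)%N -> measurable_at F (tau p) (Z p)) ->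
  (forall p, (p < N)%N -> bounded_rv (Z p)) ->
  (forall p, (p < N)%N -> measurable_at F (tau p) (c p)) ->
  (forall p, (p < N)%N -> bounded_rv (c p)) ->
  let D x := \sum_(p < N) Z p x *
     (simple_integral w S (tau p.+1) x - simple_integral w S (tau p) x
       - c p x * (w (tau p.+1) x - w (tau p) x)) in
  measurable_fun setT D /\
  (\int[P]_x ((D x) ^+ 2)%:E = sqnorm P t (fun s x =>
     (\sum_(p < N) Z p x * \1_(`]tau p, tau p.+1]%classic) s *
        (simple_value S s x - c p x))%R))%E.
Proof.
move=> tau0 tauS tauN mZ bZ mc bc D.
have tau_homo : {homo tau : i j / (i <= j)%N >-> i <= j} by exact/nondecreasing_seqP.
have taup0 p : 0 <= tau p by exact: le_trans tau0 (tau_homo _ _ (leq0n p)).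
have taupt (p : 'I_N) : tau p.+1 <= t.
  exact: le_trans (tau_homo _ _ (ltn_ord p)) tauN.
pose e1 (p : 'I_N) := Elem (taup0 p) (tauS p) (taupt p) (mZ p (ltn_ord p)) (bZ p (ltn_ord p)).
have mcZ (p : 'I_N) : measurable_at F (tau p) (fun x => - Z p x * c p x).
  apply: measurable_funM; last exact: (mc p (ltn_ord p)).
  by apply: measurableT_comp => //; exact: (mZ p (ltn_ord p)).
have bcZ (p : 'I_N) : bounded_rv (fun x => - Z p x * c p x).
  have [C hC] := bounded_rvM (bZ p (ltn_ord p)) (bc p (ltn_ord p)).
  by exists C => x; rewrite mulNr normrN.
pose e2 (p : 'I_N) := Elem (taup0 p) (tauS p) (taupt p) (mcZ p) (bcZ p).
pose l := flatten [seq (elem_mul_simple (e1 p) S ++ [:: e2 p]) | p <- index_enum 'I_N].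
have DE : D = eint w l.
  apply/funext => x; rewrite /l eint_flatten; apply: eq_bigr => p _.
  rewrite eint_cat eint_elem_mul /= /eint big_seq1/=; ring.
split; first by rewrite DE; exact: (eint_measurable F_usual w_wiener l).
rewrite DE eint_isometry_sqnorm; apply: eq_sqnorm => s x _.
rewrite /l evalue_flatten; apply: eq_bigr => p _.
rewrite evalue_cat evalue_elem_mul /= /evalue big_seq1/=; ring.
Qed.

End simple_processes.

Section jmeas_algebra.
Context {R : realType} {d : measure_display} {T : measurableType d}.
Variables (t : R) (f g : R -> T -> R).
Hypotheses (mf : jmeas t f) (mg : jmeas t g).

Lemma jmeasB : jmeas t (fun s x => f s x - g s x).
Proof. exact: measurable_funB mf mg. Qed.

Lemma jmeasM : jmeas t (fun s x => f s x * g s x).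
Proof. exact: measurable_funM mf mg. Qed.

End jmeas_algebra.

Lemma cvge0_lt {R : realType} (u : nat -> \bar R) (e : R) : 0 < e ->
  u n @[n --> \oo] --> 0%E -> \forall n \near \oo, (u n < e%:E)%E.
Proof.
move=> e0 u0; have : nbhs (0%E : \bar R) [set y | (y < e%:E)%E].
  by apply: open_nbhs_nbhs; split; [exact: open_ereal_lt_ereal|rewrite /= lte_fin].
exact: u0.
Qed.

Lemma le_integral_sqr2 {R : realType} d (T : measurableType d)
    (P : {measure set T -> \bar R}) (K : R) (f g h : T -> R) :
  0 <= K -> measurable_fun setT f -> measurable_fun setT g -> measurable_fun setT h ->
  (forall x, f x ^+ 2 <= K * (g x ^+ 2 + h x ^+ 2)) ->
  (\int[P]_x (f x ^+ 2)%:E <=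
     K%:E * (\int[P]_x (g x ^+ 2)%:E + \int[P]_x (h x ^+ 2)%:E))%E.
Proof.
move=> K0 mf mg mh fgh.
have m2 (f' : T -> R) : measurable_fun setT f' -> measurable_fun setT (fun x => (f' x ^+ 2)%:E).
  by move=> mf'; apply/measurable_EFinP; exact: measurable_funX.
rewrite -ge0_integralD//; [|by move=> s _; rewrite lee_fin sqr_ge0|exact: m2
  |by move=> s _; rewrite lee_fin sqr_ge0|exact: m2].
rewrite -ge0_integralZl_EFin//; last 2 first.
- by move=> s _; rewrite adde_ge0// lee_fin sqr_ge0.
- by apply: emeasurable_funD; exact: m2.
apply: ge0_le_integral => //.
- by move=> s _; rewrite lee_fin sqr_ge0.
- exact: m2.
- by apply: measurable_funeM; apply: emeasurable_funD; exact: m2.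
- by move=> s _; rewrite -EFinD -EFinM lee_fin; exact: fgh.
Qed.

(** * Approximation and uniqueness of Ito integrals *)

Section ito_integral.
Context {R : realType} {d : measure_display} {T : measurableType d}.
Variables (P : probability T R) (F : R -> set (set T)) (w : R -> T -> R).
Hypotheses (F_usual : usual_filtration P F) (w_wiener : wiener P F w).
Implicit Types (S : simple_process F) (t : R).

Lemma progressive_jmeasT (H : R -> T -> R) (D : set R) t :
  measurable (D : set (measurableTypeR R)) -> `]0, +oo[ `<=` D -> 0 <= t ->
  progressive F D H -> jmeas t H.
Proof.
move=> mD D0 t0 pH; have [/(_ _ t0)[sF FT] _ _ _] := F_usual.
by apply: (jmeas_sub sF FT); exact: progressive_jmeas pH.
Qed.

Lemma progressive_jmeas0 (H : R -> T -> R) t : 0 <= t ->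
  progressive F `[0, +oo[ H -> jmeas t H.
Proof.
move=> t0; apply: progressive_jmeasT => //.
by move=> s; rewrite /= !in_itv/= !andbT => /ltW.
Qed.

(** The isometry up to a factor 4, which comes from applying (a + b)^2 <= 2 a^2 + 2 b^2 twice: once
    to the integrals and once to the integrands, through a simple process of the defining sequence
    close to both [I] and [H]. *)
Lemma ito_integral_approx H r I S : 0 <= r -> is_ito_integral P F w H r I ->
  (\int[P]_x ((I x - simple_integral w S r x) ^+ 2)%:E <=
   4%:E * sqnorm P r (fun s x => (simple_value S s x - H s x)%R))%E.
Proof.
move=> r0 [pH _ mI [Sn [S1 S2]]].
have mH := progressive_jmeas0 r0 pH.
set K := sqnorm _ _ _.
have mSI S' : measurable_fun setT (simple_integral w S' r).
  exact: (simple_integral_measurable F_usual w_wiener).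
have mS S' : jmeas r (simple_value S').
  exact: (jmeas_simple_value F_usual).
apply/lee_addgt0Pr => e e0.
have e8 : 0 < e / 8 by rewrite divr_gt0.
have [n [n1 n2]] : exists n,
   (\int[P]_x ((simple_integral w (Sn n) r x - I x) ^+ 2)%:E < (e / 8)%:E)%E /\
   (sqnorm P r (fun s x => simple_value (Sn n) s x - H s x)%R < (e / 8)%:E)%E.
  have [N _ hN] : \forall n \near \oo,
   (\int[P]_x ((simple_integral w (Sn n) r x - I x) ^+ 2)%:E < (e / 8)%:E)%E /\
   (sqnorm P r (fun s x => simple_value (Sn n) s x - H s x)%R < (e / 8)%:E)%E.
    by near=> n; split; near: n; exact: cvge0_lt.
  by exists N; apply: (hN N) => /=.
have h1 : (sqnorm P r (fun s x => (simple_value (Sn n) s x - simple_value S s x)%R)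
    <= 2%:E * ((e / 8)%:E + K))%E.
  apply: (@le_trans _ _ (2%:E * (sqnorm P r (fun s x => simple_value (Sn n) s x - H s x)%R + K))%E).
    apply: sqnorm_le2 => //; [exact: jmeasB|exact: jmeasB|exact: jmeasB|].
    move=> s x _; have := sqr_ge0 (simple_value (Sn n) s x - H s x + (simple_value S s x - H s x)).
    nra.
  by rewrite lee_pmul2l ?fin_numE// leeD2r// ltW.
have h2 := @le_integral_sqr2 _ _ _ P 2 (fun x => I x - simple_integral w S r x)
   (fun x => simple_integral w (Sn n) r x - I x)
   (fun x => simple_integral w (Sn n) r x - simple_integral w S r x) (ler0n _ 2)
   (measurable_funB mI (mSI S)) (measurable_funB (mSI (Sn n)) mI)
   (measurable_funB (mSI (Sn n)) (mSI S)).
apply: le_trans (h2 _) _ => [x|].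
  have := sqr_ge0 (simple_integral w (Sn n) r x - I x +
    (simple_integral w (Sn n) r x - simple_integral w S r x)); nra.
rewrite (simple_integral_isometry F_usual w_wiener)//.
apply: (@le_trans _ _ (2%:E * ((e / 8)%:E + (2%:E * ((e / 8)%:E + K))))%E).
  by rewrite lee_pmul2l// leeD// ltW.
have K0 : (0 <= K)%E by exact: sqnorm_ge0.
(* For finite [K] the total is 4 K + 6 e / 8; for infinite [K] the bound is trivial. *)
case: K K0 {h1} => [k||] // k0.
  by rewrite -!(EFinM,EFinD) lee_fin; lra.
by rewrite [X in (_ <= X + _)%E]gt0_muley// addye// leey.
Unshelve. all: by end_near. Qed.

(** The two versions may come from different sequences, but [ito_integral_approx] places both near
    the integral of the same simple process. *)
Lemma ito_integral_unique H t I I' : 0 <= t ->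
  is_ito_integral P F w H t I -> is_ito_integral P F w H t I' ->
  {ae P, forall x, I x = I' x}.
Proof.
move=> t0 iI iI'; have [pH _ mI [Sn [S1 S2]]] := iI; have [_ _ mI' _] := iI'.
have mSI S' : measurable_fun setT (simple_integral w S' t).
  exact: (simple_integral_measurable F_usual w_wiener).
have z : (\int[P]_x ((I x - I' x) ^+ 2)%:E = 0)%E.
  apply/eqP; rewrite eq_le integral_ge0 ?andbT; last first.
    by move=> x _; rewrite lee_fin sqr_ge0.
  apply/lee_addgt0Pr => e e0; rewrite add0e.
  have e16 : 0 < e / 16 by rewrite divr_gt0.
  have [N _ /(_ N (leqnn N)) hN] := cvge0_lt e16 S1.
  apply: le_trans (@le_integral_sqr2 _ _ _ P 2 _
    (fun x => I x - simple_integral w (Sn N) t x)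
    (fun x => I' x - simple_integral w (Sn N) t x) (ler0n _ 2) _ _ _ _) _.
  - exact: measurable_funB.
  - exact: measurable_funB.
  - exact: measurable_funB.
  - move=> x; have := sqr_ge0 (I x - simple_integral w (Sn N) t x +
      (I' x - simple_integral w (Sn N) t x)); nra.
  apply: (@le_trans _ _ (2%:E * (4%:E * (e / 16)%:E + 4%:E * (e / 16)%:E))%E).
    rewrite lee_pmul2l// leeD//.
    - apply: le_trans (ito_integral_approx (Sn N) t0 iI) _.
      by rewrite lee_pmul2l// ltW.
    - apply: le_trans (ito_integral_approx (Sn N) t0 iI') _.
      by rewrite lee_pmul2l// ltW.
  by rewrite -!(EFinM,EFinD) lee_fin; lra.
have m2 : measurable_fun setT (fun x => ((I x - I' x) ^+ 2)%:E).
  by apply/measurable_EFinP; apply: measurable_funX; exact: measurable_funB.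
have /(ae_eq_integral_abs P measurableT m2) : 
    (\int[P]_x `|((I x - I' x) ^+ 2)%:E| = 0)%E.
  by rewrite -[RHS]z; apply: eq_integral => x _; rewrite gee0_abs// lee_fin sqr_ge0.
apply: filterS => x /= /(_ Logic.I) [] /eqP.
by rewrite sqrf_eq0 subr_eq0 => /eqP.
Qed.

End ito_integral.

(** * Second moments of sums along a partition *)

Lemma lee_mul2l_EFin {R : realDomainType} (r : R) (x y : \bar R) :
  0 <= r -> (x <= y)%E -> (r%:E * x <= r%:E * y)%E.
Proof. by move=> r0 xy; apply: lee_wpmul2l; rewrite ?lee_fin. Qed.

(** The half-open cells are disjoint, so at most one term of the sum survives. *)
Lemma grid_sum {R : realType} N (tau a : nat -> R) (s : R) :
  (forall p, tau p <= tau p.+1) ->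
  (exists2 p, (p < N)%N & tau p < s <= tau p.+1 /\
     \sum_(i < N) a i * \1_(`]tau i, tau i.+1]%classic) s = a p) \/
  ((forall p, (p < N)%N -> ~~ (tau p < s <= tau p.+1)) /\
     \sum_(i < N) a i * \1_(`]tau i, tau i.+1]%classic) s = 0).
Proof.
move=> tauS; have tau_homo : {homo tau : i j / (i <= j)%N >-> i <= j}.
  exact/nondecreasing_seqP.
elim: N => [|N [[p pN [sp e]]|[sN e]]]; first by right; rewrite big_ord0.
  left; exists p; first exact: ltnW.
  split=> //; rewrite big_ord_recr/= e indicE mem_setE in_itv/=.
  rewrite [_ < s]ltNge (_ : s <= tau N) ?mulr0 ?addr0//.
  by case/andP: sp => _ /le_trans; apply; exact: tau_homo.
have [h|h] := boolP (tau N < s <= tau N.+1).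
  left; exists N => //; split=> //.
  by rewrite big_ord_recr/= e add0r indicE mem_setE in_itv/= h mulr1.
right; split=> [p|].
  by rewrite ltnS leq_eqVlt => /predU1P[->//|]; exact: sN.
by rewrite big_ord_recr/= e add0r indicE mem_setE in_itv/= (negbTE h) mulr0.
Qed.

Lemma sum_sqnorm_le {R : realType} {d} {T : measurableType d} (P : probability T R)
    t N (f : nat -> R -> T -> R) (g : R -> T -> R) :
  (forall p, jmeas t (f p)) -> jmeas t g ->
  (forall s x, 0 < s <= t -> \sum_(p < N) f p s x ^+ 2 <= g s x ^+ 2) ->
  (\sum_(p < N) sqnorm P t (f p) <= sqnorm P t g)%E.
Proof.
move=> mf mg fg.
rewrite /sqnorm -ge0_integral_sum//; last 2 first.
- by move=> p; exact: jmeas_sqr_integral.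
- by move=> p x _; apply: integral_ge0 => s _; rewrite lee_fin sqr_ge0.
apply: ge0_le_integral => //.
- by move=> x _; apply: sume_ge0 => p _; apply: integral_ge0 => s _; rewrite lee_fin sqr_ge0.
- by apply: emeasurable_sum => p; exact: jmeas_sqr_integral.
- exact: jmeas_sqr_integral.
move=> x _.
have ms f' : jmeas t f' -> measurable_fun `]0, t]
    (fun s : measurableTypeR R => (f' s x ^+ 2)%:E).
  move=> mf'; apply/measurable_EFinP; apply: measurable_funX.
  exact: jmeas_section_time.
rewrite -ge0_integral_sum//; last 2 first.
- by move=> p; exact: ms.
- by move=> p s _; rewrite lee_fin sqr_ge0.
apply: ge0_le_integral => //.
- by move=> s _; apply: sume_ge0 => p _; rewrite lee_fin sqr_ge0.
- by apply: emeasurable_sum => p; exact: ms.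
- exact: ms.
- by move=> s; rewrite /= in_itv/= => st; rewrite sumEFin lee_fin; exact: fg.
Qed.

Section grid_error.
Context {R : realType} {d : measure_display} {T : measurableType d}.
Variables (P : probability T R) (F : R -> set (set T)) (w : R -> T -> R).
Hypotheses (F_usual : usual_filtration P F) (w_wiener : wiener P F w).
Variables (sigma I : R -> T -> R) (t : R).
Hypothesis t0 : 0 <= t.
Hypothesis iI : forall r, 0 <= r -> is_ito_integral P F w sigma r (I r).
Variables (N : nat) (tau : nat -> R) (c : nat -> T -> R) (S : simple_process F).
Hypotheses (tau0 : 0 <= tau 0%N) (tauS : forall p, tau p <= tau p.+1) (tauN : tau N <= t).
Hypothesis mc : forall p, (p < N)%N -> measurable_at F (tau p) (c p).
Hypothesis bc : forall p, (p < N)%N -> bounded_rv (c p).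
Hypothesis Sc : forall p s x, (p < N)%N -> tau p < s <= tau p.+1 ->
  simple_value S s x = c p x.
Variable eps : R.
Hypothesis Seps :
  (sqnorm P t (fun s x => (simple_value S s x - sigma s x)%R) <= eps%:E)%E.

(** On the cell the simple process [S] equals [c p], so this is the increment of the stochastic
    integral of [sigma - S]. *)
Definition grid_error p x :=
  I (tau p.+1) x - I (tau p) x - c p x * (w (tau p.+1) x - w (tau p) x).

Let tau_homo : {homo tau : i j / (i <= j)%N >-> i <= j}.
Proof. exact/nondecreasing_seqP. Qed.

Let taup0 p : 0 <= tau p. Proof. exact: le_trans tau0 (tau_homo (leq0n p)). Qed.

Let msigma : jmeas t sigma.
Proof. by have [pH _ _ _] := iI t0; exact: (progressive_jmeas0 F_usual t0 pH). Qed.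

Let mSI (S' : simple_process F) r : 0 <= r -> measurable_fun setT (simple_integral w S' r).
Proof. exact: (simple_integral_measurable F_usual w_wiener). Qed.

Let mI r : 0 <= r -> measurable_fun setT (I r).
Proof. by move=> /iI[]. Qed.

Let mS (S' : simple_process F) : jmeas t (simple_value S').
Proof. exact: (jmeas_simple_value F_usual). Qed.

(** [S'] is an auxiliary simple process that will be taken arbitrarily close to [sigma]. The
    isometry is exact for its integral, and the discrepancy with [I] is confined to this term. *)
Let rho (S' : simple_process F) p x := I (tau p) x - simple_integral w S' (tau p) x.

Let rho_sqr (S' : simple_process F) p : (p <= N)%N ->
  (\int[P]_x ((rho S' p x) ^+ 2)%:E <=
   4%:E * sqnorm P t (fun s x => (simple_value S' s x - sigma s x)%R))%E.
Proof.
move=> pN; apply: le_trans (ito_integral_approx F_usual w_wiener S' (taup0 p) (iI (taup0 p))) _.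
apply: lee_mul2l_EFin; [exact: ler0n|apply: sqnorm_mono].
  exact: le_trans (tau_homo pN) tauN.
exact: jmeasB.
Qed.

Let mrho S' p : measurable_fun setT (rho S' p).
Proof. by apply: measurable_funB; [exact: mI|exact: mSI]. Qed.

(** The recursion makes [k] grow exponentially with [n]. This is harmless: [k] does not depend on
    [S'], which is chosen afterwards. *)
Let weighted_rho (M : R) (Z : nat -> T -> R) n : (n <= N)%N ->
  (forall p, (p < N)%N -> measurable_fun setT (Z p)) ->
  (forall p x, (p < N)%N -> `|Z p x| <= M) ->
  exists2 k : R, 0 <= k & forall S',
    (\int[P]_x ((\sum_(p < n) Z p x * (rho S' p.+1 x - rho S' p x)) ^+ 2)%:E <=
     k%:E * sqnorm P t (fun s x => (simple_value S' s x - sigma s x)%R))%E.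
Proof.
move=> nN mZ ZM.
elim: n nN => [|n ih] nN.
  exists 0 => // S'; rewrite mul0e; under eq_integral do rewrite big_ord0 expr0n.
  by rewrite integral0.
have [k k0 hk] := ih (ltnW nN).
exists (2 * (k + 2 * M ^+ 2 * 8)); first by have := sqr_ge0 M; lra.
move=> S'; set s := sqnorm _ _ _.
have mz p : (p < N)%N -> measurable_fun setT (fun x => Z p x * (rho S' p.+1 x - rho S' p x)).
  by move=> pN; apply: measurable_funM; [exact: mZ|exact: measurable_funB].
have h1 : (\int[P]_x ((Z n x * (rho S' n.+1 x - rho S' n x)) ^+ 2)%:E <=
    (2 * M ^+ 2)%:E * (4%:E * s + 4%:E * s))%E.
  apply: le_trans (@le_integral_sqr2 _ _ _ P (2 * M ^+ 2) _ (rho S' n.+1) (rho S' n) _ _ _ _ _) _ => //.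
  - by rewrite mulr_ge0// sqr_ge0.
  - exact: mz.
  - move=> x; rewrite exprMn.
    have h : Z n x ^+ 2 <= M ^+ 2.
      rewrite -real_normK ?num_real// ler_sqr ?nnegrE//; first exact: ZM.
      by rewrite (le_trans (normr_ge0 (Z n x)))// ZM.
    apply: (@le_trans _ _ (M ^+ 2 * (rho S' n.+1 x - rho S' n x) ^+ 2)).
      by rewrite ler_wpM2r// sqr_ge0.
    rewrite [leRHS]mulrAC [leRHS]mulrC; apply: ler_wpM2l; first exact: sqr_ge0.
    have := sqr_ge0 (rho S' n.+1 x + rho S' n x); nra.
  - apply: lee_mul2l_EFin; first by rewrite mulr_ge0// sqr_ge0.
    by apply: leeD; apply: rho_sqr => //; exact: ltnW.
apply: le_trans (@le_integral_sqr2 _ _ _ P 2 _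
  (fun x => \sum_(p < n) Z p x * (rho S' p.+1 x - rho S' p x))
  (fun x => Z n x * (rho S' n.+1 x - rho S' n x)) (ler0n _ 2) _ _ _ _) _.
- apply: measurable_sum => p; apply: mz; exact: leq_trans (ltn_ord p) nN.
- apply: measurable_sum => p; apply: mz; exact: leq_trans (ltn_ord p) (ltnW nN).
- exact: mz.
- move=> x; rewrite big_ord_recr/=; set a := \sum_(p < n) _; set b := _ * _.
  have := sqr_ge0 (a - b); nra.
rewrite EFinM -muleA; apply: lee_mul2l_EFin; first exact: ler0n.
have M0 : 0 <= 2 * M ^+ 2 by have := sqr_ge0 M; lra.
have s0 : (0 <= s)%E by exact: sqnorm_ge0.
rewrite EFinD ge0_muleDl; [|by rewrite lee_fin|by rewrite lee_fin; lra].
apply: leeD; first exact: hk.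
apply: le_trans h1 _; rewrite [in leRHS]EFinM -[leRHS]muleA.
apply: lee_mul2l_EFin => //.
by rewrite -ge0_muleDl// -EFinD lee_wpmul2r// lee_fin; lra.
Qed.

(** The increments of [I] are those of the integral of [S'] plus those of [rho]: the former obey the
    isometry, the latter are controlled by [weighted_rho]. *)
Let weighted_error (M : R) (Z : nat -> T -> R) :
  (forall p, (p < N)%N -> measurable_at F (tau p) (Z p)) ->
  (forall p x, (p < N)%N -> `|Z p x| <= M) ->
  exists2 k : R, 0 <= k & forall S' : simple_process F,
    (\int[P]_x ((\sum_(p < N) Z p x * grid_error p x) ^+ 2)%:E <=
     2%:E * (sqnorm P t (fun s x =>
        (\sum_(p < N) Z p x * \1_(`]tau p, tau p.+1]%classic) s *
           (simple_value S' s x - c p x))%R)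
     + k%:E * sqnorm P t (fun s x => (simple_value S' s x - sigma s x)%R)))%E.
Proof.
move=> mZ ZM.
have mZT p : (p < N)%N -> measurable_fun setT (Z p).
  by move=> pN; exact: (measurable_atW F_usual (taup0 p) (mZ p pN)).
have mcT p : (p < N)%N -> measurable_fun setT (c p).
  by move=> pN; exact: (measurable_atW F_usual (taup0 p) (mc pN)).
have [k k0 hk] := weighted_rho (leqnn N) mZT ZM.
exists k => // S'.
have bZ p : (p < N)%N -> bounded_rv (Z p) by move=> pN; exists M => x; exact: ZM.
have [mD eD] := weighted_increments_isometry F_usual w_wiener S' tau0 tauS tauN mZ bZ mc bc.
apply: le_trans (@le_integral_sqr2 _ _ _ P 2 _ _
  (fun x => \sum_(p < N) Z p x * (rho S' p.+1 x - rho S' p x)) (ler0n _ 2) _ mD _ _) _.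
- apply: measurable_sum => p; apply: measurable_funM; first exact: mZT.
  apply: measurable_funB; first by apply: measurable_funB; exact: mI.
  apply: measurable_funM; first exact: mcT.
  apply: (measurable_atW F_usual (taup0 p.+1)).
  exact: (wiener_incr_measurable F_usual w_wiener).
- apply: measurable_sum => p; apply: measurable_funM; first exact: mZT.
  exact: measurable_funB.
- move=> x; set A := \sum_(p < N) _; set B := \sum_(p < N) _; set C := \sum_(p < N) _.
  have -> : A = B + C.
    rewrite -big_split/=; apply: eq_bigr => p _; rewrite -mulrDr; congr (_ * _).
    by rewrite /grid_error /rho; ring.
  have := sqr_ge0 (B - C); nra.
apply: lee_mul2l_EFin; first exact: ler0n.
apply: leeD; last exact: hk.
by rewrite eD.
Qed.

Let mc1 (Z : nat -> T -> R) (S' : simple_process F) p : (p < N)%N ->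
  measurable_fun setT (Z p) ->
  jmeas t (fun s x => Z p x * \1_(`]tau p, tau p.+1]%classic) s *
    (simple_value S' s x - c p x)).
Proof.
move=> pN mZ; apply: jmeasM; first exact: jmeas_rv_indic.
apply: jmeasB; first exact: mS.
apply: measurable_funTS; apply: measurableT_comp measurable_snd.
exact: (measurable_atW F_usual (taup0 p) (mc pN)).
Qed.

Let S'_small (k : R) (e : R) : 0 <= k -> 0 < e -> exists S' : simple_process F,
  exists2 r : R, k * r <= e &
  (0 <= r) /\ (sqnorm P t (fun s x => (simple_value S' s x - sigma s x)%R) <= r%:E)%E.
Proof.
move=> k0 e0; have [_ _ _ [Sn [S1 _]]] := iI t0.
have ek : 0 < e / (k + 1) by rewrite divr_gt0// ltr_wpDl.
have [n _ /(_ n (leqnn n)) hn] := cvge0_lt ek S1.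
exists (Sn n), (e / (k + 1)); last by split; exact: ltW.
rewrite mulrA ler_pdivrMr ?ltr_wpDl// mulrC ler_wpM2l// ?ltW//; lra.
Qed.

Let SS' (S' : simple_process F) (r : R) :
  (sqnorm P t (fun s x => (simple_value S' s x - sigma s x)%R) <= r%:E)%E ->
  (sqnorm P t (fun s x => (simple_value S' s x - simple_value S s x)%R) <=
   (2 * (r + eps))%:E)%E.
Proof.
move=> h; apply: (@le_trans _ _
  (2%:E * (sqnorm P t (fun s x => (simple_value S' s x - sigma s x)%R) +
     sqnorm P t (fun s x => (simple_value S s x - sigma s x)%R)))%E).
  apply: sqnorm_le2 => //; [exact: jmeasB|exact: jmeasB|exact: jmeasB|].
  move=> s x _; have := sqr_ge0 (simple_value S' s x - sigma s x +
    (simple_value S s x - sigma s x)); nra.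
rewrite [leRHS]EFinM; apply: lee_mul2l_EFin => //.
by rewrite [leRHS]EFinD; exact: leeD.
Qed.

Lemma grid_error_weighted (M : R) (Z : nat -> T -> R) :
  (forall p, (p < N)%N -> measurable_at F (tau p) (Z p)) ->
  (forall p x, (p < N)%N -> `|Z p x| <= M) ->
  (\int[P]_x ((\sum_(p < N) Z p x * grid_error p x) ^+ 2)%:E <=
   (4 * M ^+ 2 * eps)%:E)%E.
Proof.
move=> mZ ZM.
have M2 := sqr_ge0 M.
have [k k0 hk] := weighted_error mZ ZM.
apply/lee_addgt0Pr => e e0.
(* The final bound is 4 M^2 eps + (2 k + 4 M^2) r; knowing [k], the process [S'] is taken so close
   to [sigma] that the second term is at most [e]. *)
have [S' [r re [r0 hr]]] := @S'_small (2 * k + 4 * M ^+ 2) e ltac:(lra) e0.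
apply: le_trans (hk S') _.
apply: (@le_trans _ _ (2%:E * ((M ^+ 2)%:E * (2 * (r + eps))%:E + k%:E * r%:E))%E).
  apply: lee_mul2l_EFin; first exact: ler0n.
  apply: leeD; last exact: lee_mul2l_EFin.
  apply: le_trans (lee_mul2l_EFin M2 (SS' hr)).
  apply: sqnorm_le => //; last first.
  - move=> s x st; have := @grid_sum _ N tau (fun p => Z p x * (simple_value S' s x - c p x)) s tauS.
    under eq_bigr do rewrite mulrAC.
    move=> [[p pN [sp ->]]|[_ ->]]; last by rewrite expr0n mulr_ge0 ?sqr_ge0.
    rewrite exprMn -(Sc x pN sp) ler_wpM2r ?sqr_ge0//.
    rewrite -real_normK ?num_real// ler_sqr ?nnegrE//; first exact: ZM.
    by rewrite (le_trans (normr_ge0 (Z p x)))// ZM.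
  - exact: jmeasB.
  - apply: measurable_sum => p; apply: mc1 => //.
    exact: (measurable_atW F_usual (taup0 p) (mZ p (ltn_ord p))).
by rewrite -!(EFinM,EFinD) lee_fin; nra.
Qed.

(** Kronecker weights isolate one squared error at a time. Since the cells are disjoint, the norms
    over them add up to at most the norm of [S' - S], so the number of cells does not enter the
    bound. *)
Lemma grid_error_sum_sqr :
  (\int[P]_x (\sum_(p < N) grid_error p x ^+ 2)%:E <= (4 * eps)%:E)%E.
Proof.
pose Z (q p : nat) (x : T) : R := (p == q)%:R.
have mZ q p : (p < N)%N -> measurable_at F (tau p) (Z q p).
  by move=> _; exact: measurable_cst.
have ZM q p x : (p < N)%N -> `|Z q p x| <= 1 by move=> _; rewrite normr_nat; case: (_ == _).
have Zsum (q : 'I_N) (f : nat -> R) x : \sum_(p < N) Z q p x * f p = f q.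
  rewrite (bigD1 q)//= /Z eqxx mul1r big1 ?addr0// => i iq.
  by rewrite (_ : (_ == _) = false) ?mul0r//; apply/negbTE; exact: iq.
pose G q (S' : simple_process F) s x :=
  (\1_(`]tau q, tau q.+1]%classic) s : R) * (simple_value S' s x - c q x).
have /choice[kf hk] : forall q : 'I_N, exists k : R, 0 <= k /\ forall S' : simple_process F,
    (\int[P]_x (grid_error q x ^+ 2)%:E <=
     2%:E * (sqnorm P t (G q S')
     + k%:E * sqnorm P t (fun s x => (simple_value S' s x - sigma s x)%R)))%E.
  move=> q; have [k k0 hk] := weighted_error (mZ q) (ZM q).
  exists k; split=> // S'.
  apply: (le_trans _ (le_trans (hk S') _)).
    rewrite le_eqVlt; apply/orP; left; apply/eqP; apply: eq_integral => x _.
    by rewrite (Zsum q (fun p => grid_error p x)).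
  apply: lee_mul2l_EFin; first exact: ler0n.
  apply: leeD => //; rewrite le_eqVlt; apply/orP; left; apply/eqP.
  apply: eq_sqnorm => s x _; under eq_bigr do rewrite -mulrA.
  by rewrite (Zsum q (fun p => \1_(`]tau p, tau p.+1]%classic) s *
     (simple_value S' s x - c p x))).
pose k := \sum_(q < N) kf q.
have k0 : 0 <= k by apply: sumr_ge0 => q _; have [] := hk q.
apply/lee_addgt0Pr => e e0.
have [S' [r re [r0 hr]]] := @S'_small (2 * k + 4) e ltac:(lra) e0.
have mE (q : 'I_N) : measurable_fun setT (grid_error q).
  apply: measurable_funB; first by apply: measurable_funB; exact: mI.
  apply: measurable_funM; first exact: (measurable_atW F_usual (taup0 q) (mc (ltn_ord q))).
  apply: (measurable_atW F_usual (taup0 q.+1)).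
  exact: (wiener_incr_measurable F_usual w_wiener).
under eq_integral do rewrite -sumEFin.
rewrite ge0_integral_sum//; last 2 first.
- by move=> q; apply/measurable_EFinP; apply: measurable_funX.
- by move=> q x _; rewrite lee_fin sqr_ge0.
apply: (@le_trans _ _ (\sum_(q < N) (2%:E * (sqnorm P t (G q S') + (kf q * r)%:E)))%E).
  apply: lee_sum => q _; have [kq0 hq] := hk q; apply: le_trans (hq S') _.
  apply: lee_mul2l_EFin; first exact: ler0n.
  by apply: leeD => //; rewrite EFinM; exact: lee_mul2l_EFin.
rewrite -ge0_sume_distrr; last first.
  move=> q _; apply: adde_ge0; first exact: sqnorm_ge0.
  by rewrite lee_fin mulr_ge0//; have [] := hk q.
apply: (@le_trans _ _ (2%:E * ((2 * (r + eps))%:E + (k * r)%:E))%E).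
  apply: lee_mul2l_EFin; first exact: ler0n.
  rewrite big_split/=; apply: leeD; last by rewrite sumEFin -mulr_suml.
  apply: le_trans (SS' hr).
  have mG (q : 'I_N) : jmeas t (G q S').
    have := @mc1 (fun _ _ => 1) S' q (ltn_ord q) (measurable_cst _).
    by apply: eq_jmeas => s x _; rewrite mul1r.
  (* [sum_sqnorm_le] asks for measurability at every index, hence the extension by 0 beyond the
     grid. *)
  pose G' q := if (q < N)%N then G q S' else fun _ _ => 0.
  have -> : (\sum_(q < N) sqnorm P t (G q S') = \sum_(q < N) sqnorm P t (G' q))%E.
    by apply: eq_bigr => q _; rewrite /G' ltn_ord.
  apply: sum_sqnorm_le.
  - move=> p; rewrite /G'; case: ifPn => [pN|_]; last exact: measurable_cst.
    exact: (mG (Ordinal pN)).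
  - exact: jmeasB.
  - move=> s x st; under eq_bigr do rewrite /G' ltn_ord /G exprMn.
    have e1 (p : nat) : (\1_(`]tau p, tau p.+1]%classic) s : R) ^+ 2 =
        \1_(`]tau p, tau p.+1]%classic) s.
      by rewrite indicE; case: (_ \in _); rewrite ?expr0n ?expr1n.
    under eq_bigr do rewrite e1 mulrC.
    have := @grid_sum _ N tau (fun p => (simple_value S' s x - c p x) ^+ 2) s tauS.
    move=> [[p pN [sp ->]]|[_ ->]]; last exact: sqr_ge0.
    by rewrite -(Sc x pN sp).
by rewrite -!(EFinM,EFinD) lee_fin; nra.
Qed.

End grid_error.

(** * Fine grids adapted to a simple process *)

Section simple_grid.
Context {R : realType} {d : measure_display} {T : measurableType d}.
Variables (P : probability T R) (F : R -> set (set T)).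
Hypothesis F_usual : usual_filtration P F.
Variables (S : simple_process F) (t : R) (n : nat).
Variable L : nat -> R.
Hypotheses (t0 : 0 <= t) (n0 : (0 < n)%N).
Hypothesis coef_le : forall j x, `|sp_coef S j x| <= L j.

(** The jump times of [S], cut at [t], make [S] constant on every cell; the uniform points make the
    mesh small. *)
Let pts : seq R := sort <=%R
  ([seq Num.min (sp_time S i) t | i <- iota 0 (sp_size S).+1] ++
   [seq t * i%:R / n%:R | i <- iota 0 n.+1]).

(** The default value [t] prolongs the grid by a constant, so that [tau (size pts) = t]; repeated
    points only create empty cells. *)
Let tau p := nth t pts p.

Let mem_pts a : a \in pts -> 0 <= a <= t.
Proof.
rewrite mem_sort mem_cat => /orP[|] /mapP[i]; rewrite mem_iota => /= iS ->.
  by rewrite le_min sp_time_ge0' t0/= ge_min lexx orbT.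
rewrite divr_ge0 ?mulr_ge0//= ler_pdivrMr ?ltr0n// ler_wpM2l// ler_nat.
by rewrite -ltnS.
Qed.

Let tau_itv p : 0 <= tau p <= t.
Proof.
have [pn|pn] := ltnP p (size pts); first by apply: mem_pts; exact: mem_nth.
by rewrite /tau nth_default// t0 lexx.
Qed.

Let tau_homo p q : (p <= q)%N -> tau p <= tau q.
Proof.
move=> pq; have [qn|qn] := ltnP q (size pts); last first.
  by rewrite {2}/tau nth_default//; case/andP: (tau_itv p).
rewrite /tau; apply: (sorted_leq_nth le_trans le_refl) => //.
  by apply: sort_sorted; exact: le_total.
by rewrite inE; exact: leq_ltn_trans qn.
Qed.

Let gap a p : a \in pts -> a <= tau p \/ tau p.+1 <= a.
Proof.
move=> al; rewrite -[a](nth_index t al) -/(tau (index a pts)).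
by have [h|h] := leqP (index a pts) p; [left|right]; exact: tau_homo.
Qed.

Let grid_mem i : (i <= n)%N -> t * i%:R / n%:R \in pts.
Proof.
move=> ni; rewrite mem_sort mem_cat; apply/orP; right; apply/mapP; exists i => //.
by rewrite mem_iota.
Qed.

Let time_mem i : (i <= sp_size S)%N -> Num.min (sp_time S i) t \in pts.
Proof.
move=> ni; rewrite mem_sort mem_cat; apply/orP; left; apply/mapP; exists i => //.
by rewrite mem_iota.
Qed.

Let mesh p : tau p.+1 - tau p <= t / n%:R.
Proof.
have [//|h] := leP (tau p.+1 - tau p) (t / n%:R).
(* A cell longer than [t / n] cannot end before the next uniform point, so by induction all uniform
   points lie to its left. The last of them is [t], which leaves no room for the cell. *)
have : forall i, (i <= n)%N -> t * i%:R / n%:R <= tau p.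
  elim=> [_|i ih ni]; first by rewrite mulr0 mul0r; case/andP: (tau_itv p).
  have [//|h'] := gap p (grid_mem ni).
  have := ih (ltnW ni); move: h'; rewrite -natr1 mulrDr mulr1 mulrDl; lra.
move=> /(_ n (leqnn n)); rewrite mulfK ?pnatr_eq0 -?lt0n// => tp.
have /andP[_ tp'] := tau_itv p.+1.
have : 0 <= t / n%:R by rewrite divr_ge0.
lra.
Qed.

(** Closed on the left at [tau p], in contrast to [simple_value]: no jump time lies strictly inside
    a cell, so a jump time is below [s] exactly when it is at most [tau p]. Hence [c p] is known at
    time [tau p]. *)
Let c p x := \sum_(j < sp_size S) sp_coef S j x *
  \1_(`[sp_time S j, sp_time S j.+1[%classic) (tau p).

Lemma simple_grid : exists N (tau : nat -> R) (c : nat -> T -> R),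
  [/\ tau 0%N = 0, forall p, tau p <= tau p.+1, tau N = t
    & forall p, tau p.+1 - tau p <= t / n%:R] /\
  [/\ forall p, measurable_at F (tau p) (c p),
      forall p x, `|c p x| <= \sum_(j < sp_size S) L j
    & forall p s x, (p < N)%N -> tau p < s <= tau p.+1 ->
      simple_value S s x = c p x].
Proof.
exists (size pts), tau, c; split; split.
- apply/eqP; rewrite eq_le; have /andP[-> _] := tau_itv 0%N; rewrite andbT.
  have := grid_mem (leq0n n); rewrite mulr0 mul0r => h.
  by rewrite -[leRHS](nth_index t h); exact: tau_homo.
- by move=> p; exact: tau_homo.
- by rewrite /tau nth_default.
- exact: mesh.
- move=> p; apply: measurable_sum => j.
  rewrite indicE mem_setE in_itv/=.
  have [h|h] := leP (sp_time S j) (tau p); last first.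
    by rewrite /=; under eq_fun do rewrite mulr0; exact: measurable_cst.
  apply: measurable_funM; last exact: measurable_cst.
  exact: (measurable_at_le F_usual (sp_time_ge0' S j) h (@sp_coef_meas _ _ _ _ S j)).
- move=> p x; apply: le_trans (ler_norm_sum _ _ _) _.
  apply: ler_sum => j _; rewrite normrM indicE normr_nat.
  case: (_ \in _); rewrite ?mulr1 ?mulr0//.
  by rewrite (le_trans (normr_ge0 (sp_coef S j x))).
- move=> p s x pN /andP[ps sp]; rewrite /simple_value /c.
  apply: eq_bigr => j _; congr (_ * _).
  have st : s <= t by case/andP: (tau_itv p.+1) => _; exact: le_trans.
  have h i : (i <= sp_size S)%N -> (sp_time S i < s) = (sp_time S i <= tau p).
    move=> iS; apply/idP/idP => [si|/le_lt_trans]; last exact.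
    have [|] := gap p (time_mem iS); rewrite (min_idPl _)//.
    + by rewrite (le_trans (ltW si)).
    + by move=> /(le_trans sp); rewrite leNgt si.
    + by rewrite (le_trans (ltW si)).
  rewrite !indicE !mem_setE !in_itv/=; congr (_ : bool)%:R.
  by rewrite (h j (ltnW (ltn_ord j))) [s <= _]leNgt (h j.+1 (ltn_ord j)) -ltNge.
Qed.

End simple_grid.

(** * Weighted sums of compensated squares *)

Section compensated.
Context {R : realType} {d : measure_display} {T : measurableType d}.
Variables (P : probability T R) (F : R -> set (set T)) (w : R -> T -> R).
Hypotheses (F_usual : usual_filtration P F) (w_wiener : wiener P F w).
Variables (t : R) (N : nat) (tau : nat -> R) (Z : nat -> T -> R) (M delta : R).
Hypotheses (tau0 : 0 <= tau 0%N) (tauS : forall p, tau p <= tau p.+1) (tauN : tau N <= t).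
Hypothesis mesh : forall p, tau p.+1 - tau p <= delta.
Hypothesis mZ : forall p, measurable_at F (tau p) (Z p).
Hypothesis ZM : forall p x, `|Z p x| <= M.

Let D p x := Z p x * ((w (tau p.+1) x - w (tau p) x) ^+ 2 - (tau p.+1 - tau p)).

Let tau_homo : {homo tau : i j / (i <= j)%N >-> i <= j}.
Proof. exact/nondecreasing_seqP. Qed.

Let taup0 p : 0 <= tau p. Proof. exact: le_trans tau0 (tau_homo (leq0n p)). Qed.

Let M0 : 0 <= M. Proof. exact: le_trans (normr_ge0 _) (ZM 0 point). Qed.

Let mW p : measurable_at F (tau p.+1) (fun x => w (tau p.+1) x - w (tau p) x).
Proof. exact: (wiener_incr_measurable F_usual w_wiener). Qed.

Let mD p : measurable_at F (tau p.+1) (D p).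
Proof.
apply: measurable_funM.
  by apply: (measurable_at_le F_usual (taup0 p) (tauS p)); exact: mZ.
apply: measurable_funB; last exact: measurable_cst.
by apply: measurable_funX; exact: mW.
Qed.

Let mDT p : measurable_fun setT (D p).
Proof. exact: (measurable_atW F_usual (taup0 p.+1) (@mD p)). Qed.

(** For a Wiener increment y, (y^2 - h)^2 <= y^4 + h^2; the fourth moment contributes 64 h^2, hence
    65. *)
Let D_sqr p : (\int[P]_x (D p x ^+ 2)%:E <=
   (65 * M ^+ 2 * (tau p.+1 - tau p) ^+ 2)%:E)%E.
Proof.
set h := tau p.+1 - tau p.
have h0 : 0 <= h by rewrite subr_ge0.
have mW' : measurable_fun setT (fun x => w (tau p.+1) x - w (tau p) x).
  exact: (measurable_atW F_usual (taup0 p.+1) (@mW p)).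
apply: (@le_trans _ _ (\int[P]_x ((M ^+ 2)%:E *
    (((w (tau p.+1) x - w (tau p) x) ^+ 4)%:E + (h ^+ 2)%:E)))%E).
  apply: ge0_le_integral => //.
  - by move=> x _; rewrite lee_fin sqr_ge0.
  - by apply/measurable_EFinP; exact: measurable_funX.
  - apply: measurable_funeM; apply: emeasurable_funD => //.
    by apply/measurable_EFinP; exact: measurable_funX.
  move=> x _; rewrite -EFinD -EFinM lee_fin exprMn -/h.
  apply: ler_pM; [exact: sqr_ge0|exact: sqr_ge0| |].
    by rewrite -real_normK ?num_real// ler_sqr ?nnegrE//; exact: ZM.
  rewrite (exprM _ 2 2); have := sqr_ge0 (w (tau p.+1) x - w (tau p) x).
  by move: (_ ^+ 2) => a a0; nra.
rewrite ge0_integralZl_EFin//; last 3 first.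
- by move=> x _; rewrite adde_ge0// lee_fin ?sqr_ge0// (exprM _ 2 2) sqr_ge0.
- apply: emeasurable_funD => //.
  by apply/measurable_EFinP; exact: measurable_funX.
- exact: sqr_ge0.
rewrite ge0_integralD//; last 3 first.
- by move=> x _; rewrite lee_fin (exprM _ 2 2) sqr_ge0.
- by apply/measurable_EFinP; exact: measurable_funX.
- by move=> x _; rewrite lee_fin sqr_ge0.
have -> : (\int[P]_x (h ^+ 2)%:E = (h ^+ 2)%:E)%E.
  transitivity ((h ^+ 2)%:E * P setT)%E; last by rewrite probability_setT mule1.
  exact: integral_cst.
rewrite (_ : 65 * M ^+ 2 * h ^+ 2 = M ^+ 2 * (64 * h ^+ 2 + h ^+ 2)); last by ring.
rewrite [leRHS]EFinM; apply: lee_mul2l_EFin; first exact: sqr_ge0.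
rewrite EFinD; apply: leeD => //.
exact: (wiener_incr_pow4 F_usual w_wiener).
Qed.

Let D_sqr_int p : P.-integrable setT (fun x => (D p x ^+ 2)%:E).
Proof.
apply/integrableP; split; first by apply/measurable_EFinP; exact: measurable_funX.
under eq_integral do rewrite gee0_abs ?lee_fin ?sqr_ge0//.
exact: le_lt_trans (D_sqr p) (ltry _).
Qed.

Let D_int p : P.-integrable setT (EFin \o D p).
Proof.
apply: (@le_integrable _ _ _ P setT _ _ (fun x => 1%:E + (D p x ^+ 2)%:E)%E) => //.
- exact/measurable_EFinP.
- move=> x _; rewrite -EFinD !abse_EFin lee_fin [leRHS]ger0_norm ?addr_ge0 ?sqr_ge0//.
  rewrite -[D p x ^+ 2]real_normK ?num_real//.
  by move: `|D p x| => y; have := sqr_ge0 (y - 1); have := sqr_ge0 y; nra.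
- apply: integrableD => //; exact: finite_measure_integrable_cst.
Qed.

Let sum_int n : P.-integrable setT (fun x => (\sum_(p < n) D p x)%:E).
Proof. by under eq_fun do rewrite -sumEFin; apply: integrable_sum => // p _; exact: D_int. Qed.

Let sum_sqr_int n : P.-integrable setT (fun x => ((\sum_(p < n) D p x) ^+ 2)%:E).
Proof.
elim: n => [|n ih].
  by under eq_fun do rewrite big_ord0 expr0n; exact: integrable0.
have ms : measurable_fun setT (fun x => \sum_(p < n) D p x) by exact: measurable_sum.
apply: (@le_integrable _ _ _ P setT _ _ (fun x => 2%:E * (((\sum_(p < n) D p x) ^+ 2)%:E + (D n x ^+ 2)%:E))%E) => //.
- by apply/measurable_EFinP; apply: measurable_funX; exact: measurable_sum.
- move=> x _; rewrite -EFinD -EFinM !abse_EFin lee_fin [leLHS]ger0_norm ?sqr_ge0//.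
  rewrite [leRHS]ger0_norm; last by apply: mulr_ge0 => //; apply: addr_ge0; exact: sqr_ge0.
  rewrite big_ord_recr/=; have := sqr_ge0 (\sum_(p < n) D p x - D n x); nra.
- by apply: integrableZl => //; exact: integrableD.
Qed.

(** The cross term with each new summand vanishes, because the partial sum times [Z n] is known at
    time [tau n]. The diagonal terms are of order h^2 <= delta h, and the lengths h telescope. *)
Lemma compensated_sqr_le :
  (\int[P]_x ((\sum_(p < N) D p x) ^+ 2)%:E <= (65 * M ^+ 2 * delta * t)%:E)%E.
Proof.
suff H n : (\int[P]_x ((\sum_(p < n) D p x) ^+ 2)%:E <=
    (65 * M ^+ 2 * delta * (tau n - tau 0%N))%:E)%E.
  apply: le_trans (H N) _; rewrite lee_fin ler_wpM2l//.
    rewrite !mulr_ge0 ?sqr_ge0//; apply: le_trans (mesh 0%N); by rewrite subr_ge0.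
  by rewrite lerBlDr (le_trans tauN)// lerDl.
elim: n => [|n ih].
  under eq_integral do rewrite big_ord0 expr0n.
  by rewrite integral0 subrr mulr0.
have ms : measurable_fun setT (fun x => \sum_(p < n) D p x) by exact: measurable_sum.
have imul : P.-integrable setT (fun x => ((\sum_(p < n) D p x) * D n x)%:E).
  exact: integrable_mul_sqr.
have cross : (\int[P]_x ((\sum_(p < n) D p x) * D n x)%:E = 0)%E.
  have mZ' : measurable_at F (tau n) (fun x => (\sum_(p < n) D p x) * Z n x).
    apply: measurable_funM; last exact: mZ.
    apply: measurable_sum => p.
    apply: (measurable_at_le F_usual (taup0 p.+1) _ (@mD p)).
    exact: tau_homo.
  have iZ : P.-integrable setT (fun x => ((\sum_(p < n) D p x) * Z n x)%:E).
    under eq_fun do rewrite mulrC.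
    apply: (integrable_boundedM (C := M)); [|exact: ZM|exact: sum_int].
    exact: (measurable_atW F_usual (taup0 n) (@mZ n)).
  have [_ <-] := wiener_incr_compensated F_usual w_wiener (taup0 n) (tauS n) mZ' iZ.
  by apply: eq_integral => x _; rewrite /D mulrA.
have i2 : P.-integrable setT (fun x => 2%:E * ((\sum_(p < n) D p x) * D n x)%:E)%E.
  exact: integrableZl.
have -> : (\int[P]_x ((\sum_(p < n.+1) D p x) ^+ 2)%:E =
  \int[P]_x (((\sum_(p < n) D p x) ^+ 2)%:E + 2%:E * ((\sum_(p < n) D p x) * D n x)%:E
     + (D n x ^+ 2)%:E))%E.
  apply: eq_integral => x _; rewrite big_ord_recr/= -!(EFinM,EFinD); congr (_%:E); ring.
rewrite integralD//; last by apply: integrableD.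
rewrite integralD// integralZl// cross mule0 adde0.
apply: (@le_trans _ _ ((65 * M ^+ 2 * delta * (tau n - tau 0%N))%:E +
   (65 * M ^+ 2 * (tau n.+1 - tau n) ^+ 2)%:E)%E); first exact: leeD.
rewrite -EFinD lee_fin.
have h0 : 0 <= tau n.+1 - tau n by rewrite subr_ge0.
have : (tau n.+1 - tau n) ^+ 2 <= delta * (tau n.+1 - tau n).
  by rewrite expr2 ler_wpM2r.
move=> h; have : 65 * M ^+ 2 * (tau n.+1 - tau n) ^+ 2 <=
   65 * M ^+ 2 * (delta * (tau n.+1 - tau n)).
  by rewrite ler_wpM2l// mulr_ge0// sqr_ge0.
lra.
Qed.

End compensated.

(** * Estimates along a path *)

Section trigo_estimates.
Context {R : realType}.
Implicit Types z : R.

Lemma mean_value0 (f df : R -> R) z : (forall x : R, is_derive x 1 f (df x)) ->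
  exists2 c, `|c| <= `|z| & f z - f 0 = df c * z.
Proof.
move=> fdf.
have cf a b : {within `[a, b], continuous f}.
  apply: continuous_subspaceT => x; apply: differentiable_continuous.
  by apply/derivable1_diffP; case: (fdf x).
have [z0|/ltW z0] := leP 0 z.
  have [c] := MVT_segment z0 (fun x _ => fdf x) (cf 0 z).
  rewrite in_itv/= subr0 => /andP[c0 cz] ->; exists c => //.
  by rewrite !ger0_norm.
have [c] := MVT_segment z0 (fun x _ => fdf x) (cf z 0).
rewrite in_itv/= sub0r => /andP[cz c0] e; exists c.
  by rewrite !ler0_norm// lerN2.
by rewrite -opprB e mulrN opprK.
Qed.

(** This and the next bounds are Taylor remainders obtained from one another by the mean value
    theorem; the constant 1 is not sharp but sufficient. *)
Lemma norm_cos_sub1 z : `|cos z - 1| <= z ^+ 2.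
Proof.
have [c cz] := @mean_value0 cos (fun x => - sin x) z ltac:(move=> x; exact: is_derive_cos).
rewrite cos0 => ->; rewrite normrM normrN.
have [b bc] := @mean_value0 sin cos c ltac:(move=> x; exact: is_derive_sin).
rewrite sin0 subr0 => ->; rewrite normrM -[z ^+ 2]real_normK ?num_real// expr2.
apply: ler_wpM2r => //; apply: le_trans cz; rewrite ler_piMl//.
by rewrite ler_norml cos_geN1 cos_le1.
Qed.

Lemma norm_sin_le z : `|sin z| <= `|z|.
Proof.
have [c cz] := @mean_value0 sin cos z ltac:(move=> x; exact: is_derive_sin).
rewrite sin0 subr0 => ->; rewrite normrM ler_piMl//.
by rewrite ler_norml cos_geN1 cos_le1.
Qed.

Lemma norm_sin_subid z : `|sin z - z| <= `|z| ^+ 3.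
Proof.
have d x : is_derive x (1:R) (fun x : R => sin x - x) (cos x - 1).
  exact: is_deriveB.
have [c cz] := @mean_value0 _ _ z d.
rewrite sin0 !subr0 => ->; rewrite normrM exprSr ler_wpM2r//.
apply: le_trans (norm_cos_sub1 c) _.
by rewrite -[c ^+ 2]real_normK ?num_real// ler_sqr// nnegrE.
Qed.

Lemma norm_cos_taylor2 z : `|cos z - 1 + z ^+ 2 / 2| <= z ^+ 4.
Proof.
have d x : is_derive x (1:R) (fun x : R => cos x - 1 + x ^+ 2 / 2) (- (sin x - x)).
  by apply: is_derive_eq; rewrite /GRing.scale/= !mulr1 ?(subr0, mulr0, add0r); field.
have [c cz] := @mean_value0 _ _ z d.
rewrite cos0 subrr expr0n mul0r addr0 subr0 => ->; rewrite normrM normrN.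
have -> : z ^+ 4 = `|z| ^+ 3 * `|z|.
  by rewrite -exprSr -normrX ger0_norm// (exprM z 2 2) sqr_ge0.
apply: ler_wpM2r => //; apply: le_trans (norm_sin_subid c) _.
by rewrite lerXn2r// nnegrE.
Qed.

Lemma norm_cos_le1 z : `|cos z| <= 1.
Proof. by rewrite ler_norml cos_geN1 cos_le1. Qed.

Lemma norm_sin_le1 z : `|sin z| <= 1.
Proof. by rewrite ler_norml sin_geN1 sin_le1. Qed.

End trigo_estimates.

Section uniform_continuity.
Context {R : realType}.
Implicit Types (f : R -> R) (t : R).

Lemma within_continuous_eps (D : set R) f s e : {within D, continuous f} -> D s -> 0 < e ->
  exists2 delta : R, 0 < delta & forall r, D r -> `|s - r| < delta -> `|f s - f r| < e.
Proof.
move=> /subspace_continuousP cf Ds e0; have /cvgrPdist_lt /(_ e e0) := cf s Ds.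
rewrite near_withinE => /nbhs_ballP[delta d0 h].
by exists delta => // r Dr sr; exact: h.
Qed.

(** Heine's theorem by the covering form of compactness: near each point [Q delta] holds for all
    small positive [delta], so some [delta] serves the whole segment. *)
Lemma within_unif_continuous f t : {within `[0, t], continuous f} ->
  forall e, 0 < e -> exists2 delta : R, 0 < delta &
    forall r s, 0 <= r <= t -> 0 <= s <= t -> `|r - s| < delta -> `|f r - f s| < e.
Proof.
move=> cf e e0.
have := @segment_compact R 0 t; rewrite compact_near_coveringP => /near_covering_withinP.
pose Q delta r := forall s, 0 <= s <= t -> `|r - s| < delta -> `|f r - f s| < e.
move=> /(_ R (0^'+) Q _) cover.
have : \forall delta \near 0^'+, `[0, t]%classic `<=` Q delta.
  apply: cover => x xt; have e2 : 0 < e / 2 by rewrite divr_gt0.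
  have [delta d0 hx] := within_continuous_eps cf xt e2.
  have d2 : 0 < delta / 2 by rewrite divr_gt0.
  exists ([set r | `|x - r| < delta / 2], [set r | r < delta / 2]).
    split=> /=; last exact: nbhs_right_lt.
    exact: (nbhsx_ballx x (delta / 2) d2).
  move=> [r dd] [/= xr ddd] rt s st rs.
  have h1 := hx r rt ltac:(lra).
  have h2 : `|f x - f s| < e / 2.
    apply: hx => //; have := ler_distD r x s; lra.
  have := ler_distD (f x) (f r) (f s); rewrite (distrC (f r) (f x)); lra.
move=> h; have [delta [d0 hd]] := @filter_ex _ _ _ _ (filterI (nbhs_right_gt (0:R)) h).
exists delta => // r s rt st; apply: hd => //=; rewrite ?in_itv//.
Qed.

End uniform_continuity.

Section real_integrable.
Context {R : realType} d (T : measurableType d) (mu : {measure set T -> \bar R}).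
Variables (D : set T) (mD : measurable D) (f : T -> R) (k : R).
Hypothesis fi : mu.-integrable D (EFin \o f).

Lemma integrable_EFinZl : mu.-integrable D (EFin \o (fun x => k * f x)).
Proof.
rewrite (_ : EFin \o _ = fun x => (k%:E * (f x)%:E)%E)//.
exact: integrableZl.
Qed.

Lemma integrable_EFinZr : mu.-integrable D (EFin \o (fun x => f x * k)).
Proof.
rewrite (_ : EFin \o _ = fun x => (k%:E * (f x)%:E)%E); first exact: integrableZl.
by apply/funext => x /=; rewrite mulrC.
Qed.

End real_integrable.

Section grid_integrals.
Context {R : realType}.
Local Notation mu := (@lebesgue_measure R).
Variables (t : R) (N : nat) (tau : nat -> R).
Hypotheses (tau0 : tau 0%N = 0) (tauS : forall p, tau p <= tau p.+1) (tauN : tau N = t).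

Let tau_homo : {homo tau : i j / (i <= j)%N >-> i <= j}.
Proof. exact/nondecreasing_seqP. Qed.

Lemma Rintegral_itvD (f : R -> R) (a b c : R) : a <= b -> b <= c ->
  mu.-integrable `]a, c] (EFin \o f) ->
  \int[mu]_(s in `]a, c]) f s = \int[mu]_(s in `]a, b]) f s + \int[mu]_(s in `]b, c]) f s.
Proof.
move=> ab bc fi; rewrite -(@Rintegral_itvB _ f (BRight a) (BRight c) b)//.
by rewrite addrC subrK.
Qed.

Lemma integrable_itvS (f : R -> R) (a b a' b' : R) : a <= a' -> b' <= b ->
  mu.-integrable `]a, b] (EFin \o f) -> mu.-integrable `]a', b'] (EFin \o f).
Proof.
move=> aa' bb'; apply: integrableS => //.
move=> s; rewrite /= !in_itv/= => /andP[as_ sb].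
by rewrite (le_lt_trans aa' as_) (le_trans sb bb').
Qed.

Lemma integrable_grid (f : R -> R) p : (p < N)%N ->
  mu.-integrable `]0, t] (EFin \o f) -> mu.-integrable `]tau p, tau p.+1] (EFin \o f).
Proof.
by move=> pN; apply: integrable_itvS; [rewrite -tau0|rewrite -tauN]; exact: tau_homo.
Qed.

Lemma sum_grid_integral (f : R -> R) : mu.-integrable `]0, t] (EFin \o f) ->
  \sum_(p < N) \int[mu]_(s in `]tau p, tau p.+1]) f s = \int[mu]_(s in `]0, t]) f s.
Proof.
move=> fi; rewrite -{1}tauN in fi *.
suff H n : (n <= N)%N ->
    \sum_(p < n) \int[mu]_(s in `]tau p, tau p.+1]) f s = \int[mu]_(s in `]0, tau n]) f s.
  by rewrite H// tauN.
elim: n => [_|n ih nN]; first by rewrite big_ord0 tau0 set_itvoc0 Rintegral_set0.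
rewrite big_ord_recr/= ih ?(ltnW nN)// -Rintegral_itvD//.
  by rewrite -tau0; exact: tau_homo.
by apply: integrable_itvS fi => //; exact: tau_homo.
Qed.

Lemma sum_grid_le (f g : R -> R) :
  mu.-integrable `]0, t] (EFin \o f) -> mu.-integrable `]0, t] (EFin \o g) ->
  forall b : nat -> R,
  (forall p s, (p < N)%N -> tau p < s <= tau p.+1 -> `|b p * f s| <= g s) ->
  `|\sum_(p < N) b p * \int[mu]_(s in `]tau p, tau p.+1]) f s| <=
  \int[mu]_(s in `]0, t]) g s.
Proof.
move=> fi gi b fg; apply: le_trans (ler_norm_sum _ _ _) _.
rewrite -sum_grid_integral//; apply: ler_sum => p _.
have fip := integrable_grid (ltn_ord p) fi; have gip := integrable_grid (ltn_ord p) gi.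
have bi : mu.-integrable `]tau p, tau p.+1] (EFin \o (fun s => b p * f s)).
  exact: integrable_EFinZl.
rewrite -RintegralZl//; apply: le_trans (le_normr_Rintegral _ bi) _ => //.
apply: le_Rintegral => //; first exact: integrable_norm.
by move=> s; rewrite /= in_itv/=; exact: fg.
Qed.

Lemma Rintegral_itv_cst (a b c : R) : a <= b ->
  \int[mu]_(s in `]a, b]) c = c * (b - a).
Proof.
move=> ab; rewrite Rintegral_cst//= lebesgue_measure_itv/= lte_fin.
by move: ab; rewrite le_eqVlt => /predU1P[->|->//]; rewrite ltxx subrr.
Qed.

Lemma integrable_itv_bounded (f : R -> R) (a b C : R) :
  measurable_fun `]a, b] (f : measurableTypeR R -> R) ->
  (forall s, a < s <= b -> `|f s| <= C) ->
  mu.-integrable `]a, b] (EFin \o f).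
Proof.
move=> mf fC; apply: measurable_bounded_integrable => //.
  by rewrite /= lebesgue_measure_itv/=; case: ifP => // _; rewrite ltry.
exists C; split; first exact: num_real.
move=> C' CC' s; rewrite /= in_itv/= => /fC /le_trans; apply; exact: ltW.
Qed.

End grid_integrals.

(** * The convolution integrals along a fixed path *)

Section path.
Context {R : realType}.
Local Notation mu := (@lebesgue_measure R).
Variables (t : R) (xx u : R -> R).
Hypothesis t0 : 0 <= t.
Hypothesis cx : {within `[0, t], continuous xx}.
Hypothesis iu : mu.-integrable `]0, t] (EFin \o u).

Definition pathX s := \int[mu]_(v in `]0, s]) (cos (xx s - xx v) * u v).
Definition pathY s := \int[mu]_(v in `]0, s]) (sin (xx s - xx v) * u v).

Let mxx : measurable_fun `]0, t] (xx : measurableTypeR R -> R).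
Proof.
apply: (@measurable_funS _ _ _ _ `[0, t]%classic) => //.
- by move=> s; rewrite /= !in_itv/= => /andP[/ltW -> ->].
- exact: subspace_continuous_measurable_fun.
Qed.

Let ifu (f : R -> R) : (forall y, `|f y| <= 1) -> continuous f ->
  mu.-integrable `]0, t] (EFin \o (fun v => f (xx v) * u v)).
Proof.
move=> f1 cf; apply: (@le_integrable _ _ _ mu _ _ _ (EFin \o u)) => //.
- apply/measurable_EFinP; apply: measurable_funM.
    by apply: measurableT_comp => //; exact: continuous_measurable_fun.
  by apply/measurable_EFinP; exact: measurable_int iu.
- by move=> s _; rewrite !abse_EFin lee_fin normrM ler_piMl.
Qed.

Lemma integrable_cos_path c : mu.-integrable `]0, t] (EFin \o (fun v => cos (c - xx v) * u v)).
Proof.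
apply: (ifu (f := fun y => cos (c - y))) => y; first exact: norm_cos_le1.
apply: continuous_comp; last exact: continuous_cos.
by apply: cvgB; [exact: cvg_cst|exact: cvg_id].
Qed.

Lemma integrable_sin_path c : mu.-integrable `]0, t] (EFin \o (fun v => sin (c - xx v) * u v)).
Proof.
apply: (ifu (f := fun y => sin (c - y))) => y; first exact: norm_sin_le1.
apply: continuous_comp; last exact: continuous_sin.
by apply: cvgB; [exact: cvg_cst|exact: cvg_id].
Qed.

Let norm_int_le (f : R -> R) s : (forall y, `|f y| <= 1) -> s <= t ->
  mu.-integrable `]0, t] (EFin \o (fun v => f v * u v)) ->
  `|\int[mu]_(v in `]0, s]) (f v * u v)| <= \int[mu]_(v in `]0, t]) `|u v|.
Proof.
move=> f1 st fi.
have iu' : mu.-integrable `]0, t] (EFin \o (fun v => `|u v|)).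
  exact: (integrable_norm iu).
have [s0|s0] := leP 0 s; last first.
  rewrite set_itv_ge ?Rintegral_set0 ?normr0 ?Rintegral_ge0//.
  by rewrite bnd_simp -leNgt ltW.
rewrite (Rintegral_itvD s0 st iu'); apply: (@le_trans _ _ (\int[mu]_(v in `]0, s]) `|u v|)).
  have fis : mu.-integrable `]0, s] (EFin \o (fun v => f v * u v)).
    exact: integrable_itvS fi.
  apply: le_trans (le_normr_Rintegral _ fis) _ => //.
  apply: le_Rintegral => //; first exact: integrable_norm.
    by apply: integrable_itvS iu'.
  by move=> v _; rewrite normrM ler_piMl.
by rewrite lerDl Rintegral_ge0.
Qed.

Lemma pathX_le s : s <= t -> `|pathX s| <= \int[mu]_(v in `]0, t]) `|u v|.
Proof.
move=> st; apply: norm_int_le => //; last exact: integrable_cos_path.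
by move=> y; exact: norm_cos_le1.
Qed.

Lemma pathY_le s : s <= t -> `|pathY s| <= \int[mu]_(v in `]0, t]) `|u v|.
Proof.
move=> st; apply: norm_int_le => //; last exact: integrable_sin_path.
by move=> y; exact: norm_sin_le1.
Qed.

Lemma pathY_step r s : 0 <= r -> r <= s -> s <= t ->
  pathY s = pathX r * sin (xx s - xx r) + pathY r * cos (xx s - xx r) +
    \int[mu]_(v in `]r, s]) (sin (xx s - xx v) * u v).
Proof.
move=> r0 rs st.
have is_ c : mu.-integrable `]0, s] (EFin \o (fun v => sin (c - xx v) * u v)).
  exact: integrable_itvS (integrable_sin_path c).
have rt := le_trans rs st.
have ir c : mu.-integrable `]0, r] (EFin \o (fun v => sin (c - xx v) * u v)).
  exact: integrable_itvS (integrable_sin_path c).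
have ir' c : mu.-integrable `]0, r] (EFin \o (fun v => cos (c - xx v) * u v)).
  exact: integrable_itvS (integrable_cos_path c).
rewrite {1}/pathY (Rintegral_itvD r0 rs (is_ _)); congr (_ + _).
rewrite /pathX /pathY -!RintegralZr// -RintegralD//; last 2 first.
- exact: integrable_EFinZr.
- exact: integrable_EFinZr.
apply: eq_Rintegral => v _.
have -> : xx s - xx v = (xx s - xx r) + (xx r - xx v) by ring.
by rewrite sinD; ring.
Qed.

Let prim_cont (f : R -> R) : mu.-integrable `]0, t] (EFin \o f) ->
  {within `[0, t], continuous (fun s => \int[mu]_(v in `]0, s]) f v)}.
Proof.
(* Extended by 0 outside []0, t]], [f] becomes integrable on the whole line, and closed and
   half-open integrals agree. *)
move=> fi; pose g : measurableTypeR R -> R := f \_ `]0, t].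
have gi : mu.-integrable setT (EFin \o g).
  by rewrite -restrict_EFin; apply/integrable_restrict => //=; rewrite setTI.
have gi' : mu.-integrable `[0, t] (EFin \o g) by exact: integrableS gi.
have := parameterized_integral_continuous t0 gi'.
apply: subspace_eq_continuous => s; rewrite inE/= in_itv/= => /andP[s0 st].
have gis : mu.-integrable `]0, s] (EFin \o g) by exact: integrableS gi.
apply: etrans (esym (Rintegral_itv_obnd_cbnd gis)) _.
apply: eq_Rintegral => v; rewrite inE/= in_itv/= => /andP[v0 vs].
by rewrite /g patchE mem_set//= in_itv/= v0 (le_trans vs st).
Qed.

(** Expanding the cosine separates [s] from the integration variable, so continuity of [pathX]
    reduces to that of two primitives. *)
Let pathX_split s : s <= t -> pathX s =
  cos (xx s) * \int[mu]_(v in `]0, s]) (cos (xx v) * u v) +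
  sin (xx s) * \int[mu]_(v in `]0, s]) (sin (xx v) * u v).
Proof.
move=> st.
have i1 : mu.-integrable `]0, s] (EFin \o (fun v => cos (xx v) * u v)).
  apply: (integrable_itvS (lexx 0) st); apply: ifu; first exact: norm_cos_le1.
  exact: continuous_cos.
have i2 : mu.-integrable `]0, s] (EFin \o (fun v => sin (xx v) * u v)).
  apply: (integrable_itvS (lexx 0) st); apply: ifu; first exact: norm_sin_le1.
  exact: continuous_sin.
rewrite -!RintegralZl// -RintegralD//; last 2 first.
- exact: integrable_EFinZl.
- exact: integrable_EFinZl.
by apply: eq_Rintegral => v _; rewrite cosB; ring.
Qed.

Let pathY_split s : s <= t -> pathY s =
  sin (xx s) * \int[mu]_(v in `]0, s]) (cos (xx v) * u v) -
  cos (xx s) * \int[mu]_(v in `]0, s]) (sin (xx v) * u v).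
Proof.
move=> st.
have i1 : mu.-integrable `]0, s] (EFin \o (fun v => cos (xx v) * u v)).
  apply: (integrable_itvS (lexx 0) st); apply: ifu; first exact: norm_cos_le1.
  exact: continuous_cos.
have i2 : mu.-integrable `]0, s] (EFin \o (fun v => sin (xx v) * u v)).
  apply: (integrable_itvS (lexx 0) st); apply: ifu; first exact: norm_sin_le1.
  exact: continuous_sin.
rewrite -!RintegralZl// -RintegralB//; last 2 first.
- exact: integrable_EFinZl.
- exact: integrable_EFinZl.
by apply: eq_Rintegral => v _; rewrite sinB; ring.
Qed.

Let cA : {within `[0, t], continuous (fun s => \int[mu]_(v in `]0, s]) (cos (xx v) * u v))}.
Proof. by apply: prim_cont; apply: ifu; [exact: norm_cos_le1|exact: continuous_cos]. Qed.

Let cB : {within `[0, t], continuous (fun s => \int[mu]_(v in `]0, s]) (sin (xx v) * u v))}.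
Proof. by apply: prim_cont; apply: ifu; [exact: norm_sin_le1|exact: continuous_sin]. Qed.

Lemma pathX_continuous : {within `[0, t], continuous pathX}.
Proof.
apply: (@subspace_eq_continuous _ _ _ (fun s =>
  cos (xx s) * \int[mu]_(v in `]0, s]) (cos (xx v) * u v) +
  sin (xx s) * \int[mu]_(v in `]0, s]) (sin (xx v) * u v))).
  by move=> s; rewrite inE/= in_itv/= => /andP[_ st]; exact: esym (pathX_split st).
move=> s; apply: cvgD; apply: cvgM; [|exact: cA| |exact: cB].
- by apply: continuous_comp; [exact: cx|exact: continuous_cos].
- by apply: continuous_comp; [exact: cx|exact: continuous_sin].
Qed.

Lemma pathY_continuous : {within `[0, t], continuous pathY}.
Proof.
apply: (@subspace_eq_continuous _ _ _ (fun s =>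
  sin (xx s) * \int[mu]_(v in `]0, s]) (cos (xx v) * u v) -
  cos (xx s) * \int[mu]_(v in `]0, s]) (sin (xx v) * u v))).
  by move=> s; rewrite inE/= in_itv/= => /andP[_ st]; exact: esym (pathY_split st).
move=> s; apply: cvgB; apply: cvgM; [|exact: cA| |exact: cB].
- by apply: continuous_comp; [exact: cx|exact: continuous_sin].
- by apply: continuous_comp; [exact: cx|exact: continuous_cos].
Qed.

End path.

Section real_integrableD.
Context {R : realType} d (T : measurableType d) (mu : {measure set T -> \bar R}).
Variables (D : set T) (mD : measurable D) (f g : T -> R).
Hypothesis fi : mu.-integrable D (EFin \o f).
Hypothesis gi : mu.-integrable D (EFin \o g).

Lemma integrable_EFinD : mu.-integrable D (EFin \o (fun x => f x + g x)).
Proof. exact: (integrableD mD fi gi). Qed.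

Lemma integrable_EFinB : mu.-integrable D (EFin \o (fun x => f x - g x)).
Proof. exact: (integrableB mD fi gi). Qed.

End real_integrableD.

(** * The deterministic estimate on one path *)

Section path_estimate.
Context {R : realType}.
Local Notation mu := (@lebesgue_measure R).
(** The triangle inequality for the nine error sums of [path_estimate]. Stating it for abstract
    reals makes the sums and their bounds atoms for [lra]. *)
Let combine (y s1 s2 s3 s4 s5 s6 s7 s8 s9 I1 I2 q1 q2 q3 q4 q5 q6 q7 m r : R) :
  0 <= r -> 2 * q1 <= q2 -> q3 <= q4 -> `|s1| <= r * m -> `|s2| <= q1 -> `|s3| <= q1 ->
  `|s4| <= r -> `|s5 - I1| <= q6 -> `|s6 - I2| <= q7 -> `|s7| <= q3 -> `|s8| <= r ->
  `|s9| <= q5 ->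
  `|y + s2 - s1 - s3 - s4 - s6 + 2^-1 * (s7 + s8 + s9 + s5) - (y + 2^-1 * I1 - I2)| <=
    m * r + q6 + q7 + q2 + 2 * r + q5 + q4.
Proof.
move=> r0 h1 h2; rewrite !ler_norml => /andP[? ?] /andP[? ?] /andP[? ?] /andP[? ?]
  /andP[? ?] /andP[? ?] /andP[? ?] /andP[? ?] /andP[? ?].
apply/andP; split; lra.
Qed.

Variables (t M K : R) (xx u a sg S : R -> R).
Hypothesis t0 : 0 <= t.
Hypothesis cx : {within `[0, t], continuous xx}.
Hypothesis iu : mu.-integrable `]0, t] (EFin \o u).
Hypothesis uM : \int[mu]_(s in `]0, t]) `|u s| <= M.
Hypothesis K0 : 0 <= K.
Hypothesis ma : measurable_fun `]0, t] (a : measurableTypeR R -> R).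
Hypothesis msg : measurable_fun `]0, t] (sg : measurableTypeR R -> R).
Hypothesis mS : measurable_fun `]0, t] (S : measurableTypeR R -> R).
Hypothesis aK : forall s, 0 < s <= t -> `|a s| <= K.
Hypothesis sgK : forall s, 0 < s <= t -> `|sg s| <= K.
Hypothesis SL : exists L, forall s, 0 < s <= t -> `|S s| <= L.
Variables (N : nat) (tau c dW E : nat -> R).
Hypotheses (tau0 : tau 0%N = 0) (tauS : forall p, tau p <= tau p.+1) (tauN : tau N = t).
Hypothesis Sc : forall p s, (p < N)%N -> tau p < s <= tau p.+1 -> S s = c p.
Local Notation X := (pathX xx u).
Local Notation Y := (pathY xx u).
Local Notation h p := (tau p.+1 - tau p).
Local Notation D p := (xx (tau p.+1) - xx (tau p)).
Local Notation A p := (\int[mu]_(s in `]tau p, tau p.+1]) a s).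
Hypothesis DE : forall p, (p < N)%N -> D p = A p + E p + c p * dW p.
(** A single small parameter governs every error. Quantities that occur squared are bounded by
    rho^2, so that they can still be divided by [rho] in the weighted inequalities below. *)
Variable rho : R.
Hypotheses (rho0 : 0 < rho) (rho1 : rho <= 1).
Hypothesis modx : forall p s, (p < N)%N -> tau p <= s <= tau p.+1 ->
  `|xx (tau p.+1) - xx s| <= rho.
Hypothesis modX : forall p s, (p < N)%N -> tau p <= s <= tau p.+1 -> `|X (tau p) - X s| <= rho.
Hypothesis modY : forall p s, (p < N)%N -> tau p <= s <= tau p.+1 -> `|Y (tau p) - Y s| <= rho.
Hypothesis mesh : forall p, h p <= rho ^+ 2.
Hypothesis e1 : `|\sum_(p < N) X (tau p) * E p| <= rho.
Hypothesis e2 : \sum_(p < N) E p ^+ 2 <= rho ^+ 2.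
Hypothesis e3 : `|\sum_(p < N) Y (tau p) * (c p ^+ 2 * (dW p ^+ 2 - h p))| <= rho.
Hypothesis e3' : `|\sum_(p < N) c p ^+ 2 * (dW p ^+ 2 - h p)| <= 1.
Hypothesis e4 : \int[mu]_(s in `]0, t]) ((S s - sg s) ^+ 2) <= rho ^+ 2.

Let tau_homo : {homo tau : i j / (i <= j)%N >-> i <= j}.
Proof. exact/nondecreasing_seqP. Qed.

Let tau_ge0 p : 0 <= tau p.
Proof. by rewrite -tau0; exact: tau_homo. Qed.

Let tau_le p : (p <= N)%N -> tau p <= t.
Proof. by rewrite -tauN; exact: tau_homo. Qed.

Let in_t p s : (p < N)%N -> tau p < s <= tau p.+1 -> 0 < s <= t.
Proof.
move=> pN /andP[ps sp]; rewrite (le_lt_trans (tau_ge0 p) ps)/=.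
exact: le_trans sp (tau_le pN).
Qed.

Let M0 : 0 <= M.
Proof. by apply: le_trans uM; exact: Rintegral_ge0. Qed.

Let XM p : (p <= N)%N -> `|X (tau p)| <= M.
Proof. by move=> pN; apply: le_trans uM; apply: pathX_le => //; exact: tau_le. Qed.

Let YM p : (p <= N)%N -> `|Y (tau p)| <= M.
Proof. by move=> pN; apply: le_trans uM; apply: pathY_le => //; exact: tau_le. Qed.

Let ia : mu.-integrable `]0, t] (EFin \o a).
Proof. by apply: (integrable_itv_bounded ma); exact: aK. Qed.

Let mfun_within (f : R -> R) : {within `[0, t], continuous f} ->
  measurable_fun `]0, t] (f : measurableTypeR R -> R).
Proof.
move=> cf; apply: (@measurable_funS _ _ _ _ `[0, t]%classic) => //.
- by move=> s; rewrite /= !in_itv/= => /andP[/ltW -> ->].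
- exact: subspace_continuous_measurable_fun.
Qed.

Let mX : measurable_fun `]0, t] (X : measurableTypeR R -> R).
Proof. by apply: mfun_within; exact: pathX_continuous. Qed.

Let mY : measurable_fun `]0, t] (Y : measurableTypeR R -> R).
Proof. by apply: mfun_within; exact: pathY_continuous. Qed.

Let icst (k : R) : mu.-integrable `]0, t] (EFin \o (fun=> k)).
Proof. by apply: (integrable_itv_bounded (C := `|k|)) => //; exact: measurable_cst. Qed.

Let sqr_le (f k : R) : `|f| <= k -> f ^+ 2 <= k ^+ 2.
Proof.
move=> fk; rewrite -real_normK ?num_real// ler_sqr// nnegrE//.
exact: le_trans (normr_ge0 f) fk.
Qed.

Let isg2 : mu.-integrable `]0, t] (EFin \o (fun s => sg s ^+ 2)).
Proof.
apply: (integrable_itv_bounded (C := K ^+ 2)); first exact: measurable_funX.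
by move=> s /sgK /sqr_le; rewrite ger0_norm// sqr_ge0.
Qed.

Let iS2 : mu.-integrable `]0, t] (EFin \o (fun s => S s ^+ 2)).
Proof.
have [L hL] := SL; apply: (integrable_itv_bounded (C := L ^+ 2)); first exact: measurable_funX.
by move=> s /hL /sqr_le; rewrite ger0_norm// sqr_ge0.
Qed.

Let id2 : mu.-integrable `]0, t] (EFin \o (fun s => (S s - sg s) ^+ 2)).
Proof.
have [L hL] := SL; apply: (integrable_itv_bounded (C := (L + K) ^+ 2)).
  by apply: measurable_funX; exact: measurable_funB.
move=> s st; rewrite ger0_norm ?sqr_ge0//; apply: sqr_le.
by apply: le_trans (ler_normB _ _) _; apply: lerD; [exact: hL|exact: sgK].
Qed.

Let Dle p : (p < N)%N -> `|D p| <= rho.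
Proof. by move=> pN; apply: modx => //; rewrite lexx tauS. Qed.

Let sum_h : \sum_(p < N) h p = t.
Proof.
rewrite -(big_mkord xpredT (fun p => h p)) telescope_sumr// tauN tau0 subr0//.
Qed.

Let h0 p : 0 <= h p. Proof. by rewrite subr_ge0. Qed.

Let Rp p := \int[mu]_(s in `]tau p, tau p.+1]) (sin (xx (tau p.+1) - xx s) * u s).

(** On each cell the sine is at most the oscillation [rho] of the path, and the integral of |u| is
    at most [M]. *)
Let sum_R : `|\sum_(p < N) Rp p| <= rho * M.
Proof.
apply: le_trans (ler_norm_sum _ _ _) _.
have iru : mu.-integrable `]0, t] (EFin \o (fun s => rho * `|u s|)).
  by apply: integrable_EFinZl => //; exact: integrable_norm.
apply: (@le_trans _ _ (\int[mu]_(s in `]0, t]) (rho * `|u s|))); last first.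
  by rewrite RintegralZl//; [rewrite ler_pM2l|exact: integrable_norm].
rewrite -(sum_grid_integral tau0 tauS tauN iru); apply: ler_sum => p _.
have ip := integrable_grid tau0 tauS tauN (ltn_ord p)
  (integrable_sin_path cx iu (xx (tau p.+1))).
apply: le_trans (le_normr_Rintegral _ ip) _ => //.
apply: le_Rintegral => //; first exact: integrable_norm.
  exact: (integrable_grid tau0 tauS tauN (ltn_ord p) iru).
move=> s; rewrite /= in_itv/= => /andP[ps sp]; rewrite normrM ler_wpM2r//.
apply: le_trans (norm_sin_le _) _; apply: modx => //.
by rewrite (ltW ps).
Qed.

Let sum_A2 : \sum_(p < N) A p ^+ 2 <= K ^+ 2 * t * rho ^+ 2.
Proof.
apply: (@le_trans _ _ (\sum_(p < N) K ^+ 2 * rho ^+ 2 * h p)); last first.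
  by rewrite -mulr_sumr sum_h mulrAC.
apply: ler_sum => p _.
have : `|A p| <= K * h p.
  have ip := integrable_grid tau0 tauS tauN (ltn_ord p) ia.
  apply: le_trans (le_normr_Rintegral _ ip) _ => //.
  rewrite -(Rintegral_itv_cst K (tauS p)).
  apply: le_Rintegral => //; first exact: integrable_norm.
    exact: (integrable_grid tau0 tauS tauN (ltn_ord p) (icst K)).
  by move=> s; rewrite /= in_itv/= => /(in_t (ltn_ord p)); exact: aK.
move=> /sqr_le /le_trans; apply; rewrite exprMn -mulrA.
by apply: ler_wpM2l; rewrite ?sqr_ge0// expr2; apply: ler_wpM2r.
Qed.

(** The discrete quadratic variation [Q] is split into its Wiener part [q], which stays bounded by
    [qc], and the part [B] of drift and error, which is at most Bc rho^2. *)
Let Q := \sum_(p < N) D p ^+ 2.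
Let B := \sum_(p < N) (E p + A p) ^+ 2.
Let q := \sum_(p < N) (c p * dW p) ^+ 2.
Let Bc := 2 + 2 * K ^+ 2 * t.
Let qc := 3 + 2 * K ^+ 2 * t.

Let K2t : 0 <= K ^+ 2 * t. Proof. by rewrite mulr_ge0// sqr_ge0. Qed.

Let rho2 : rho ^+ 2 <= rho. Proof. by rewrite expr2 ler_piMl// ltW. Qed.

Let B_le : B <= Bc * rho ^+ 2.
Proof.
apply: (@le_trans _ _ (2 * \sum_(p < N) E p ^+ 2 + 2 * \sum_(p < N) A p ^+ 2)).
  rewrite !mulr_sumr -big_split/=; apply: ler_sum => p _.
  have := sqr_ge0 (E p - A p); nra.
rewrite /Bc; have := e2; have := sum_A2; nra.
Qed.

Let sum_c2h : \sum_(p < N) c p ^+ 2 * h p = \int[mu]_(s in `]0, t]) (S s ^+ 2).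
Proof.
rewrite -(sum_grid_integral tau0 tauS tauN iS2); apply: eq_bigr => p _.
rewrite -(Rintegral_itv_cst (c p ^+ 2) (tauS p)); apply: eq_Rintegral => s.
by rewrite inE/= in_itv/= => sp; rewrite (Sc (ltn_ord p) sp).
Qed.

(** In [qc], 1 bounds the compensated sum, and 2 + 2 K^2 t bounds the integral of S^2, compared with
    that of sg^2 through [e4]; the bound on [S] from [SL] does not enter. *)
Let q_le : q <= qc.
Proof.
have -> : q = \sum_(p < N) c p ^+ 2 * (dW p ^+ 2 - h p) + \sum_(p < N) c p ^+ 2 * h p.
  by rewrite -big_split/=; apply: eq_bigr => p _; ring.
have h1 : \int[mu]_(s in `]0, t]) (S s ^+ 2) <= 2 * rho ^+ 2 + 2 * K ^+ 2 * t.
  apply: (@le_trans _ _ (\int[mu]_(s in `]0, t]) (2 * (S s - sg s) ^+ 2 + 2 * K ^+ 2))).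
    apply: le_Rintegral => //.
      by apply: integrable_EFinD => //; exact: integrable_EFinZl.
    move=> s; rewrite /= in_itv/= => st; have := sqr_le (sgK st).
    have := sqr_ge0 (S s - sg s - sg s); nra.
  rewrite RintegralD//; last exact: integrable_EFinZl.
  by rewrite RintegralZl// Rintegral_itv_cst// subr0 lerD2r ler_pM2l.
rewrite sum_c2h /qc.
move: e3' => /ler_normlP[_ e3'']; have : rho ^+ 2 <= 1 by apply: le_trans rho2 _.
lra.
Qed.

Let Q_le : Q <= 2 * qc + 2 * Bc.
Proof.
apply: (@le_trans _ _ (2 * q + 2 * B)).
  rewrite !mulr_sumr -big_split/=; apply: ler_sum => p _.
  rewrite (DE (ltn_ord p)); have := sqr_ge0 (c p * dW p - (E p + A p)); nra.
have : Bc * rho ^+ 2 <= Bc.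
  have Bc0 : 0 <= Bc by rewrite addr_ge0// -mulrA mulr_ge0.
  by apply: ler_piMr => //; exact: le_trans rho2 rho1.
have := B_le; have := q_le; lra.
Qed.

(** The cubic remainder of the sine gives |D|^3 <= rho D^2 on each cell. The next bound treats the
    quartic remainder of the cosine in the same way. *)
Let sum_T3 : `|\sum_(p < N) X (tau p) * (D p - sin (D p))| <= M * (rho * Q).
Proof.
apply: le_trans (ler_norm_sum _ _ _) _; rewrite !mulr_sumr; apply: ler_sum => p _.
rewrite normrM; apply: ler_pM => //; first exact: XM (ltnW (ltn_ord p)).
rewrite distrC; apply: le_trans (norm_sin_subid _) _.
rewrite exprS -[D p ^+ 2]real_normK ?num_real//; apply: ler_wpM2r; first exact: sqr_ge0.
exact: Dle.
Qed.

Let sum_T4 : `|\sum_(p < N) Y (tau p) * (cos (D p) - 1 + D p ^+ 2 / 2)| <= M * (rho * Q).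
Proof.
apply: le_trans (ler_norm_sum _ _ _) _; rewrite !mulr_sumr; apply: ler_sum => p _.
rewrite normrM; apply: ler_pM => //; first exact: YM (ltnW (ltn_ord p)).
apply: le_trans (norm_cos_taylor2 _) _.
rewrite (exprM _ 2 2) [_ ^+ 2 ^+ 2]expr2; apply: ler_wpM2r; first exact: sqr_ge0.
by apply: le_trans rho2; exact: sqr_le (Dle (ltn_ord p)).
Qed.

Let sum_T6 : `|\sum_(p < N) Y (tau p) * (D p ^+ 2 - (c p * dW p) ^+ 2)| <=
  M * (B * (1 + rho^-1) + rho * q).
Proof.
apply: le_trans (ler_norm_sum _ _ _) _.
rewrite mulr_suml mulr_sumr -big_split/= mulr_sumr; apply: ler_sum => p _.
rewrite normrM; apply: ler_pM => //; first exact: YM (ltnW (ltn_ord p)).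
rewrite (DE (ltn_ord p)); set x := E p + A p; set y := c p * dW p.
have -> : (A p + E p + y) ^+ 2 - y ^+ 2 = x ^+ 2 + 2 * (x * y) by rewrite /x; ring.
have ri0 : 0 < rho^-1 by rewrite invr_gt0.
(* The mixed term is weighted by [rho]: the x^2 sum to order rho^2, so dividing them by [rho] costs
   nothing essential, and the bounded sum of the y^2 receives a factor [rho]. *)
have hxy : `|2 * (x * y)| <= x ^+ 2 * rho^-1 + rho * y ^+ 2.
  have e : x ^+ 2 * rho^-1 + rho * y ^+ 2 = rho^-1 * (x ^+ 2 + (rho * y) ^+ 2).
    by field; rewrite lt0r_neq0.
  rewrite e ler_pdivlMl//.
  rewrite -{1}(gtr0_norm rho0) -normrM ler_norml; apply/andP; split.
    have := sqr_ge0 (x + rho * y); nra.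
  have := sqr_ge0 (x - rho * y); nra.
apply: le_trans (ler_normD _ _) _; rewrite ger0_norm ?sqr_ge0//; lra.
Qed.

Let sum_T5 : `|\sum_(p < N) Y (tau p) *
   (c p ^+ 2 * h p - \int[mu]_(s in `]tau p, tau p.+1]) (sg s ^+ 2))| <=
  M * (rho * (1 + K + K * t)).
Proof.
have iD : mu.-integrable `]0, t] (EFin \o (fun s => S s ^+ 2 - sg s ^+ 2)).
  exact: integrable_EFinB.
have -> : \sum_(p < N) Y (tau p) *
   (c p ^+ 2 * h p - \int[mu]_(s in `]tau p, tau p.+1]) (sg s ^+ 2)) =
  \sum_(p < N) Y (tau p) * \int[mu]_(s in `]tau p, tau p.+1]) (S s ^+ 2 - sg s ^+ 2).
  apply: eq_bigr => p _; congr (_ * _).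
  rewrite RintegralB//; [|exact: (integrable_grid tau0 tauS tauN (ltn_ord p) iS2)
    |exact: (integrable_grid tau0 tauS tauN (ltn_ord p) isg2)].
  congr (_ - _); rewrite -(Rintegral_itv_cst (c p ^+ 2) (tauS p)); apply: eq_Rintegral => s.
  by rewrite inE/= in_itv/= => sp; rewrite (Sc (ltn_ord p) sp).
(* With d = S - sg, one has S^2 - sg^2 = d^2 + 2 d sg, and 2 K |d| <= K d^2 / rho + K rho; the
   integral of d^2 is at most rho^2, so the result is of order [rho]. *)
pose g s := M * ((1 + K / rho) * (S s - sg s) ^+ 2 + K * rho).
have ig1 : mu.-integrable `]0, t] (EFin \o (fun s => (1 + K / rho) * (S s - sg s) ^+ 2)).
  exact: integrable_EFinZl.
have ig2 : mu.-integrable `]0, t] (EFin \o (fun s => (1 + K / rho) * (S s - sg s) ^+ 2 + K * rho)).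
  exact: integrable_EFinD.
have ig : mu.-integrable `]0, t] (EFin \o g) by exact: integrable_EFinZl.
apply: (le_trans (@sum_grid_le _ _ _ _ tau0 tauS tauN _ _ iD ig (fun p => Y (tau p)) _)).
  move=> p s pN sp; rewrite normrM; apply: ler_pM => //; first exact: YM (ltnW pN).
  have := sgK (in_t pN sp); set d := S s - sg s => sK.
  have -> : S s ^+ 2 - sg s ^+ 2 = d ^+ 2 + 2 * (d * sg s) by rewrite /d; ring.
  apply: le_trans (ler_normD _ _) _; rewrite ger0_norm ?sqr_ge0// (mulrDl 1 (K / rho)) mul1r -addrA lerD2l.
  rewrite normrM normrM (ger0_norm (ler0n _ 2)).
  apply: (@le_trans _ _ (2 * (`|d| * K))).
    by apply: ler_wpM2l => //; apply: ler_wpM2l.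
  have -> : K / rho * d ^+ 2 + K * rho = K * (rho^-1 * (`|d| ^+ 2 + rho ^+ 2)).
    by rewrite real_normK ?num_real//; field; rewrite lt0r_neq0.
  rewrite mulrA mulrC; apply: ler_wpM2l => //.
  rewrite ler_pdivlMl//.
  by have := sqr_ge0 (`|d| - rho); nra.
rewrite /g RintegralZl// RintegralD// ?icst// RintegralZl// Rintegral_itv_cst// subr0.
apply: ler_wpM2l => //.
have : (1 + K / rho) * \int[mu]_(s in `]0, t]) ((S s - sg s) ^+ 2) <= (1 + K / rho) * rho ^+ 2.
  by apply: ler_wpM2l => //; rewrite addr_ge0// divr_ge0// ltW.
have -> : (1 + K / rho) * rho ^+ 2 = rho ^+ 2 + K * rho by field; rewrite lt0r_neq0.
move: rho2; set I := \int[mu]_(_ in _) _; lra.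
Qed.

Let iYsg : mu.-integrable `]0, t] (EFin \o (fun s => sg s ^+ 2 * Y s)).
Proof.
apply: (integrable_itv_bounded (C := K ^+ 2 * M)).
  by apply: measurable_funM => //; exact: measurable_funX.
move=> s st; rewrite normrM; apply: ler_pM => //.
  by rewrite ger0_norm ?sqr_ge0//; exact: sqr_le (sgK st).
by apply: le_trans uM; apply: pathY_le => //; case/andP: st.
Qed.

Let iXa : mu.-integrable `]0, t] (EFin \o (fun s => X s * a s)).
Proof.
apply: (integrable_itv_bounded (C := M * K)); first exact: measurable_funM.
move=> s st; rewrite normrM; apply: ler_pM => //; last exact: aK.
by apply: le_trans uM; apply: pathX_le => //; case/andP: st.
Qed.

(** A Riemann sum with the weight [g] frozen at left endpoints, against the integral with the moving
    weight. *)
Let sum_frozen (f g : R -> R) (L : R) : 0 <= L ->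
  mu.-integrable `]0, t] (EFin \o f) ->
  mu.-integrable `]0, t] (EFin \o (fun s => f s * g s)) ->
  (forall s, 0 < s <= t -> `|f s| <= L) ->
  (forall p s, (p < N)%N -> tau p <= s <= tau p.+1 -> `|g (tau p) - g s| <= rho) ->
  `|\sum_(p < N) g (tau p) * \int[mu]_(s in `]tau p, tau p.+1]) f s -
    \int[mu]_(s in `]0, t]) (f s * g s)| <= rho * (L * t).
Proof.
move=> L0 fi fgi fL gm.
rewrite -(sum_grid_integral tau0 tauS tauN fgi) -sumrB.
apply: le_trans (ler_norm_sum _ _ _) _.
rewrite -sum_h !mulr_sumr; apply: ler_sum => p _.
have fip := integrable_grid tau0 tauS tauN (ltn_ord p) fi.
have fgip := integrable_grid tau0 tauS tauN (ltn_ord p) fgi.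
have gfip : mu.-integrable `]tau p, tau p.+1] (EFin \o (fun s => g (tau p) * f s)).
  exact: integrable_EFinZl.
rewrite -RintegralZl// -RintegralB//.
have bi : mu.-integrable `]tau p, tau p.+1] (EFin \o (fun s => g (tau p) * f s - f s * g s)).
  exact: integrable_EFinB.
apply: le_trans (le_normr_Rintegral _ bi) _ => //.
rewrite mulrA -(Rintegral_itv_cst (rho * L) (tauS p)).
apply: le_Rintegral => //; first exact: integrable_norm.
  exact: (integrable_grid tau0 tauS tauN (ltn_ord p) (icst (rho * L))).
move=> s; rewrite /= in_itv/= => sp; rewrite mulrC -mulrBr normrM mulrC.
apply: ler_pM => //; last exact: fL (in_t (ltn_ord p) sp).
by apply: gm => //; case/andP: sp => /ltW -> ->.
Qed.

Let sum_T1 : `|\sum_(p < N) Y (tau p) * \int[mu]_(s in `]tau p, tau p.+1]) (sg s ^+ 2) -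
    \int[mu]_(s in `]0, t]) (sg s ^+ 2 * Y s)| <= rho * (K ^+ 2 * t).
Proof.
apply: (@sum_frozen (fun s => sg s ^+ 2) Y) => //; first exact: sqr_ge0.
by move=> s /sgK /sqr_le; rewrite ger0_norm// sqr_ge0.
Qed.

Let sum_T2 : `|\sum_(p < N) X (tau p) * A p - \int[mu]_(s in `]0, t]) (a s * X s)|
  <= rho * (K * t).
Proof.
apply: (@sum_frozen a X) => //.
by move: iXa; rewrite (_ : (fun s => X s * a s) = fun s => a s * X s)//;
  apply/funext => s; rewrite mulrC.
Qed.

(** It depends only on [t], [M] and [K]. Neither the grid nor the bound on the simple process
    enters, so the estimate is uniform along the sequence of samplings. *)
Definition path_estimate_cst :=
  M + K ^+ 2 * t + K * t + 2 * (M * (2 * qc + 2 * Bc)) + 2 +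
  M * (1 + K + K * t) + M * (2 * Bc + qc).

Lemma path_estimate :
  `|\sum_(p < N) X (tau p) * (c p * dW p) -
    (Y t + 2^-1 * \int[mu]_(s in `]0, t]) (sg s ^+ 2 * Y s) -
       \int[mu]_(s in `]0, t]) (X s * a s))| <= path_estimate_cst * rho.
Proof.
have Y0 : Y 0 = 0 by rewrite /pathY set_itvoc0 Rintegral_set0.
have tel : \sum_(p < N) (Y (tau p.+1) - Y (tau p)) = Y t.
  rewrite -(big_mkord xpredT (fun p => Y (tau p.+1) - Y (tau p))).
  by rewrite (telescope_sumr (fun p => Y (tau p)))// tauN tau0 Y0 subr0.
rewrite (@eq_Rintegral _ _ _ mu _ (fun s => a s * X s) (fun s => X s * a s)); last by move=> s _; rewrite mulrC.
have hS1 := sum_T1; have hS2 := sum_T2.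
set I1 := \int[mu]_(s in `]0, t]) (sg s ^+ 2 * Y s) in hS1 *.
set I2 := \int[mu]_(s in `]0, t]) (a s * X s) in hS2 *.
(* An exact identity, checked cell by cell: the recursion for [Y] is solved for [X D], and each
   replacement made on the way leaves its remainder as a separate sum. *)
have main : \sum_(p < N) X (tau p) * (c p * dW p) =
  \sum_(p < N) (Y (tau p.+1) - Y (tau p))
  + \sum_(p < N) X (tau p) * (D p - sin (D p))
  - \sum_(p < N) Rp p
  - \sum_(p < N) Y (tau p) * (cos (D p) - 1 + D p ^+ 2 / 2)
  - \sum_(p < N) X (tau p) * E p
  - \sum_(p < N) X (tau p) * A p
  + 2^-1 * (\sum_(p < N) Y (tau p) * (D p ^+ 2 - (c p * dW p) ^+ 2)
    + \sum_(p < N) Y (tau p) * (c p ^+ 2 * (dW p ^+ 2 - h p))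
    + \sum_(p < N) Y (tau p) *
        (c p ^+ 2 * h p - \int[mu]_(s in `]tau p, tau p.+1]) (sg s ^+ 2))
    + \sum_(p < N) Y (tau p) * \int[mu]_(s in `]tau p, tau p.+1]) (sg s ^+ 2)).
  rewrite -!big_split/= mulr_sumr -!sumrN -!big_split/=; apply: eq_bigr => p _.
  have pN := ltn_ord p.
  have step := pathY_step cx iu (tau_ge0 p) (tauS p) (tau_le pN).
  rewrite -/(Rp p) in step.
  have hc : c p * dW p = D p - A p - E p by rewrite (DE pN); ring.
  by rewrite step [in LHS]hc; field.
rewrite main tel.
have hQ : M * (rho * Q) <= M * (2 * qc + 2 * Bc) * rho.
  by rewrite -mulrA; apply: ler_wpM2l => //; rewrite mulrC; apply: ler_wpM2r => //; exact: ltW.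
have Bc0 : 0 <= Bc by rewrite addr_ge0// -mulrA mulr_ge0.
have hT6 : M * (B * (1 + rho^-1) + rho * q) <= M * (2 * Bc + qc) * rho.
  rewrite -mulrA; apply: ler_wpM2l => //; rewrite mulrDl; apply: lerD; last first.
    by rewrite mulrC; apply: ler_wpM2r => //; exact: ltW.
  apply: (@le_trans _ _ (Bc * rho ^+ 2 * (1 + rho^-1))).
    by apply: ler_wpM2r => //; rewrite addr_ge0// invr_ge0 ltW.
  have -> : Bc * rho ^+ 2 * (1 + rho^-1) = Bc * (rho ^+ 2 + rho).
    by field; rewrite lt0r_neq0.
  rewrite (mulrC 2) -mulrA; apply: ler_wpM2l => //.
  by rewrite mulr_natl mulr2n lerD2r.
have hT5 : M * (rho * (1 + K + K * t)) = M * (1 + K + K * t) * rho by ring.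
have hT1 : rho * (K ^+ 2 * t) = K ^+ 2 * t * rho by ring.
have hT2 : rho * (K * t) = K * t * rho by ring.
have := sum_T5; rewrite hT5 => hS5; move: hS1 hS2; rewrite hT1 hT2 => hS1 hS2.
have -> : path_estimate_cst * rho = M * rho + K ^+ 2 * t * rho + K * t * rho +
    2 * (M * (2 * qc + 2 * Bc)) * rho + 2 * rho + M * (1 + K + K * t) * rho +
    M * (2 * Bc + qc) * rho.
  by rewrite /path_estimate_cst; move: qc Bc => ? ?; ring.
have {}hQ : 2 * (M * (rho * Q)) <= 2 * (M * (2 * qc + 2 * Bc)) * rho.
  by rewrite -[leRHS]mulrA; apply: ler_wpM2l.
exact: (combine _ (ltW rho0) hQ hT6 sum_R sum_T3 sum_T4 e1 hS1 hS2 sum_T6 e3 hS5).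
Qed.

End path_estimate.

(** * Measurability of the convolution integrals *)

Lemma grid_cover {R : realDomainType} N (tau : nat -> R) (s : R) :
  tau 0%N < s <= tau N -> exists2 p, (p < N)%N & tau p < s <= tau p.+1.
Proof.
move=> /andP[s0 sN]; elim: N sN => [/(lt_le_trans s0)|N ih sN]; first by rewrite ltxx.
have [/ih[p pN sp]|Ns] := leP s (tau N); first by exists p => //; exact: ltnW.
by exists N => //; rewrite Ns.
Qed.

Lemma grid_sum_eq {R : realType} N (tau a : nat -> R) (s : R) p :
  (forall i, tau i <= tau i.+1) -> (p < N)%N -> tau p < s <= tau p.+1 ->
  \sum_(i < N) a i * \1_(`]tau i, tau i.+1]%classic) s = a p.
Proof.
move=> tauS pN sp; have tau_homo : {homo tau : i j / (i <= j)%N >-> i <= j}.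
  exact/nondecreasing_seqP.
have [[q qN [sq ->]]|[/(_ p pN)]] := @grid_sum R N tau a s tauS; last by rewrite sp.
congr a; move: sp sq => /andP[p1 p2] /andP[q1 q2].
case: (ltngtP p q) => // [/tau_homo pq|/tau_homo qp].
- by have := lt_le_trans q1 (le_trans p2 pq); rewrite ltxx.
- by have := lt_le_trans p1 (le_trans q2 qp); rewrite ltxx.
Qed.

Section jmeas_continuous.
Context {R : realType} {d : measure_display} {T : measurableType d}.
Variables (t : R) (f : R -> T -> R).
Hypothesis cf : forall x, {within `[0, t], continuous (f ^~ x)}.
Hypothesis mf : forall s, 0 <= s <= t -> measurable_fun setT (f s).

(** The process is the pointwise limit of its left-endpoint samplings on uniform grids, each of
    which is a finite sum of measurable products. *)
Lemma continuous_jmeas : jmeas t f.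
Proof.
have [t0|t0] := leP t 0.
  by rewrite /jmeas set_itv_ge ?set0X ?bnd_simp -?leNgt//; exact: measurable_fun_set0.
pose tau n (i : nat) := t * i%:R / n.+1%:R.
have n0 n : 0 < n.+1%:R :> R by rewrite ltr0n.
have tauS n i : tau n i <= tau n i.+1.
  by rewrite ler_pM2r ?invr_gt0// ler_pM2l// ler_nat.
have tauN n : tau n n.+1 = t by rewrite /tau mulfK// pnatr_eq0.
have tau_homo n : {homo tau n : i j / (i <= j)%N >-> i <= j}.
  exact/nondecreasing_seqP.
have tau0 n : tau n 0%N = 0 by rewrite /tau mulr0 mul0r.
have tau_in n i : (i <= n.+1)%N -> 0 <= tau n i <= t.
  by move=> ni; rewrite -(tau0 n) tau_homo//= -[leRHS](tauN n) tau_homo.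
pose g n s x := \sum_(i < n.+1) f (tau n i) x * \1_(`]tau n i, tau n i.+1]%classic) s.
apply: (@measurable_fun_cvg _ _ _ _ (fun n (p : measurableTypeR R * T) => g n p.1 p.2)).
  move=> n; apply: measurable_sum => i; apply: jmeas_rv_indic; apply: mf.
  exact: tau_in (ltnW (ltn_ord i)).
move=> [s x] [/= + _]; rewrite in_itv/= => st.
have s0t : `[0, t]%classic s by rewrite /= in_itv/=; case/andP: st => /ltW -> ->.
apply/cvgrPdist_lt => e e0.
have [delta d0 hd] := within_continuous_eps (@cf x) s0t e0.
have := cvgr_lt 0 (@cvg_harmonic R) (delta / t) (divr_gt0 d0 t0).
move=> /(_ _)/filterS; apply=> n hn.
have [|p pn sp] := @grid_cover _ n.+1 (tau n) s; first by rewrite tau0 tauN.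
rewrite /g (grid_sum_eq (fun i => f (tau n i) x) (tauS n) pn sp).
have /andP[q1 q2] := sp.
apply: hd; first by rewrite /= in_itv/= tau_in// ltnW.
rewrite gtr0_norm ?subr_gt0//; apply: (@le_lt_trans _ _ (tau n p.+1 - tau n p)).
  by rewrite lerD2r.
have -> : tau n p.+1 - tau n p = t * n.+1%:R^-1.
  by rewrite /tau -mulrBl -mulrBr -natr1 [_ + 1 - _]addrC addKr mulr1.
by rewrite mulrC -ltr_pdivlMr.
Qed.

End jmeas_continuous.

Section jmeas_volterra.
Context {R : realType} {d : measure_display} {T : measurableType d}.
Local Notation mu := (@lebesgue_measure R).
Variables (t : R) (x u : R -> T -> R) (phi : R -> R).
Hypotheses (mx : jmeas t x) (mu_ : jmeas t u).
Hypothesis mphi : measurable_fun setT (phi : measurableTypeR R -> R).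

Lemma jmeas_volterra :
  jmeas t (fun s z => \int[mu]_(v in `]0, s]) (phi (x s z - x v z) * u v z)).
Proof.
pose D : set (measurableTypeR R * T) := `]0, t]%classic `*` [set: T].
have mD : measurable D by apply: measurableX => //; exact: measurable_itv.
pose x' : measurableTypeR R * T -> R := (fun p => x p.1 p.2) \_ D.
pose u' : measurableTypeR R * T -> R := (fun p => u p.1 p.2) \_ D.
have mx' : measurable_fun setT x' by apply/(measurable_restrictT _ mD).
have mu' : measurable_fun setT u' by apply/(measurable_restrictT _ mD).
(* The moving upper limit becomes the condition [v <= s]. The pair of time and outcome then serves
   as the outcome in [jmeas_Rintegral], over the fixed interval []0, t]]. *)
pose h (v : R) (p : measurableTypeR R * T) :=
  if v <= p.1 then phi (x' p - x' (v, p.2)) * u' (v, p.2) else 0.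
have mh : jmeas t h.
  apply: measurable_funTS.
  have m2 : measurable_fun setT (fun q : measurableTypeR R * (measurableTypeR R * T) => (q.1, q.2.2)).
    apply/measurable_fun_pairP; split; first exact: measurable_fst.
    exact: measurableT_comp measurable_snd measurable_snd.
  have m1 : measurable_fun setT (fun q : measurableTypeR R * (measurableTypeR R * T) => q.2.1).
    exact: measurableT_comp measurable_fst measurable_snd.
  apply: measurable_fun_ifT.
  - apply: measurable_fun_ler; first exact: measurable_fst.
    exact: m1.
  - apply: measurable_funM; last exact: (measurableT_comp mu' m2).
    apply: measurableT_comp; first exact: mphi.
    apply: measurable_funB; last exact: (measurableT_comp mx' m2).
    exact: measurableT_comp mx' measurable_snd.
  - exact: measurable_cst.
have := jmeas_Rintegral mh.
move=> /(measurable_funTS (D := D)); apply: eq_measurable_fun => -[s z].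
rewrite inE => -[/= + _]; rewrite in_itv/= => st.
rewrite /Rintegral; congr fine.
have -> : `]0, s]%classic = `]0, t]%classic `&` [set v : R | v <= s].
  apply/seteqP; split=> v /=; rewrite !in_itv/=.
    by move=> /andP[-> vs]; split=> //; case/andP: st => _; exact: le_trans.
  by move=> [/andP[-> _] ->].
rewrite integral_mkcondr; apply: eq_integral => v; rewrite inE/= in_itv/= => vt.
rewrite patchE /h/= mem_setE/= /x' /u' !patchE; case: ifPn => vs; last first.
  by rewrite ifN// notin_setE/=; exact/negP.
rewrite ifT; last by rewrite inE.
by rewrite !ifT// ?inE /D/= in_itv.
Qed.

End jmeas_volterra.

Section progressive.
Context {R : realType} {d : measure_display} {T : measurableType d}.
Variables (P : probability T R) (F : R -> set (set T)).
Hypothesis F_usual : usual_filtration P F.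
Implicit Types H : R -> T -> R.
Local Notation mu := (@lebesgue_measure R).

(** [jmeas] ignores time 0, so that slice is treated apart, and there [H] vanishes. *)
Lemma jmeas_progressive H : (forall z, H 0 z = 0) ->
  (forall t, 0 <= t -> @jmeas R _ (g_sigma_algebraType (F t)) t H) ->
  progressive F `[0, +oo[ H.
Proof.
move=> H0 mH t t0.
have -> : ((`[0, +oo[ `&` `[0, t]) `*` setT : set (measurableTypeR R * g_sigma_algebraType (F t))) =
    [set 0] `*` setT `|` `]0, t]%classic `*` setT.
  apply/seteqP; split=> -[s z]/=; rewrite !in_itv/= andbT.
    move=> [[s0 /andP[_ st]] _]; have [->|s0'] := eqVneq s 0; first by left.
    by right; split=> //; rewrite st lt_neqAle s0 eq_sym s0'.
  by move=> [[-> _]|[/andP[/ltW s0 st] _]]; rewrite ?lexx ?t0// s0 st.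
apply/measurable_funU.
- by apply: measurableX => //; exact: measurable_set1.
- by apply: measurableX => //; exact: measurable_itv.
split; last exact: mH.
apply: (@eq_measurable_fun _ _ (measurableTypeR R * g_sigma_algebraType (F t))%type R _ (cst 0)); last exact: measurable_cst.
by move=> [s z]; rewrite inE => -[/= -> _]; rewrite H0.
Qed.

Lemma progressive_adapted H : progressive F `[0, +oo[ H -> adapted F H.
Proof.
move=> pH t t0.
have m : measurable ((`[0, +oo[ `&` `[0, t]) `*` setT : set (measurableTypeR R * g_sigma_algebraType (F t))).
  by apply: measurableX => //; apply: measurableI; exact: measurable_itv.
apply: (measurable_comp m _ (pH t t0) (pair1_measurable t)).
by move=> _ [z _ <-]; split => //=; rewrite !in_itv/= t0 lexx.
Qed.

Lemma progressiveM H H' (D : set R) : progressive F D H -> progressive F D H' ->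
  progressive F D (fun s z => H s z * H' s z).
Proof. by move=> pH pH' t t0; exact: measurable_funM (pH t t0) (pH' t t0). Qed.

Lemma progressive_comp H (D : set R) (phi : R -> R) :
  measurable_fun setT (phi : measurableTypeR R -> R) ->
  progressive F D H -> progressive F D (fun s z => phi (H s z)).
Proof. by move=> mphi pH t t0; exact: measurableT_comp mphi (pH t t0). Qed.

Variables x u : R -> T -> R.
Hypotheses (x_adapted : adapted F x) (x_continuous : continuous_paths x).
Hypothesis u_prog : progressive F `]0, +oo[ u.

Lemma continuous_within_itv t z : {within `[0, t], continuous (x ^~ z)}.
Proof.
apply: continuous_subspaceW; last exact: x_continuous.
by move=> s; rewrite /= !in_itv/= andbT => /andP[].
Qed.

Lemma volterra_progressive (phi : R -> R) :
  measurable_fun setT (phi : measurableTypeR R -> R) ->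
  progressive F `[0, +oo[
    (fun s z => \int[mu]_(v in `]0, s]) (phi (x s z - x v z) * u v z)).
Proof.
move=> mphi; apply: jmeas_progressive.
  by move=> z; rewrite set_itvoc0 Rintegral_set0.
move=> t t0; apply: jmeas_volterra => //.
- apply: continuous_jmeas; first by move=> z; exact: continuous_within_itv.
  by move=> s /andP[s0 st]; exact: (measurable_at_le F_usual s0 st (x_adapted s0)).
- by apply: (progressive_jmeas _ _ t0 u_prog).
Qed.

End progressive.

(** * Convergence along a sequence of partitions *)

Lemma ge0_cvge0 {R : realType} (a : nat -> \bar R) : (forall n, 0 <= a n)%E ->
  (forall e : R, 0 < e -> \forall n \near \oo, (a n <= e%:E)%E) ->
  a n @[n --> \oo] --> 0%E.
Proof.
move=> a0 ae; apply/fine_cvgP; split.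
  apply: filterS (ae 1 ltr01) => n an; rewrite ge0_fin_numE//.
  by apply: le_lt_trans an _; exact: ltry.
apply/cvgrPdist_le => e e0; apply: filterS (ae e e0) => n an.
rewrite sub0r normrN ger0_norm ?fine_ge0//.
by rewrite -lee_fin fineK// ge0_fin_numE// (le_lt_trans an)// ltry.
Qed.

Section ae_limits.
Context {R : realType} {d : measure_display} {T : measurableType d}.
Variable P : probability T R.

(** The series of the [V n] has finite expectation, hence is finite almost everywhere, and its terms
    tend to 0. *)
Lemma ae_cvg0_of_summable (V : nat -> T -> \bar R) :
  (forall n, measurable_fun setT (V n)) -> (forall n x, 0 <= V n x)%E ->
  (forall n, \int[P]_x V n x <= (1 / (2 ^ n.+1)%:R)%:E)%E ->
  {ae P, forall x, V n x @[n --> \oo] --> 0%E}.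
Proof.
move=> mV V0 Vle.
have iV : P.-integrable setT (fun x => \sum_(n <oo) V n x)%E.
  apply/integrableP; split; first by apply: ge0_emeasurable_sum => // n x _ _; exact: V0.
  under eq_integral => x _ do rewrite gee0_abs ?nneseries_ge0//.
  rewrite integral_nneseries//; apply: (@le_lt_trans _ _ 1%E); last exact: ltry.
  apply: (@le_trans _ _ (\sum_(0 <= n <oo) (1 / (2 ^ n.+1)%:R)%:E)%E).
    by apply: lee_nneseries => // n _ _; apply: integral_ge0.
  exact: epsilon_trick0.
have := integrable_ae measurableT iV.
apply: filterS => x /(_ Logic.I) fx.
have sx : (\sum_(0 <= n <oo) V n x < +oo)%E by rewrite ltey_eq fx.
have tl := nneseries_tail_cvg sx (fun n _ => V0 n x).
apply: (@squeeze_cvge _ _ _ _ (fun=> 0%E) _ (fun n => \sum_(n <= k <oo) V k x)%E) => //.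
  apply: nearW => n; rewrite V0/=.
  have := @nneseries_lim_ge _ (V ^~ x) xpredT n n.+1 (fun n _ _ => V0 n x).
  by rewrite big_nat1.
exact: cvg_cst.
Qed.

Lemma bounded_integral_cvg0 (G : nat -> T -> \bar R) (C : R) :
  (forall n, measurable_fun setT (G n)) -> (forall n x, 0 <= G n x <= C%:E)%E ->
  {ae P, forall x, G n x @[n --> \oo] --> 0%E} ->
  (\int[P]_x G n x)%E @[n --> \oo] --> 0%E.
Proof.
move=> mG GC G0.
have iC : P.-integrable setT (cst C%:E) by exact: finite_measure_integrable_cst.
have G0' : {ae P, forall x, [set: T] x -> G ^~ x @ \oo --> cst 0%E x}.
  by apply: filterS G0.
have GC' : {ae P, forall x n, [set: T] x -> (`|G n x| <= cst C%:E x)%E}.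
  by apply: nearW => x n _; have /andP[g0 gC] := GC n x; rewrite gee0_abs.
have [_ _] := dominated_convergence measurableT mG (measurable_cst _) G0' iC GC'.
by rewrite integral_cst// mul0e.
Qed.

(** Fatou's lemma in the second index carries the Cauchy bound for [J n - J m] over to [J n - J'];
    thus the almost sure limit is also the limit in L^2(P). *)
Lemma ae_cvg_L2 (J : nat -> T -> R) (J' : T -> R) :
  (forall n, measurable_fun setT (J n)) -> measurable_fun setT J' ->
  {ae P, forall x, J n x @[n --> \oo] --> J' x} ->
  (forall e : R, 0 < e -> exists N, forall n m, (N <= n)%N -> (N <= m)%N ->
     (\int[P]_x ((J n x - J m x) ^+ 2)%:E <= e%:E)%E) ->
  (\int[P]_x ((J n x - J' x) ^+ 2)%:E)%E @[n --> \oo] --> 0%E.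
Proof.
move=> mJ mJ' JJ' cJ.
have m2 n m : measurable_fun setT (fun x => ((J n x - J m x) ^+ 2)%:E).
  by apply/measurable_EFinP; apply: measurable_funX; exact: measurable_funB.
have h e : 0 < e -> exists N, forall n, (N <= n)%N ->
    (\int[P]_x ((J n x - J' x) ^+ 2)%:E <= e%:E)%E.
  move=> e0; have [N hN] := cJ e e0; exists N => n Nn.
  have -> : (\int[P]_x ((J n x - J' x) ^+ 2)%:E =
      \int[P]_x limn_einf (fun m => ((J n x - J m x) ^+ 2)%:E))%E.
    apply: ae_eq_integral => //.
    - by apply/measurable_EFinP; apply: measurable_funX; exact: measurable_funB.
    - rewrite /limn_einf; apply: measurableT_comp => //.
      by apply: measurable_fun_limn_esup => m; exact: measurableT_comp.
    - apply: filterS JJ' => x JJ' _; apply/esym; apply: (cvg_limn_einf_sup _).1.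
      apply: cvg_EFin; first exact: nearW.
      under eq_fun do rewrite expr2.
      rewrite expr2; have c : J n x - J m x @[m --> \oo] --> J n x - J' x.
        by apply: cvgB => //; exact: cvg_cst.
      exact: cvgM.
  apply: le_trans (fatou P measurableT (m2 n) _) _.
    by move=> m x _; rewrite lee_fin sqr_ge0.
  rewrite limn_einf_lim; apply: lime_le; first exact: is_cvg_einfs.
  near=> k; apply: (@le_trans _ _ (\int[P]_x ((J n x - J k x) ^+ 2)%:E)%E).
    by apply: ereal_inf_lbound; exists k => /=.
  by apply: hN => //; near: k; exact: nbhs_infty_ge.
apply: ge0_cvge0 => [n|e e0].
  by apply: integral_ge0 => x _; rewrite lee_fin sqr_ge0.
by have [N hN] := h e e0; exists N.
Unshelve. all: by end_near. Qed.

End ae_limits.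

(** * Samplings of [sigma] with small total error *)

Section sampling.
Context {R : realType} {d : measure_display} {T : measurableType d}.
Variables (P : probability T R) (F : R -> set (set T)) (w sigma I : R -> T -> R).
Hypotheses (F_usual : usual_filtration P F) (w_wiener : wiener P F w).
Variable t : R.
Hypothesis t0 : 0 <= t.
Hypothesis iI : forall r, 0 <= r -> is_ito_integral P F w sigma r (I r).
Local Notation mu := (@lebesgue_measure R).

(** The output of [simple_grid] in bundled form, so that a sequence of samplings can be chosen. The
    bound on the coefficients is existential since it varies from one sampling to the next. *)
Record sampling (eta : R) := Sampling {
  smp : simple_process F ;
  smp_size : nat ;
  smp_time : nat -> R ;
  smp_coef : nat -> T -> R ;
  smp_time0 : smp_time 0%N = 0 ;
  smp_timeS : forall p, smp_time p <= smp_time p.+1 ;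
  smp_timeN : smp_time smp_size = t ;
  smp_mesh : forall p, smp_time p.+1 - smp_time p <= eta ;
  smp_coef_meas : forall p, measurable_at F (smp_time p) (smp_coef p) ;
  smp_coef_bounded : exists L : R, forall p z, `|smp_coef p z| <= L ;
  smp_value : forall p s z, (p < smp_size)%N ->
    smp_time p < s <= smp_time p.+1 -> simple_value smp s z = smp_coef p z }.

Variables (X Y : R -> T -> R) (M : R).
Hypotheses (X_adapted : adapted F X) (Y_adapted : adapted F Y).
Hypotheses (XM : forall s z, `|X s z| <= M) (YM : forall s z, `|Y s z| <= M).

Section errors.
Variables (eta : R) (G : sampling eta).
Local Notation tau := (smp_time G).
Local Notation c := (smp_coef G).
Local Notation N := (smp_size G).
Local Notation h p := (tau p.+1 - tau p).
Local Notation dW p z := (w (tau p.+1) z - w (tau p) z).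
Local Notation E p z := (grid_error w I tau c p z).

Definition smp_error1 z := \sum_(p < N) X (tau p) z * E p z.
Definition smp_error2 z := \sum_(p < N) E p z ^+ 2.
Definition smp_error3 z :=
  \sum_(p < N) Y (tau p) z * c p z ^+ 2 * (dW p z ^+ 2 - h p).
Definition smp_error4 z := \sum_(p < N) c p z ^+ 2 * (dW p z ^+ 2 - h p).

(** All summands are nonnegative, so one bound on the expectation of their sum controls every
    hypothesis that [path_estimate] makes on the errors. *)
Definition smp_error z : \bar R :=
  ((smp_error1 z ^+ 2)%:E + (smp_error2 z)%:E + (smp_error3 z ^+ 2)%:E +
   (smp_error4 z ^+ 2)%:E +
   \int[mu]_(s in `]0%R, t]) ((simple_value (smp G) s z - sigma s z) ^+ 2)%:E)%E.

Let tau_homo : {homo tau : i j / (i <= j)%N >-> i <= j}.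
Proof. by apply/nondecreasing_seqP; exact: smp_timeS. Qed.

Lemma smp_time_ge0 p : 0 <= tau p.
Proof. by rewrite -(smp_time0 G); exact: tau_homo. Qed.

Lemma smp_time_le p : (p <= N)%N -> tau p <= t.
Proof. by move=> pN; rewrite -(smp_timeN G); exact: tau_homo. Qed.

Lemma smp_error_ge0 z : (0 <= smp_error z)%E.
Proof.
apply: adde_ge0; last by apply: integral_ge0 => s _; rewrite lee_fin sqr_ge0.
rewrite !adde_ge0// ?lee_fin ?sqr_ge0//.
by apply: sumr_ge0 => p _; exact: sqr_ge0.
Qed.

Let mW p : measurable_fun setT (fun z => dW p z).
Proof.
apply: measurable_funB; apply: (measurable_atW F_usual) (smp_time_ge0 _) _;
  by case: w_wiener => + _ _ _ _; apply; exact: smp_time_ge0.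
Qed.

Let mc p : measurable_fun setT (c p).
Proof. apply: (measurable_atW F_usual (smp_time_ge0 p)).
exact: smp_coef_meas. Qed.

Let mE p : measurable_fun setT (fun z => E p z).
Proof.
apply: measurable_funB; last exact: measurable_funM.
by apply: measurable_funB; [have [] := iI (smp_time_ge0 p.+1)|have [] := iI (smp_time_ge0 p)].
Qed.

Let mXt p : measurable_fun setT (X (tau p)).
Proof. exact: (measurable_atW F_usual (smp_time_ge0 p) (X_adapted (smp_time_ge0 p))). Qed.

Let mYt p : measurable_fun setT (Y (tau p)).
Proof. exact: (measurable_atW F_usual (smp_time_ge0 p) (Y_adapted (smp_time_ge0 p))). Qed.

Let m1 : measurable_fun setT smp_error1.
Proof. by apply: measurable_sum => p; exact: measurable_funM. Qed.

Let m2 : measurable_fun setT smp_error2.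
Proof. by apply: measurable_sum => p; exact: measurable_funX. Qed.

Let md p : measurable_fun setT (fun z => dW p z ^+ 2 - h p).
Proof. by apply: measurable_funB; [exact: measurable_funX|exact: measurable_cst]. Qed.

Let m3 : measurable_fun setT smp_error3.
Proof.
apply: measurable_sum => p; apply: measurable_funM (md p).
by apply: measurable_funM => //; exact: measurable_funX.
Qed.

Let m4 : measurable_fun setT smp_error4.
Proof.
by apply: measurable_sum => p; apply: measurable_funM (md p); exact: measurable_funX.
Qed.

Let mS : jmeas t (fun s z => simple_value (smp G) s z - sigma s z).
Proof.
apply: jmeasB; first exact: (jmeas_simple_value F_usual).
by have [pH _ _ _] := iI t0; exact: (progressive_jmeas0 F_usual t0 pH).
Qed.

Let msq (f : T -> R) : measurable_fun setT f -> measurable_fun setT (fun z => (f z ^+ 2)%:E).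
Proof. by move=> mf; apply/measurable_EFinP; exact: measurable_funX. Qed.

Let m12 : measurable_fun setT (fun z => ((smp_error1 z ^+ 2)%:E + (smp_error2 z)%:E)%E).
Proof. by apply: emeasurable_funD; [exact: msq|exact/measurable_EFinP]. Qed.

Let m123 : measurable_fun setT (fun z => ((smp_error1 z ^+ 2)%:E + (smp_error2 z)%:E +
  (smp_error3 z ^+ 2)%:E)%E).
Proof. by apply: emeasurable_funD; [exact: m12|exact: msq]. Qed.

Let m1234 : measurable_fun setT (fun z => ((smp_error1 z ^+ 2)%:E + (smp_error2 z)%:E +
  (smp_error3 z ^+ 2)%:E + (smp_error4 z ^+ 2)%:E)%E).
Proof. by apply: emeasurable_funD; [exact: m123|exact: msq]. Qed.

Lemma measurable_smp_error : measurable_fun setT smp_error.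
Proof. by apply: emeasurable_funD; [exact: m1234|exact: jmeas_sqr_integral]. Qed.

Lemma integral_smp_error :
  (\int[P]_z smp_error z = \int[P]_z (smp_error1 z ^+ 2)%:E + \int[P]_z (smp_error2 z)%:E +
     \int[P]_z (smp_error3 z ^+ 2)%:E + \int[P]_z (smp_error4 z ^+ 2)%:E +
     sqnorm P t (fun s z => (simple_value (smp G) s z - sigma s z)%R))%E.
Proof.
have q0 (f : T -> R) z : [set: T] z -> (0 <= (f z ^+ 2)%:E)%E by rewrite lee_fin sqr_ge0.
have e2 z : [set: T] z -> (0 <= (smp_error2 z)%:E)%E.
  by move=> _; rewrite lee_fin; apply: sumr_ge0 => p _; exact: sqr_ge0.
have e12 z : [set: T] z -> (0 <= (smp_error1 z ^+ 2)%:E + (smp_error2 z)%:E)%E.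
  by move=> zT; apply: adde_ge0; [exact: q0|exact: e2].
have e123 z : [set: T] z ->
    (0 <= (smp_error1 z ^+ 2)%:E + (smp_error2 z)%:E + (smp_error3 z ^+ 2)%:E)%E.
  by move=> zT; apply: adde_ge0; [exact: e12|exact: q0].
have e1234 z : [set: T] z -> (0 <= (smp_error1 z ^+ 2)%:E + (smp_error2 z)%:E +
    (smp_error3 z ^+ 2)%:E + (smp_error4 z ^+ 2)%:E)%E.
  by move=> zT; apply: adde_ge0; [exact: e123|exact: q0].
rewrite (ge0_integralD _ measurableT e1234 m1234 _ (jmeas_sqr_integral mS)); last first.
  by move=> z _; apply: integral_ge0 => s _; rewrite lee_fin sqr_ge0.
rewrite (ge0_integralD _ measurableT e123 m123 (q0 _) (msq m4)).
rewrite (ge0_integralD _ measurableT e12 m12 (q0 _) (msq m3)).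
rewrite (ge0_integralD _ measurableT (q0 _) (msq m1) e2)//.
exact/measurable_EFinP.
Qed.

End errors.

Lemma exists_sampling (eta : R) : 0 < eta -> exists G : sampling eta,
  (\int[P]_z smp_error G z <= eta%:E)%E.
Proof.
(* The weighted errors, their squares and the distance to [sigma] cost 4 M^2, 4 and 1 times [e],
   together half of [eta]. *)
move=> eta0; pose e := eta / (2 * (4 * M ^+ 2 + 5)).
have M2 : 0 <= M ^+ 2 by exact: sqr_ge0.
have e0 : 0 < e by rewrite divr_gt0// mulr_gt0// ltr_pwDr// mulr_ge0.
have [_ _ _ [Sn [S1 _]]] := iI t0.
have [k _ /(_ k (leqnn k)) hk] := cvge0_lt e0 S1.
set S := Sn k in hk.
have [C hC] := choice (sp_coef_bounded S).
pose L := \sum_(j < sp_size S) C j.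
(* [b] collects the factors of [delta] in the two compensated sums, with weights bounded by M L^2
   and L^2. As it involves the bound [L] of the chosen [S], the mesh is fixed only now; these sums
   use up the other half of [eta]. *)
pose b := 65 * (M ^+ 2 + 1) * L ^+ 4 * t.
have b0 : 0 <= b.
  apply: mulr_ge0 => //; apply: mulr_ge0; last by rewrite (exprM _ 2 2) sqr_ge0.
  by rewrite mulr_ge0// addr_ge0.
pose delta := eta / (2 * (b + 1)).
have b1 : 0 < b + 1 by rewrite ltr_pwDr.
have d0 : 0 < delta by rewrite divr_gt0// mulr_gt0.
have de : delta <= eta.
  by rewrite ler_pdivrMr ?mulr_gt0// ler_peMr ?ltW//; move: b0; lra.
have [n n0 nd] : exists2 n, (0 < n)%N & t / n%:R <= delta.
  exists (Num.truncn (t / delta)).+1 => //.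
  rewrite ler_pdivrMr ?ltr0n// mulrC -ler_pdivrMr//.
  exact: ltW (truncnS_gt _).
have [N [tau [c [[tau0 tauS tauN mesh] [mc cL Sc]]]]] := simple_grid F_usual t0 n0 hC.
have mesh' p : tau p.+1 - tau p <= eta by apply: le_trans de; exact: le_trans nd.
pose G := Sampling tau0 tauS tauN mesh' mc (ex_intro _ L cL) Sc.
exists G; rewrite integral_smp_error.
have tau00 : 0 <= tau 0%N by rewrite tau0.
have tauNt : tau N <= t by rewrite tauN.
have meshd p : tau p.+1 - tau p <= delta by exact: le_trans nd.
have mX p : (p < N)%N -> measurable_at F (tau p) (X (tau p)).
  by move=> _; apply: X_adapted; exact: (smp_time_ge0 G).
have bc p : (p < N)%N -> bounded_rv (c p) by move=> _; exists L; exact: cL.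
have h1 := grid_error_weighted F_usual w_wiener t0 iI tau00 tauS tauNt
  (fun p _ => @mc p) bc Sc (ltW hk) mX (fun p z _ => XM (tau p) z).
have h2 := grid_error_sum_sqr F_usual w_wiener t0 iI tau00 tauS tauNt
  (fun p _ => @mc p) bc Sc (ltW hk).
have mc2 p : measurable_at F (tau p) (fun z => c p z ^+ 2) by exact: measurable_funX (@mc p).
have c2L p z : `|c p z ^+ 2| <= L ^+ 2.
  rewrite normrX ler_sqr ?nnegrE//; exact: le_trans (normr_ge0 (c p z)) (cL p z).
have mYc p : measurable_at F (tau p) (fun z => Y (tau p) z * c p z ^+ 2).
  by apply: measurable_funM (@mc2 p); apply: Y_adapted; exact: (smp_time_ge0 G).
have YcL p z : `|Y (tau p) z * c p z ^+ 2| <= M * L ^+ 2 by rewrite normrM ler_pM.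
have h3 := compensated_sqr_le F_usual w_wiener tau00 tauS tauNt meshd mYc YcL.
have h4 := compensated_sqr_le F_usual w_wiener tau00 tauS tauNt meshd mc2 c2L.
apply: le_trans (leeD (leeD (leeD (leeD h1 h2) h3) h4) (ltW hk)) _.
rewrite -!EFinD lee_fin.
have -> : 4 * M ^+ 2 * e + 4 * e + 65 * (M * L ^+ 2) ^+ 2 * delta * t +
    65 * (L ^+ 2) ^+ 2 * delta * t + e = (4 * M ^+ 2 + 5) * e + b * delta.
  by rewrite /b; ring.
have -> : (4 * M ^+ 2 + 5) * e = eta / 2.
  by rewrite /e; field; rewrite lt0r_neq0// ltr_pwDr// mulr_ge0.
have : b * delta <= (b + 1) * delta by rewrite ler_pM2r// lerDl.
have -> : (b + 1) * delta = eta / 2 by rewrite /delta; field; rewrite lt0r_neq0.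
lra.
Qed.

End sampling.

Section clip.
Context {R : realType}.
Implicit Types M r : R.

Definition clip M r := Num.max (- M) (Num.min M r).

Lemma norm_clip_le M r : 0 <= M -> `|clip M r| <= M.
Proof.
move=> M0; rewrite ler_norml /clip le_max lexx/= ge_max ge_min lexx/= andbT.
by rewrite lerNl (le_trans _ M0)// oppr_le0.
Qed.

Lemma clip_id M r : `|r| <= M -> clip M r = r.
Proof.
by rewrite ler_norml /clip => /andP[Mr rM]; rewrite (min_idPr rM) (max_idPr Mr).
Qed.

Lemma measurable_clip M : measurable_fun setT (clip M : measurableTypeR R -> R).
Proof.
apply: measurable_maxr; first exact: measurable_cst.
by apply: measurable_minr; [exact: measurable_cst|exact: measurable_id].
Qed.

End clip.

Section sampled_product.
Context {R : realType} {d : measure_display} {T : measurableType d}.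
Variables (P : probability T R) (F : R -> set (set T)) (w X : R -> T -> R).
Variables (t M eta : R) (G : sampling F t eta).
Hypotheses (X_adapted : adapted F X) (XM : forall s z, `|X s z| <= M).
Local Notation tau := (smp_time G).

Let coef p z := X (tau p) z * smp_coef G p z.

Let coef_meas p : measurable_at F (tau p) (coef p).
Proof.
apply: measurable_funM; last exact: smp_coef_meas.
by apply: X_adapted; exact: smp_time_ge0.
Qed.

Let coef_bounded p : exists C : R, forall z, `|coef p z| <= C.
Proof.
have [L hL] := smp_coef_bounded G; exists (M * L) => z.
by rewrite normrM; apply: ler_pM.
Qed.

Let time0 : 0 <= tau 0%N. Proof. exact: smp_time_ge0. Qed.

Definition smp_product : simple_process F :=
  SimpleProcess (smp_size G) time0 (smp_timeS G) coef_meas coef_bounded.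

Lemma smp_product_integral z : simple_integral w smp_product t z =
  \sum_(p < smp_size G) X (tau p) z * (smp_coef G p z *
     (w (tau p.+1) z - w (tau p) z)).
Proof.
apply: eq_bigr => p _ /=; rewrite mulrA.
by rewrite !(min_idPl _)//; apply: smp_time_le => //; exact: ltnW.
Qed.

Lemma smp_product_value p s z : (p < smp_size G)%N -> tau p < s <= tau p.+1 ->
  simple_value smp_product s z = X (tau p) z * smp_coef G p z.
Proof.
by move=> pN sp; exact: (grid_sum_eq (fun i => coef i z) (smp_timeS G) pN sp).
Qed.

End sampled_product.

(** * The Ito integral of X sigma *)

Section volterra_path.
Context {R : realType} {d : measure_display} {T : measurableType d}.
Variables (P : probability T R) (F : R -> set (set T)) (w a sigma u x I : R -> T -> R).
Hypotheses (F_usual : usual_filtration P F) (w_wiener : wiener P F w).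
Variables (t M K : R).
Hypotheses (t0 : 0 <= t) (M0 : 0 <= M) (K0 : 0 <= K).
Hypotheses (a_prog : progressive F `[0, +oo[ a) (aK : forall s z, 0 <= s -> `|a s z| <= K).
Hypotheses (sigma_prog : progressive F `[0, +oo[ sigma)
  (sigmaK : forall s z, 0 <= s -> `|sigma s z| <= K).
Hypotheses (x_adapted : adapted F x) (x_continuous : continuous_paths x).
Hypothesis u_prog : progressive F `]0, +oo[ u.
Hypothesis iI : forall r, 0 <= r -> is_ito_integral P F w sigma r (I r).
Hypothesis xI : forall r, 0 <= r -> {ae P, forall z, x r z = x 0 z
  + \int[lebesgue_measure]_(s in `]0, r]) a s z + I r z}.
Local Notation mu := (@lebesgue_measure R).
Let u_good z := mu.-integrable `]0, t] (EFin \o (u ^~ z)) /\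
  \int[mu]_(s in `]0, t]) `|u s z| <= M.
Hypothesis uM : {ae P, forall z, u_good z}.

Let X s z := pathX (x ^~ z) (u ^~ z) s.
Let Y s z := pathY (x ^~ z) (u ^~ z) s.
(** [X] is bounded by [M] only on almost every path, whereas the coefficients of a simple process
    must be bounded at every outcome. On good paths the truncation changes nothing. *)
Let Xc s z := clip M (X s z).
Let Yc s z := clip M (Y s z).

Let X_prog : progressive F `[0, +oo[ X.
Proof.
apply: (volterra_progressive F_usual) => //.
by apply: continuous_measurable_fun; exact: continuous_cos.
Qed.

Let Y_prog : progressive F `[0, +oo[ Y.
Proof.
apply: (volterra_progressive F_usual) => //.
by apply: continuous_measurable_fun; exact: continuous_sin.
Qed.

Let Xc_prog : progressive F `[0, +oo[ Xc.
Proof. exact: progressive_comp (measurable_clip M) X_prog. Qed.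

Let Yc_prog : progressive F `[0, +oo[ Yc.
Proof. exact: progressive_comp (measurable_clip M) Y_prog. Qed.

Let Xc_adapted : adapted F Xc := progressive_adapted Xc_prog.
Let Yc_adapted : adapted F Yc := progressive_adapted Yc_prog.
Let XcM s z : `|Xc s z| <= M. Proof. exact: norm_clip_le. Qed.
Let YcM s z : `|Yc s z| <= M. Proof. exact: norm_clip_le. Qed.

Let XcE s z : u_good z -> s <= t -> Xc s z = X s z.
Proof.
move=> [iu uz] st; apply: clip_id; apply: le_trans uz.
by apply: pathX_le => //; exact: continuous_within_itv.
Qed.

Let YcE s z : u_good z -> s <= t -> Yc s z = Y s z.
Proof.
move=> [iu uz] st; apply: clip_id; apply: le_trans uz.
by apply: pathY_le => //; exact: continuous_within_itv.
Qed.

(** The value that the claimed identity forces on the stochastic part: its right-hand side minus the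
    drift integral. *)
Definition volterra_limit z := Y t z +
  2^-1 * \int[mu]_(s in `]0, t]) (sigma s z ^+ 2 * Y s z) -
  \int[mu]_(s in `]0, t]) (X s z * a s z).

Let jm H : progressive F `[0, +oo[ H -> jmeas t H.
Proof. by move=> pH; exact: (progressive_jmeas0 F_usual t0 pH). Qed.

Let smp_estimate eta (G : sampling F t eta) z rho delta : u_good z ->
  (forall p, x (smp_time G p) z = x 0 z +
     \int[mu]_(s in `]0, smp_time G p]) a s z + I (smp_time G p) z) ->
  0 < rho -> rho <= 1 -> eta < delta -> eta <= rho ^+ 2 ->
  (forall r s, 0 <= r <= t -> 0 <= s <= t -> `|r - s| < delta ->
     [/\ `|x r z - x s z| <= rho, `|X r z - X s z| <= rho & `|Y r z - Y s z| <= rho]) ->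
  (smp_error w sigma I Xc Yc G z <= (rho ^+ 2)%:E)%E ->
  `|simple_integral w (smp_product G Xc_adapted XcM) t z - volterra_limit z| <=
  path_estimate_cst t M K * rho.
Proof.
move=> uz xz rho0 rho1 ed er modz; have [iu uMz] := uz.
rewrite /smp_error; set q := (\int[mu]_(s in _) _)%E => err.
have q0 : (0 <= q)%E by apply: integral_ge0 => s _; rewrite lee_fin sqr_ge0.
have e2_ge0 : 0 <= smp_error2 w I G z by apply: sumr_ge0 => p _; exact: sqr_ge0.
(* Since [q] is at most the total error it is finite, and [err] becomes an inequality of reals in
   which every nonnegative summand is at most rho^2. *)
have qfin : q \is a fin_num.
  rewrite ge0_fin_numE//; apply: le_lt_trans (ltry (rho ^+ 2)); apply: le_trans err.
  by rewrite leeDr// -!EFinD lee_fin !addr_ge0// ?sqr_ge0.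
move: err; rewrite -(fineK qfin) -!EFinD lee_fin => err.
have fq0 : 0 <= fine q by exact: fine_ge0.
have tau0 := smp_time_ge0 G; have taut := smp_time_le (G := G).
have sq (y : R) : y ^+ 2 <= rho ^+ 2 -> `|y| <= rho.
  by rewrite -[y ^+ 2]real_normK ?num_real// ler_sqr// nnegrE// ltW.
have [s1 s3 s4] : [/\ 0 <= smp_error1 w I Xc G z ^+ 2, 0 <= smp_error3 w Yc G z ^+ 2 &
    0 <= smp_error4 w G z ^+ 2] by rewrite !sqr_ge0.
rewrite smp_product_integral.
under eq_bigr => p _ do rewrite (XcE uz (taut _ (ltnW (ltn_ord p)))).
have ia r : r <= t -> mu.-integrable `]0, r] (EFin \o (a ^~ z)).
  move=> rt; apply: (@integrable_itvS _ _ 0 t) => //.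
  apply: (integrable_itv_bounded (C := K)).
    by apply: jmeas_section_time; exact: jm.
  by move=> s /andP[/ltW s0 _]; exact: aK.
have incell p s : (p < smp_size G)%N -> smp_time G p <= s <= smp_time G p.+1 ->
    0 <= s <= t.
  by move=> pN /andP[ps sp]; rewrite (le_trans (tau0 p) ps)/= (le_trans sp)// taut.
have dcell p s s' : (p < smp_size G)%N -> smp_time G p <= s <= smp_time G p.+1 ->
    smp_time G p <= s' <= smp_time G p.+1 -> `|s - s'| < delta.
  move=> pN /andP[ps sp] /andP[ps' sp']; apply: le_lt_trans ed.
  apply: le_trans (smp_mesh G p); rewrite ler_norml; apply/andP; split; lra.
have left p : smp_time G p <= smp_time G p <= smp_time G p.+1 by rewrite lexx smp_timeS.
have right p : smp_time G p <= smp_time G p.+1 <= smp_time G p.+1 by rewrite lexx smp_timeS.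
apply: (@path_estimate _ t M K (x ^~ z) (u ^~ z) (a ^~ z) (sigma ^~ z)
  (fun s => simple_value (smp G) s z) t0 _ iu uMz K0 _ _ _ _ _ _ (smp_size G) (smp_time G)
  (fun p => smp_coef G p z) (fun p => w (smp_time G p.+1) z - w (smp_time G p) z)
  (fun p => grid_error w I (smp_time G) (smp_coef G) p z) _ _ _ _ _ rho rho0 rho1).
- exact: continuous_within_itv.
- by apply: jmeas_section_time; exact: jm.
- by apply: jmeas_section_time; exact: jm.
- by apply: jmeas_section_time; exact: (jmeas_simple_value F_usual).
- by move=> s /andP[/ltW s0 _]; exact: aK.
- by move=> s /andP[/ltW s0 _]; exact: sigmaK.
- have [L hL] := smp_coef_bounded G; exists L => s st.
  have [|p pN sp] := @grid_cover _ (smp_size G) (smp_time G) s.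
    by rewrite smp_time0 smp_timeN.
  by rewrite (smp_value z pN sp).
- exact: smp_time0.
- exact: smp_timeS.
- exact: smp_timeN.
- by move=> p s pN sp; exact: smp_value.
- move=> p pN; rewrite !xz.
  rewrite (@Rintegral_itvD _ _ 0 (smp_time G p) (smp_time G p.+1)) ?smp_timeS ?tau0 ?ia ?taut//.
  by rewrite /grid_error; ring.
- move=> p s pN sp.
  by have [] := modz _ _ (incell _ _ pN (right p)) (incell _ _ pN sp) (dcell _ _ _ pN (right p) sp).
- move=> p s pN sp.
  by have [] := modz _ _ (incell _ _ pN (left p)) (incell _ _ pN sp) (dcell _ _ _ pN (left p) sp).
- move=> p s pN sp.
  by have [] := modz _ _ (incell _ _ pN (left p)) (incell _ _ pN sp) (dcell _ _ _ pN (left p) sp).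
- by move=> p; exact: le_trans (smp_mesh G p) er.
- have -> : \sum_(p < smp_size G) X (smp_time G p) z * grid_error w I (smp_time G) (smp_coef G) p z
      = smp_error1 w I Xc G z.
    by apply: eq_bigr => p _; rewrite XcE// taut// ltnW.
  by apply: sq; lra.
- rewrite -/(smp_error2 w I G z); lra.
- have -> : \sum_(p < smp_size G) Y (smp_time G p) z * (smp_coef G p z ^+ 2 *
      ((w (smp_time G p.+1) z - w (smp_time G p) z) ^+ 2 - (smp_time G p.+1 - smp_time G p)))
      = smp_error3 w Yc G z.
    by apply: eq_bigr => p _; rewrite YcE ?mulrA// taut// ltnW.
  by apply: sq; lra.
- rewrite -/(smp_error4 w G z); apply: le_trans rho1; apply: sq; lra.
- rewrite /Rintegral -/q; lra.
Qed.

Let eta n : R := 1 / (2 ^ n.+1)%:R.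

Let eta_lt e : 0 < e -> \forall n \near \oo, eta n < e.
Proof.
move=> e0; have := cvgr_lt 0 (@cvg_harmonic R) e e0.
move=> /(_ _)/filterS; apply=> n; apply: le_lt_trans.
by rewrite /eta div1r lef_pV2 ?posrE ?ltr0n ?expn_gt0// ler_nat ltnW// ltn_expl.
Qed.

Let integral_itv_cst (k : R) : (\int[mu]_(_ in `]0%R, t]) k%:E = (k * t)%:E)%E.
Proof.
rewrite integral_cst; last exact: measurable_itv.
have : mu `]0, t]%classic = t%:E; last by rewrite EFinM => e; congr (_ * _)%E; exact: e.
rewrite lebesgue_measure_itv/= lte_fin; case: ifPn => [_|].
  by rewrite -EFinB subr0.
by rewrite -leNgt => t0'; congr (_%:E); apply/eqP; rewrite eq_le t0' t0.
Qed.

Let eta0 n : 0 < eta n. Proof. by rewrite divr_gt0// ltr0n expn_gt0. Qed.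

Lemma measurable_volterra_limit : measurable_fun setT volterra_limit.
Proof.
have mR H : progressive F `[0, +oo[ H ->
    measurable_fun setT (fun z => \int[mu]_(s in `]0, t]) H s z).
  by move=> /jm; exact: jmeas_Rintegral.
apply: measurable_funB; last exact: (mR _ (progressiveM X_prog a_prog)).
apply: measurable_funD.
  exact: (measurable_atW F_usual t0 (progressive_adapted Y_prog t0)).
apply: measurable_funM; first exact: measurable_cst.
apply: (mR (fun s z => sigma s z ^+ 2 * Y s z)).
exact: (progressiveM (progressiveM sigma_prog sigma_prog) Y_prog).
Qed.

Section sampling_sequence.
Variable G : forall n, sampling F t (eta n).
Hypothesis G_error :
  forall n, (\int[P]_z smp_error w sigma I Xc Yc (G n) z <= (eta n)%:E)%E.
Local Notation prod n := (smp_product (G n) Xc_adapted XcM).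

Let m_error n : measurable_fun setT (smp_error w sigma I Xc Yc (G n)).
Proof. exact: (measurable_smp_error F_usual w_wiener t0 iI Xc_adapted Yc_adapted). Qed.

(** The total errors have summable expectations, so on almost every path they fall below any rho^2,
    and [smp_estimate] applies with arbitrarily small [rho]. *)
Lemma smp_product_integral_cvg : {ae P, forall z,
  simple_integral w (prod n) t z @[n --> \oo] --> volterra_limit z}.
Proof.
have err0 : {ae P, forall z, smp_error w sigma I Xc Yc (G n) z @[n --> \oo] --> 0%E}.
  apply: (@ae_cvg0_of_summable _ _ _ P (fun n => smp_error w sigma I Xc Yc (G n)) (fun n => @m_error n)) => //.
  by move=> n z; exact: smp_error_ge0.
(* For each time the Ito decomposition of [x] has its own null set; only the countably many sampling
   times are needed. *)
have xz : {ae P, forall z, forall n p, x (smp_time (G n) p) z = x 0 z +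
     \int[mu]_(s in `]0, smp_time (G n) p]) a s z + I (smp_time (G n) p) z}.
  by apply/ae_foralln => n; apply/ae_foralln => p; apply: xI; exact: smp_time_ge0.
apply: filterS3 uM xz err0 => z uz xz err0; have [iu uMz] := uz.
have cxz : {within `[0, t], continuous (x ^~ z)} by exact: continuous_within_itv.
apply/cvgrPdist_le => e e0.
pose C := `|path_estimate_cst t M K| + 1.
have C0 : 0 < C by rewrite ltr_wpDl.
pose rho := Num.min 1 (e / C).
have rho0 : 0 < rho by rewrite lt_min ltr01 divr_gt0.
have rho1 : rho <= 1 by rewrite ge_min lexx.
have Crho : path_estimate_cst t M K * rho <= e.
  apply: (@le_trans _ _ (C * rho)).
    by rewrite ler_pM2r//; apply: le_trans (ler_norm _) _; rewrite lerDl.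
  by rewrite mulrC -ler_pdivlMr// /rho ge_min lexx orbT.
have [d1 d10 h1] := within_unif_continuous cxz rho0.
have [d2 d20 h2] := within_unif_continuous (@pathX_continuous _ _ _ _ t0 cxz iu) rho0.
have [d3 d30 h3] := within_unif_continuous (@pathY_continuous _ _ _ _ t0 cxz iu) rho0.
pose delta := Num.min d1 (Num.min d2 d3).
have delta0 : 0 < delta by rewrite !lt_min d10 d20.
have rho20 : 0 < rho ^+ 2 by rewrite exprn_gt0.
near=> n; rewrite distrC; apply: le_trans Crho.
apply: (@smp_estimate _ _ _ _ delta) => //.
- by near: n; exact: eta_lt.
- by rewrite ltW//; near: n; exact: eta_lt.
- move=> r s rt st; rewrite !lt_min => /andP[/(h1 _ _ rt st)/ltW ? /andP[]].
  by move=> /(h2 _ _ rt st)/ltW ? /(h3 _ _ rt st)/ltW ?.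
- by rewrite ltW//; near: n; exact: cvge0_lt.
Unshelve. all: by end_near. Qed.

(** [Xc] frozen at left endpoints, an intermediate between the product of samples and [Xc] times
    [sigma]. *)
Let frozen n s z := \sum_(p < smp_size (G n)) Xc (smp_time (G n) p) z *
  \1_(`]smp_time (G n) p, smp_time (G n) p.+1]%classic) s.

Let jm_frozen n : jmeas t (frozen n).
Proof.
apply: measurable_sum => p; apply: jmeas_rv_indic.
exact: (measurable_atW F_usual (smp_time_ge0 _ _) (Xc_adapted (smp_time_ge0 _ _))).
Qed.

Let cell n s : 0 < s <= t -> exists2 p, (p < smp_size (G n))%N &
  smp_time (G n) p < s <= smp_time (G n) p.+1.
Proof. by move=> st; apply: grid_cover; rewrite smp_time0 smp_timeN. Qed.

Let frozenE n s z p : (p < smp_size (G n))%N ->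
  smp_time (G n) p < s <= smp_time (G n) p.+1 -> frozen n s z = Xc (smp_time (G n) p) z.
Proof. by move=> pN sp; exact: (grid_sum_eq (fun p => Xc _ z) (smp_timeS (G n)) pN sp). Qed.

Let jmXc : jmeas t Xc := jm Xc_prog.
Let jms : jmeas t sigma := jm sigma_prog.

Let jm_gap n : jmeas t (fun s z => simple_value (smp (G n)) s z - sigma s z).
Proof. by apply: jmeasB => //; exact: (jmeas_simple_value F_usual). Qed.

Let jm_lag n : jmeas t (fun s z => frozen n s z - Xc s z).
Proof. exact: jmeasB. Qed.

Lemma smp_sqnorm_le n :
  (sqnorm P t (fun s z => (simple_value (smp (G n)) s z - sigma s z)%R) <= (eta n)%:E)%E.
Proof.
apply: le_trans (G_error n).
rewrite (integral_smp_error F_usual w_wiener t0 iI Xc_adapted Yc_adapted) leeDr//.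
have i0 (f : T -> R) : (forall z, 0 <= f z) -> (0 <= \int[P]_z (f z)%:E)%E.
  by move=> f0; apply: integral_ge0 => z _; rewrite lee_fin.
by do 3 (apply: adde_ge0; last by apply: i0 => z; rewrite ?sqr_ge0//;
  apply: sumr_ge0 => p _; exact: sqr_ge0);
  apply: i0 => z; exact: sqr_ge0.
Qed.

(** On a good path [X] is uniformly continuous, so the time integral tends to 0; it is bounded by (2
    M)^2 t, and bounded convergence gives the expectation. *)
Lemma frozen_cvg : sqnorm P t (fun s z => frozen n s z - Xc s z) @[n --> \oo] --> 0%E.
Proof.
apply: (bounded_integral_cvg0 (C := (2 * M) ^+ 2 * t)).
- by move=> n; exact: jmeas_sqr_integral.
- move=> n z; apply/andP; split.
    by apply: integral_ge0 => s _; rewrite lee_fin sqr_ge0.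
  apply: (@le_trans _ _ (\int[mu]_(s in `]0%R, t]) ((2 * M) ^+ 2)%:E)%E).
    apply: ge0_le_integral => //.
    + by move=> s _; rewrite lee_fin sqr_ge0.
    + apply/measurable_EFinP; apply: measurable_funX.
      exact: jmeas_section_time (jm_lag n).
    move=> s; rewrite /= in_itv/= => st; rewrite lee_fin.
    have [p pN sp] := cell n st; rewrite (frozenE z pN sp).
    rewrite -real_normK ?num_real// ler_sqr ?nnegrE ?mulr_ge0//.
    by apply: le_trans (ler_normB _ _) _; rewrite mulr_natl mulr2n lerD.
  by rewrite integral_itv_cst.
apply: filterS uM => z uz; have [iu uMz] := uz.
have cxz : {within `[0, t], continuous (x ^~ z)} by exact: continuous_within_itv.
apply: ge0_cvge0 => [n|e e0].
  by apply: integral_ge0 => s _; rewrite lee_fin sqr_ge0.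
pose rho := Num.sqrt (e / (t + 1)).
have t1 : 0 < t + 1 by rewrite ltr_pwDr.
have rho0 : 0 < rho by rewrite sqrtr_gt0 divr_gt0.
have rhoE : rho ^+ 2 * t <= e.
  rewrite sqr_sqrtr; last by rewrite divr_ge0 ?(ltW e0) ?(ltW t1).
  by rewrite mulrAC ler_pdivrMr// ler_pM2l// lerDl.
have [delta d0 hd] := within_unif_continuous (@pathX_continuous _ _ _ _ t0 cxz iu) rho0.
apply: filterS (eta_lt d0) => n nd.
apply: (@le_trans _ _ (\int[mu]_(s in `]0%R, t]) (rho ^+ 2)%:E)%E); last first.
  by rewrite integral_itv_cst lee_fin.
apply: ge0_le_integral => //.
- by move=> s _; rewrite lee_fin sqr_ge0.
- apply/measurable_EFinP; apply: measurable_funX.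
  exact: jmeas_section_time (jm_lag n).
move=> s; rewrite /= in_itv/= => st; rewrite lee_fin.
have [p pN sp] := cell n st; rewrite (frozenE z pN sp).
have pt : smp_time (G n) p <= t by apply: smp_time_le; exact: ltnW.
have /andP[s0 st'] := st; have /andP[ps sp'] := sp.
rewrite !XcE// -real_normK ?num_real// ler_sqr ?nnegrE ?(ltW rho0)//; apply/ltW/hd.
- by rewrite smp_time_ge0.
- by rewrite ltW.
rewrite distrC gtr0_norm ?subr_gt0//; apply: le_lt_trans nd.
by apply: le_trans (smp_mesh (G n) p); rewrite lerD2r.
Qed.

Let H s z := Xc s z * sigma s z.
Let jmH : jmeas t H := jmeasM jmXc jms.
Let jm_prod n : jmeas t (fun s z => simple_value (prod n) s z - H s z).
Proof. by apply: jmeasB => //; exact: (jmeas_simple_value F_usual). Qed.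

Lemma smp_product_cvg :
  sqnorm P t (fun s z => simple_value (prod n) s z - H s z) @[n --> \oo] --> 0%E.
Proof.
pose C := 2 * (M ^+ 2 + K ^+ 2).
have C0 : 0 <= C by rewrite mulr_ge0// addr_ge0// sqr_ge0.
have le n : (sqnorm P t (fun s z => (simple_value (prod n) s z - H s z)%R) <=
    C%:E * (sqnorm P t (fun s z => (simple_value (smp (G n)) s z - sigma s z)%R) +
            sqnorm P t (fun s z => (frozen n s z - Xc s z)%R)))%E.
  apply: sqnorm_le2 => // s z st; have [p pN sp] := cell n st.
  rewrite (smp_product_value Xc_adapted XcM z pN sp) (smp_value z pN sp) (frozenE z pN sp) /H /C.
  have M2 : Xc (smp_time (G n) p) z ^+ 2 <= M ^+ 2.
    by rewrite -real_normK ?num_real// ler_sqr ?nnegrE.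
  have K2 : sigma s z ^+ 2 <= K ^+ 2.
    rewrite -real_normK ?num_real// ler_sqr ?nnegrE//; apply: sigmaK.
    by case/andP: st => /ltW.
  move: (Xc _ z) (Xc s z) (smp_coef _ _ _) (sigma s z) M2 K2 => X1 X2 c b M2 K2.
  (* The sampled coefficient [c], which has no bound uniform in [n], appears only in [c - b]; the
     other factors are bounded by [M] and [K], whence the constant 2 (M^2 + K^2). *)
  have -> : X1 * c - X2 * b = X1 * (c - b) + (X1 - X2) * b by ring.
  apply: (@le_trans _ _ (2 * (X1 ^+ 2 * (c - b) ^+ 2 + (X1 - X2) ^+ 2 * b ^+ 2))).
    have := sqr_ge0 (X1 * (c - b) - (X1 - X2) * b); nra.
  rewrite -mulrA ler_pM2l//.
  have h1 : X1 ^+ 2 * (c - b) ^+ 2 <= M ^+ 2 * (c - b) ^+ 2 by rewrite ler_wpM2r ?sqr_ge0.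
  have h2 : (X1 - X2) ^+ 2 * b ^+ 2 <= K ^+ 2 * (X1 - X2) ^+ 2.
    by rewrite mulrC ler_wpM2r ?sqr_ge0.
  have h3 : 0 <= M ^+ 2 * (X1 - X2) ^+ 2 by rewrite mulr_ge0 ?sqr_ge0.
  have h4 : 0 <= K ^+ 2 * (c - b) ^+ 2 by rewrite mulr_ge0 ?sqr_ge0.
  by rewrite mulrDl !mulrDr; lra.
apply: ge0_cvge0 => [n|e e0]; first exact: sqnorm_ge0.
pose r := e / (2 * (C + 1)).
have C1 : 0 < C + 1 by rewrite ltr_wpDl.
have r0 : 0 < r by rewrite divr_gt0// mulr_gt0.
near=> n; apply: le_trans (le n) _.
apply: (@le_trans _ _ (C%:E * (r%:E + r%:E))%E).
  apply: lee_mul2l_EFin => //; apply: leeD.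
    apply: le_trans (smp_sqnorm_le n) _; rewrite lee_fin ltW//.
    by near: n; exact: eta_lt.
  by rewrite ltW//; near: n; exact: cvge0_lt frozen_cvg.
rewrite -EFinD -EFinM lee_fin.
have -> : C * (r + r) = C / (C + 1) * e.
  by rewrite /r; field; rewrite lt0r_neq0.
by rewrite ler_piMl ?(ltW e0)// ler_pdivrMr// mul1r lerDl.
Unshelve. all: by end_near. Qed.

Lemma smp_product_integral_cvg_L2 :
  (\int[P]_z ((simple_integral w (prod n) t z - volterra_limit z) ^+ 2)%:E)%E
     @[n --> \oo] --> 0%E.
Proof.
apply: ae_cvg_L2.
- by move=> n; exact: (simple_integral_measurable F_usual w_wiener).
- exact: measurable_volterra_limit.
- exact: smp_product_integral_cvg.
move=> e e0; have e4 : 0 < e / 4 by rewrite divr_gt0.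
have [N _ hN] := cvge0_lt e4 smp_product_cvg.
exists N => n m /hN/= hn /hN/= hm.
rewrite (simple_integral_isometry F_usual w_wiener)//.
apply: (@le_trans _ _ (2%:E * ((e / 4)%:E + (e / 4)%:E))%E).
  apply: (@le_trans _ _ (2%:E * (sqnorm P t (fun s z => simple_value (prod n) s z - H s z)%R +
     sqnorm P t (fun s z => simple_value (prod m) s z - H s z)%R))%E); last first.
    by apply: lee_mul2l_EFin; [exact: ler0n|apply: leeD; [exact: ltW hn|exact: ltW hm]].
  apply: sqnorm_le2 => //.
    by apply: jmeasB; exact: (jmeas_simple_value F_usual).
  move=> s z _; have := sqr_ge0 (simple_value (prod n) s z - H s z +
    (simple_value (prod m) s z - H s z)); nra.
by rewrite -EFinD -EFinM lee_fin; lra.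
Qed.

End sampling_sequence.

Lemma ae_sqnorm f g : jmeas t f -> jmeas t g ->
  {ae P, forall z, forall s, 0 < s <= t -> f s z = g s z} ->
  sqnorm P t f = sqnorm P t g.
Proof.
move=> mf mg fg; apply: ge0_ae_eq_integral => //.
- exact: jmeas_sqr_integral.
- exact: jmeas_sqr_integral.
- by move=> z _; apply: integral_ge0 => s _; rewrite lee_fin sqr_ge0.
- by move=> z _; apply: integral_ge0 => s _; rewrite lee_fin sqr_ge0.
apply: filterS fg => z fg _; apply: eq_integral => s; rewrite inE/= in_itv/= => st.
by rewrite fg.
Qed.

Let XcE_ae : {ae P, forall z, forall s, 0 < s <= t -> Xc s z = X s z}.
Proof. by apply: filterS uM => z uz s /andP[_ st]; exact: XcE. Qed.

(** The approximating simple processes are built from [Xc]; since [Xc] and [X] agree up to time [t]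
    on almost every path, all norms are those for [X]. *)
Lemma ito_volterra :
  is_ito_integral P F w (fun s z => X s z * sigma s z) t volterra_limit.
Proof.
have pH : progressive F `[0, +oo[ (fun s z => X s z * sigma s z).
  exact: progressiveM X_prog sigma_prog.
have jXs : jmeas t (fun s z => Xc s z * sigma s z) by apply: jmeasM; exact: jm.
split=> //; last 2 first.
- exact: measurable_volterra_limit.
- have ex n := cid (exists_sampling F_usual w_wiener t0 iI Xc_adapted Yc_adapted XcM YcM (eta0 n)).
  pose G n := projT1 (ex n); have hG n : (\int[P]_z smp_error w sigma I Xc Yc (G n) z <= (eta n)%:E)%E.
    exact: projT2 (ex n).
  exists (fun n => smp_product (G n) Xc_adapted XcM); split.
    have := smp_product_cvg hG; apply: cvg_trans; apply: near_eq_cvg; apply: nearW => n.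
    apply: ae_sqnorm.
    + by apply: jmeasB => //; exact: (jmeas_simple_value F_usual).
    + by apply: jmeasB; [exact: (jmeas_simple_value F_usual)|exact: jm].
    + by apply: filterS XcE_ae => z h s st; rewrite h.
  exact: smp_product_integral_cvg_L2 hG.
rewrite -/(sqnorm P t (fun s z => X s z * sigma s z)).
rewrite -(@ae_sqnorm (fun s z => Xc s z * sigma s z)); [|done|exact: jm|]; last first.
  by apply: filterS XcE_ae => z h s st; rewrite h.
apply: (@le_lt_trans _ _ (\int[P]_z ((M * K) ^+ 2 * t)%:E)%E); last first.
  by apply: (integrable_lty measurableT); exact: finite_measure_integrable_cst.
apply: ge0_le_integral => //.
- by move=> z _; apply: integral_ge0 => s _; rewrite lee_fin sqr_ge0.
- exact: jmeas_sqr_integral.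

move=> z _; rewrite -integral_itv_cst; apply: ge0_le_integral => //.
- by move=> s _; rewrite lee_fin sqr_ge0.
- by apply/measurable_EFinP; apply: measurable_funX; exact: (jmeas_section_time z jXs).
move=> s; rewrite /= in_itv/= => /andP[/ltW s0 _]; rewrite lee_fin.
rewrite -real_normK ?num_real// ler_sqr ?nnegrE ?mulr_ge0// normrM.
by apply: ler_pM => //; exact: sigmaK.
Qed.

Lemma volterra_drift_integrable : {ae P, forall z,
  mu.-integrable `]0, t] (fun s => (X s z * a s z)%:E)}.
Proof.
apply: filterS uM => z [iu uz].
apply: (integrable_itv_bounded (C := M * K)).
  by apply: measurable_funM; apply: jmeas_section_time; exact: jm.
move=> s /andP[s0 st]; rewrite normrM; apply: ler_pM => //; last exact/aK/ltW.
apply: le_trans uz; apply: pathX_le => //; exact: continuous_within_itv.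
Qed.

End volterra_path.

(** * The theorem *)

Section path_modulus.
Context {R : realType}.
Local Notation mu := (@lebesgue_measure R).
Variables (t : R) (xx u : R -> R).
Hypotheses (t0 : 0 <= t) (cx : {within `[0, t], continuous xx}).
Hypothesis iu : mu.-integrable `]0, t] (EFin \o u).

Lemma path_modulus_le : Num.sqrt (pathX xx u t ^+ 2 + pathY xx u t ^+ 2) <=
  \int[mu]_(s in `]0, t]) `|u s|.
Proof.
set X := pathX xx u t; set Y := pathY xx u t; set r := Num.sqrt _.
have r2 : r ^+ 2 = X ^+ 2 + Y ^+ 2 by rewrite sqr_sqrtr// addr_ge0// sqr_ge0.
(* The case r = 0 is set apart, because the inequality is proved after multiplication by [r]. *)
have := sqrtr_ge0 (X ^+ 2 + Y ^+ 2); rewrite -/r le_eqVlt => /predU1P[<-|r0].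
  by apply: Rintegral_ge0.
have ic := @integrable_cos_path _ _ _ _ cx iu (xx t).
have is_ := @integrable_sin_path _ _ _ _ cx iu (xx t).
have icX : mu.-integrable `]0, t] (EFin \o (fun s => X * (cos (xx t - xx s) * u s))).
  exact: integrable_EFinZl.
have isY : mu.-integrable `]0, t] (EFin \o (fun s => Y * (sin (xx t - xx s) * u s))).
  exact: integrable_EFinZl.
have iau : mu.-integrable `]0, t] (EFin \o (fun s => `|u s|)) by exact: integrable_norm.
rewrite -(ler_pM2l r0) -expr2 r2 2!expr2 {2}/X {2}/Y.
rewrite -RintegralZl// -RintegralZl// -RintegralZl// -RintegralD//.
apply: le_Rintegral => //.
- exact: integrable_EFinD.
- exact: integrable_EFinZl.
move=> s _; rewrite !mulrA -mulrDl; apply: le_trans (ler_norm _) _.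
rewrite normrM ler_wpM2r//.
rewrite -ler_sqr ?nnegrE ?(ltW r0)// real_normK ?num_real// r2.
have := cos2Dsin2 (xx t - xx s); set C := cos _; set S := sin _ => e.
have -> : X ^+ 2 + Y ^+ 2 = (X ^+ 2 + Y ^+ 2) * (C ^+ 2 + S ^+ 2) by rewrite e mulr1.
(* Lagrange's identity: this square is the defect in (X C + Y S)^2 <= (X^2 + Y^2) (C^2 + S^2). *)
have := sqr_ge0 (X * S - Y * C); nra.
Qed.

End path_modulus.

Section ess_bounded_input.
Context {R : realType} {d : measure_display} {T : measurableType d}.
Variables (P : probability T R) (u : R -> T -> R).
Local Notation mu := (@lebesgue_measure R).

Lemma ess_bounded_input t : 0 <= t ->
  (forall t, 0 < t -> {ae P, forall z, mu.-integrable `]0, t] (fun s => (u s z)%:E)}) ->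
  (forall t, 0 < t ->
     (ess_sup P (fun z => \int[mu]_(s in `]0%R, t]) (`|u s z|%:E)) < +oo)%E) ->
  exists2 M, 0 <= M & {ae P, forall z, mu.-integrable `]0, t] (EFin \o (u ^~ z)) /\
    \int[mu]_(s in `]0, t]) `|u s z| <= M}.
Proof.
rewrite le_eqVlt => /predU1P[<- _ _|t0 iu eu].
  exists 0 => //; apply: nearW => z; rewrite set_itvoc0 Rintegral_set0; split=> //.
  exact: integrable_set0.
have := eu t t0; have := ess_sup_ge P (fun z => \int[mu]_(s in `]0%R, t]) (`|u s z|%:E))%E.
case: (ess_sup _ _) => [r| |]//= ur _; last first.
  (* If the essential supremum were -oo, a nonnegative integral would be at most -oo on almost every
     path, which is absurd there. *)
  exists 0 => //; apply: filterS ur => z; rewrite leeNy_eq => /eqP uz.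
  have : (0 <= \int[mu]_(s in `]0%R, t]) (`|u s z|%:E))%E.
    by apply: integral_ge0 => s _; rewrite lee_fin.
  by rewrite uz.
exists (Num.max 0 r); first by rewrite le_max lexx.
apply: filterS2 ur (iu t t0) => z uz iuz; split=> //.
rewrite le_max; apply/orP; right; rewrite /Rintegral -lee_fin fineK//.
exact: integrable_fin_num (integrable_norm iuz).
Qed.

End ess_bounded_input.

Theorem theorem2p1 (R : realType) (d : measure_display) (T : measurableType d)
    (P : probability T R) (F : R -> set (set T))
    (w a sigma u x : R -> T -> R)
    (P_complete : measure_is_complete P)
    (F_usual : usual_filtration P F)
    (w_wiener : wiener P F w)
    (a_prog : progressive F `[0, +oo[ a) (a_bounded : bounded_process a)
    (sigma_prog : progressive F `[0, +oo[ sigma)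
    (sigma_bounded : bounded_process sigma)
    (x_adapted : adapted F x) (x_continuous : continuous_paths x)
    (x_ito : ito_process P F w a sigma x)
    (u_prog : progressive F `]0, +oo[ u)
    (u_integrable : forall t, 0 < t -> {ae P, forall omega,
       lebesgue_measure.-integrable `]0, t] (fun s => (u s omega)%:E)})
    (u_ess_sup : forall t, 0 < t ->
       (ess_sup P (fun omega =>
          \int[lebesgue_measure]_(s in `]0%R, t]) (`|u s omega|%:E)) < +oo)%E) :
  let X t omega : R := \int[lebesgue_measure]_(s in `]0, t])
                     (cos (x t omega - x s omega) * u s omega) in
  let Y t omega : R := \int[lebesgue_measure]_(s in `]0, t])
                     (sin (x t omega - x s omega) * u s omega) in
  (forall t, 0 <= t ->
     (exists J, is_ito_process_integral P F w a sigma X t J) /\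
     (forall J, is_ito_process_integral P F w a sigma X t J ->
        {ae P, forall omega, J omega = Y t omega +
           2^-1 * \int[lebesgue_measure]_(s in `]0, t])
                    (sigma s omega ^+ 2 * Y s omega)})) /\
  (forall t, 0 <= t ->
     {ae P, forall omega, Num.sqrt (X t omega ^+ 2 + Y t omega ^+ 2)
        <= \int[lebesgue_measure]_(s in `]0, t]) `|u s omega|}).

Proof.
move=> X Y; split=> t t0; last first.
  have [M M0 uM] := ess_bounded_input t0 u_integrable u_ess_sup.
  apply: filterS uM => z [iu _]; apply: (@path_modulus_le _ _ (x ^~ z) (u ^~ z)) => //.
  exact: continuous_within_itv.
have [M M0 uM] := ess_bounded_input t0 u_integrable u_ess_sup.
have [Ca aC] := a_bounded; have [Cs sC] := sigma_bounded.
pose K := Num.max 0 (Num.max Ca Cs).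
have K0 : 0 <= K by rewrite le_max lexx.
have aK s z : 0 <= s -> `|a s z| <= K by move=> /aC h; rewrite !le_max h orbT.
have sK s z : 0 <= s -> `|sigma s z| <= K by move=> /sC h; rewrite !le_max h !orbT.
(* One version of the integral of [sigma] is fixed at every time, with a dummy value at negative
   times, since the sampling arguments evaluate it along whole grids. *)
have /choice[I II] : forall r, exists J, 0 <= r -> is_ito_integral P F w sigma r J /\
    {ae P, forall z, x r z = x 0 z + \int[lebesgue_measure]_(s in `]0, r]) a s z + J z}.
  move=> r; have [r0|r0] := leP 0 r; last by exists (fun=> 0).
  by have [J iJ xJ] := x_ito _ r0; exists J.
have iI r : 0 <= r -> is_ito_integral P F w sigma r (I r) by move=> /II[].
have xI r : 0 <= r -> {ae P, forall z, x r z = x 0 z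
    + \int[lebesgue_measure]_(s in `]0, r]) a s z + I r z} by move=> /II[].
have iV := ito_volterra F_usual w_wiener t0 M0 K0 a_prog aK sigma_prog sK x_adapted
  x_continuous u_prog iI xI uM.
have iXa := volterra_drift_integrable F_usual t0 a_prog aK x_adapted x_continuous u_prog uM.
split.
  exists (fun z => Y t z + 2^-1 * \int[lebesgue_measure]_(s in `]0, t]) (sigma s z ^+ 2 * Y s z)).
  exists (volterra_limit a sigma u x t) => //.
  apply: filterS iXa => z iz; split=> //.
  by rewrite /volterra_limit addrCA subrr addr0.
(* Any other [J] comes with its own version [I'] of the stochastic part; uniqueness identifies it
   with [volterra_limit], and the drift integrals cancel. *)
move=> J [I' iI' J_eq].
have := ito_integral_unique F_usual w_wiener t0 iI' iV.
apply: filterS2 J_eq => z [_ ->] ->.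
by rewrite /volterra_limit addrCA subrr addr0.
Qed.
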